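(* Let $m$ be a positive integer satisfying $km\equiv k\pmod{12}$. Then the formula $$T^{v}_{m,k}f(z)=\frac{1}{\sqrt m}\sum_{ad=m,\ d>0}\chi_k(d)\sum_{b\bmod d}\xi^{-bd}f\left(\frac{az+b}{d}\right)$$ defines a (Hecke) operator $T^{v}_{m,k}:\mathcal{M}(\Gamma,v,k,R)\to\mathcal{M}(\Gamma,v,k,R)$. If $f$ has Fourier coefficients $c(n)$, i.e. $f=\sum_n c(n)\mathcal{W}_{n,k,R}$, then $T^{v}_{m,k}f$ has Fourier coefficients $$d(n)=\sum_{0<a\mid\left(m,\;n-k\frac{m-1}{12}\right)}\chi_k(a)\,c\left(\frac{nm}{a^2}+\frac{k(m-a^2)}{12a^2}\right).$$ If $T^{v}_{m,k}f=\lambda_{m,k}f$ and $c(0)\ne0$, then $$\lambda_{m,k}=\frac{1}{c(0)}\begin{cases}c\left(k\frac{m-1}{12}\right),&(D,m)=1,\\[2pt] c\left(k\frac{m-1}{12}\right)+\chi_k(D)\,c\left(k\frac{m-D^2}{12D^2}\right),&(D,m)>1.\end{cases}$$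
   Context: Let $\mathcal{H}$ be the upper half-plane, $\overline{\Gamma}=SL(2,\mathbb{Z})$, $\Gamma=PSL(2,\mathbb{Z})$, $e(z)=e^{2\pi i z}$; $(a,b)$ denotes the greatest common divisor, with $(a,0)=a$; $\mathrm{Arg}$ takes values in $]-\pi,\pi]$. Fix an integer $k$ with $1\le k\le 11$ and put $D=\frac{k}{(12,k)}$, $\xi=e(k/12)$ and $\chi_k(d)=i^{k(d-1)}$ for integers $d$. Let $v=v_\eta^{2k}:\overline{\Gamma}\to S^1$ be the weight $k$ multiplier system of $\eta^{2k}$, i.e. $\eta(gz)^{2k}=v(g)(cz+d)^k\eta(z)^{2k}$ for $g=\begin{pmatrix}a&b\\c&d\end{pmatrix}\in\overline{\Gamma}$, where $\eta(z)=e(z/24)\prod_{n\ge1}(1-e(nz))$; in particular $v\begin{pmatrix}1&1\\0&1\end{pmatrix}=\xi$. Fix a real $R$ with $\lambda=\frac14+R^2>\frac14$. $\mathcal{M}(\Gamma,v,k,R)$ is the space of Maass waveforms: functions $f$ on $\mathcal{H}$ with $f(gz)=v(g)\,e^{ik\mathrm{Arg}(cz+d)}f(z)$ for all $g=\begin{pmatrix}a&b\\c&d\end{pmatrix}\in\overline{\Gamma}$, with $(\Delta_k+\lambda)f=0$, where $\Delta_k=y^2\left(\frac{\partial^2}{\partial x^2}+\frac{\partial^2}{\partial y^2}\right)-iky\frac{\partial}{\partial x}$, and with $\int_{\Gamma\backslash\mathcal{H}}|f|^2\frac{dx\,dy}{y^2}<\infty$. Every such $f$ has a Fourier expansion $f(z)=\sum_{n\in\mathbb{Z}}c(n)\mathcal{W}_{n,k,R}(z)$,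 where, for $z=x+iy$ and $\alpha_k=\frac{k}{12}$, $$\mathcal{W}_{n,k,R}(z)=\frac{1}{\sqrt{|n+\alpha_k|}}\,W_{\frac k2\mathrm{sgn}(n+\alpha_k),\,iR}\left(4\pi|n+\alpha_k|y\right)e\left((n+\alpha_k)x\right)$$ and $W_{l,\mu}$ is the Whittaker $W$-function. *)

(* Defs.v *)
(* Stdlib reals and Coquelicot complex numbers. *)
From Stdlib Require Import Reals ZArith List Lia.
From Coquelicot Require Import Coquelicot.

Open Scope R_scope.

(** * Complex functions *)

Definition Cexp (z : C) : C :=
  RtoC (exp (Re z)) * (cos (Im z), sin (Im z)).

(* e(z) = exp (2 pi i z) *)
Definition e (z : C) : C := Cexp (RtoC (2 * PI) * Ci * z).

(* Principal argument, with values in ]-PI, PI] for z <> 0. *)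
Definition Arg (z : C) : R :=
  if Rle_dec 0 (Im z) then acos (Re z / Cmod z) else - acos (Re z / Cmod z).

Definition CpowZ (z : C) (n : Z) : C :=
  match n with
  | Z0 => RtoC 1
  | Zpos p => Cpow z (Pos.to_nat p)
  | Zneg p => Cinv (Cpow z (Pos.to_nat p))
  end.

(* t ^ s for real t > 0 and complex s *)
Definition Rcpow (t : R) (s : C) : C := Cexp (s * RtoC (ln t)).

Definition Clim_seq (u : nat -> C) : C :=
  (real (Lim_seq (fun n => Re (u n))), real (Lim_seq (fun n => Im (u n)))).

Definition CSeries (u : nat -> C) : C :=
  (Series (fun n => Re (u n)), Series (fun n => Im (u n))).

Definition Csum {A : Type} (l : list A) (F : A -> C) : C :=
  fold_right (fun i s => (F i + s)%C) (RtoC 0) l.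

(* [zsum_eq u s]: the series of the u n, n in Z, converges absolutely
   (equivalently, unconditionally), with sum s. *)
Definition zsum_eq (u : Z -> C) (s : C) : Prop :=
  let p n := u (Z.of_nat n) in
  let q n := u (- Z.of_nat (S n))%Z in
  ex_series (fun n => Cmod (p n)) /\ ex_series (fun n => Cmod (q n)) /\
  s = (CSeries p + CSeries q)%C.

(** * The Whittaker function *)

(* (a)_n = a (a + 1) ... (a + n - 1) *)
Fixpoint pochhammer (a : C) (n : nat) : C :=
  match n with
  | O => RtoC 1
  | S p => pochhammer a p * (a + RtoC (INR p))
  end.

(* Gauss: Gamma(s) = lim n! n^s / (s (s + 1) ... (s + n)) *)
Definition CGamma (s : C) : C :=
  Clim_seq (fun n => RtoC (INR (fact n)) * Rcpow (INR n) s / pochhammer s (S n))%C.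

(* Kummer's confluent hypergeometric function 1F1(a; b; t) *)
Definition kummerM (a b : C) (t : R) : C :=
  CSeries (fun n => pochhammer a n / pochhammer b n * RtoC (t ^ n / INR (fact n)))%C.

Definition whittakerM (l mu : C) (t : R) : C :=
  (RtoC (exp (- t / 2)) * Rcpow t (mu + RtoC (1 / 2)) *
   kummerM (mu - l + RtoC (1 / 2)) (RtoC 1 + RtoC 2 * mu) t)%C.

(* The usual expression of W by means of M_{l,mu} and M_{l,-mu}
   (Gradshteyn-Ryzhik 9.220.4, Whittaker-Watson 16.41, DLMF 13.14.33),
   meaningful when 2 mu is not an integer; here mu = i R with R real nonzero. *)
Definition whittakerW (l mu : C) (t : R) : C :=
  (CGamma (- (RtoC 2 * mu)) / CGamma (RtoC (1 / 2) - mu - l) * whittakerM l mu t +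
   CGamma (RtoC 2 * mu) / CGamma (RtoC (1 / 2) + mu - l) * whittakerM l (- mu) t)%C.

(** * The modular group and the multiplier system of eta^(2k) *)

(* Functions on the upper half-plane are represented by functions C -> C
   of which only the values on [upper] matter. *)
Definition upper (z : C) : Prop := 0 < Im z.

Record SL2Z : Set := mkSL2Z {
  g11 : Z; g12 : Z; g21 : Z; g22 : Z;
  SL2Z_det : (g11 * g22 - g12 * g21 = 1)%Z }.

Definition CZ (n : Z) : C := RtoC (IZR n).

Definition autj (g : SL2Z) (z : C) : C := (CZ (g21 g) * z + CZ (g22 g))%C.

Definition mobius (g : SL2Z) (z : C) : C :=
  ((CZ (g11 g) * z + CZ (g12 g)) / autj g z)%C.

Fixpoint eta_prod (z : C) (N : nat) : C :=
  match N with
  | O => RtoC 1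
  | S p => eta_prod z p * (RtoC 1 - e (RtoC (INR (S p)) * z))
  end.

Definition eta (z : C) : C := (e (z / RtoC 24) * Clim_seq (eta_prod z))%C.

(* v is the multiplier system v_eta^(2k); the equation determines v
   since eta has no zero in the upper half-plane. *)
Definition is_eta_multiplier (k : Z) (v : SL2Z -> C) : Prop :=
  (forall g, Cmod (v g) = 1) /\
  (forall g z, upper z ->
     CpowZ (eta (mobius g z)) (2 * k) =
     (v g * CpowZ (autj g z) k * CpowZ (eta z) (2 * k))%C).

(** * Maass waveforms *)

Definition slice_x (f : C -> C) (z : C) (x : R) : C := f (x, Im z).
Definition slice_y (f : C -> C) (z : C) (y : R) : C := f (Re z, y).

Definition CDerive (h : R -> C) (t : R) : C :=
  (Derive (fun s => Re (h s)) t, Derive (fun s => Im (h s)) t).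
Definition ex_CDerive (h : R -> C) (t : R) : Prop :=
  ex_derive (fun s => Re (h s)) t /\ ex_derive (fun s => Im (h s)) t.

Definition dx (f : C -> C) (z : C) : C := CDerive (slice_x f z) (Re z).
Definition dy (f : C -> C) (z : C) : C := CDerive (slice_y f z) (Im z).

Definition C1_upper (f : C -> C) : Prop :=
  forall z, upper z ->
    ex_CDerive (slice_x f z) (Re z) /\ ex_CDerive (slice_y f z) (Im z) /\
    continuous (dx f) z /\ continuous (dy f) z.

Definition C2_upper (f : C -> C) : Prop :=
  C1_upper f /\ C1_upper (dx f) /\ C1_upper (dy f).

(* Delta_k = y^2 (d^2/dx^2 + d^2/dy^2) - i k y d/dx *)
Definition Delta (k : Z) (f : C -> C) (z : C) : C :=
  (RtoC (Im z ^ 2) * (dx (dx f) z + dy (dy f) z)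
   - Ci * CZ k * RtoC (Im z) * dx f z)%C.

(* Integral of |f|^2 dx dy / y^2 over the part below height Y of the standard
   fundamental domain { |x| <= 1/2, |z| >= 1 } of PSL(2,Z). *)
Definition trunc_norm2 (f : C -> C) (Y : R) : R :=
  RInt (fun x =>
    RInt (fun y => Cmod (f (x, y)) ^ 2 / y ^ 2) (sqrt (1 - x ^ 2)) Y)
    (- (1 / 2)) (1 / 2).

(* For f continuous with |f| invariant under SL(2,Z), this is
   int_(PSL(2,Z)\H) |f|^2 dx dy / y^2 < oo: the integrand being nonnegative,
   the integral is the supremum of its truncations. *)
Definition square_integrable (f : C -> C) : Prop :=
  exists M : R, forall Y : R, 1 <= Y -> trunc_norm2 f Y <= M.

(* The space M(Gamma, v, k, r), where lambda = 1/4 + r^2. *)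
Record maass (v : SL2Z -> C) (k : Z) (r : R) (f : C -> C) : Prop := {
  maass_aut : forall g z, upper z ->
    f (mobius g z) =
    (v g * Cexp (Ci * CZ k * RtoC (Arg (autj g z))) * f z)%C;
  maass_C2 : C2_upper f;
  maass_eigen : forall z, upper z ->
    (Delta k f z + RtoC (1 / 4 + r ^ 2) * f z)%C = RtoC 0;
  maass_L2 : square_integrable f }.

(* The real number n + alpha_k, which is nonzero for 1 <= k <= 11. *)
Definition shift (k n : Z) : R := IZR n + IZR k / 12.

Definition calW (n k : Z) (r : R) (z : C) : C :=
  (RtoC (/ sqrt (Rabs (shift k n))) *
   whittakerW (RtoC (IZR k / 2 * sign (shift k n))) (Ci * RtoC r)
     (4 * PI * Rabs (shift k n) * Im z) *
   e (RtoC (shift k n * Re z)))%C.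

Definition has_fourier_coeffs (k : Z) (r : R) (f : C -> C) (c : Z -> C) : Prop :=
  forall z, upper z -> zsum_eq (fun n => (c n * calW n k r z)%C) (f z).

(** * Hecke operators *)

Definition xi (k : Z) : C := e (RtoC (IZR k / 12)).

Definition chi (k d : Z) : C := CpowZ Ci (k * (d - 1)).

Definition bigD (k : Z) : Z := (k / Z.gcd 12 k)%Z.

(* 0, 1, ..., n - 1 *)
Definition zrange (n : Z) : list Z := map Z.of_nat (seq 0 (Z.to_nat n)).

(* The positive divisors of n, for n > 0. *)
Definition divisors (n : Z) : list Z :=
  filter (fun a => (n mod a =? 0)%Z) (map Z.of_nat (seq 1 (Z.to_nat n))).

Definition hecke_term (k : Z) (f : C -> C) (a d b : Z) (z : C) : C :=
  (CpowZ (xi k) (- b * d) * f ((CZ a * z + CZ b) / CZ d))%C.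

Definition hecke (k m : Z) (f : C -> C) (z : C) : C :=
  (RtoC (/ sqrt (IZR m)) *
   Csum (divisors m) (fun d =>
     chi k d * Csum (zrange d) (fun b => hecke_term k f (m / d) d b z)))%C.

(* The index n m / a^2 + k (m - a^2) / (12 a^2), brought to a common
   denominator since neither term need be an integer; see
   [hecke_index_exact] for the integrality of the total. *)
Definition hecke_index (k m n a : Z) : Z :=
  ((12 * n * m + k * (m - a ^ 2)) / (12 * a ^ 2))%Z.

Definition hecke_coeff (k m : Z) (c : Z -> C) (n : Z) : C :=
  Csum (divisors (Z.gcd m (n - k * (m - 1) / 12)))
       (fun a => (chi k a * c (hecke_index k m n a))%C).

(** * All the integer divisions above are exact *)

Lemma divisors_spec (n a : Z) : (0 < n)%Z ->
  In a (divisors n) <-> (0 < a)%Z /\ (a | n)%Z.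
Proof.
intros Hn; unfold divisors; rewrite filter_In, in_map_iff, Z.eqb_eq; split.
- intros [[j [<- Hj]] Hmod]; apply in_seq in Hj.
  split; [lia | apply Z.mod_divide; lia].
- intros [Ha Hd]; assert (a <= n)%Z by now apply Z.divide_pos_le.
  split; [| now apply Z.mod_divide; [lia |]].
  exists (Z.to_nat a); split; [lia | apply in_seq; lia].
Qed.

Lemma multiple_exact (k m : Z) : (k * m mod 12 = k mod 12)%Z ->
  (12 | k * (m - 1))%Z.
Proof.
intros H; apply Z.mod_divide; [lia |].
replace (k * (m - 1))%Z with (k * m - k)%Z by ring.
now rewrite Zminus_mod, H, Z.sub_diag.
Qed.

Lemma sqr_exact (k a d : Z) : (12 | k * (a * d - 1))%Z ->
  (12 | k * (d ^ 2 - 1))%Z.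
Proof.
intros H; apply Z.mod_divide in H; [| lia]; apply Z.mod_divide; [lia |].
rewrite (Z.div_mod a 12), (Z.div_mod d 12), (Z.div_mod k 12) in H by lia.
rewrite (Z.div_mod d 12), (Z.div_mod k 12) by lia.
assert (Ha := Z.mod_pos_bound a 12 ltac:(lia)).
assert (Hd := Z.mod_pos_bound d 12 ltac:(lia)).
assert (Hk := Z.mod_pos_bound k 12 ltac:(lia)).
revert H Ha Hd Hk.
generalize (a mod 12)%Z (d mod 12)%Z (k mod 12)%Z (a / 12)%Z (d / 12)%Z (k / 12)%Z.
intros s t u A B E H Hs Ht Hu.
replace ((12 * E + u) * ((12 * A + s) * (12 * B + t) - 1))%Z
  with (u * (s * t - 1) +
        (E * ((12 * A + s) * (12 * B + t) - 1) +
         u * (12 * A * B + A * t + s * B)) * 12)%Z in H by ring.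
replace ((12 * E + u) * ((12 * B + t) ^ 2 - 1))%Z
  with (u * (t * t - 1) +
        (E * ((12 * B + t) ^ 2 - 1) + u * (12 * B * B + 2 * B * t)) * 12)%Z by ring.
rewrite Z_mod_plus_full in H |- *.
assert (Hall : forallb (fun s => forallb (fun t => forallb (fun u =>
   implb (u * (s * t - 1) mod 12 =? 0)%Z (u * (t * t - 1) mod 12 =? 0)%Z)
   (zrange 12)) (zrange 12)) (zrange 12) = true) by (vm_compute; reflexivity).
assert (Hin : forall w, (0 <= w < 12)%Z -> In w (zrange 12)).
{ intros w Hw; apply in_map_iff; exists (Z.to_nat w).
  split; [lia | apply in_seq; lia]. }
rewrite forallb_forall in Hall; specialize (Hall s (Hin s Hs)).
rewrite forallb_forall in Hall; specialize (Hall t (Hin t Ht)).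
rewrite forallb_forall in Hall; specialize (Hall u (Hin u Hu)).
rewrite H in Hall; now apply Z.eqb_eq in Hall.
Qed.

Lemma hecke_index_exact (k m n a : Z) : (k * m mod 12 = k mod 12)%Z ->
  (a | Z.gcd m (n - k * (m - 1) / 12))%Z ->
  (12 * a ^ 2 | 12 * n * m + k * (m - a ^ 2))%Z.
Proof.
intros Hkm Ha; destruct (multiple_exact k m Hkm) as [q Hq].
rewrite Hq, Z.div_mul in Ha by lia.
assert (H1 := Z.divide_trans _ _ _ Ha (Z.gcd_divide_l _ _)).
assert (H2 := Z.divide_trans _ _ _ Ha (Z.gcd_divide_r _ _)).
destruct H1 as [d Hd], H2 as [s Hs].
destruct (sqr_exact k a d) as [t Ht].
{ exists q; rewrite <- Hq, Hd; ring. }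
exists (d * s + t)%Z.
assert (Hn : n = (s * a + q)%Z) by lia.
assert (Hq' : (12 * q = k * (m - 1))%Z) by lia.
transitivity (12 * s * a * m + k * (m - 1) * m + k * (m - a ^ 2))%Z.
{ rewrite <- Hq', Hn; ring. }
rewrite Hd.
transitivity (12 * d * s * a ^ 2 + a ^ 2 * (k * (d ^ 2 - 1)))%Z; [ring |].
rewrite Ht; ring.
Qed.

Lemma bigD_index_exact (k m : Z) : (1 <= k <= 11)%Z ->
  (k * m mod 12 = k mod 12)%Z -> (1 < Z.gcd (bigD k) m)%Z ->
  (12 * bigD k ^ 2 | k * (m - bigD k ^ 2))%Z.
Proof.
intros Hk Hkm Hg.
assert (Hp : (Z.gcd (bigD k) m | bigD k)%Z) by apply Z.gcd_divide_l.
assert (Hm : (Z.gcd (bigD k) m | m)%Z) by apply Z.gcd_divide_r.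
revert Hp Hm Hg; generalize (Z.gcd (bigD k) m); intros g Hp Hm Hg.
destruct (multiple_exact _ _ Hkm) as [q Hq]; clear Hkm.
assert (Hk' : (k = 1 \/ k = 2 \/ k = 3 \/ k = 4 \/ k = 5 \/ k = 6 \/ k = 7 \/
               k = 8 \/ k = 9 \/ k = 10 \/ k = 11)%Z) by lia.
assert (HD : (0 < bigD k)%Z).
{ decompose [or] Hk'; subst k; reflexivity. }
assert (Hle : (g <= bigD k)%Z) by now apply Z.divide_pos_le.
assert (HDm : (bigD k | m)%Z).
{ replace (bigD k) with g; [exact Hm |].
  destruct Hp as [t Ht].
  decompose [or] Hk'; subst k;
    match type of Ht with bigD ?x = _ =>
      let y := eval vm_compute in (bigD x) in change (bigD x) with y in *
    end;
    (assert (Hg' : (g = 2 \/ g = 3 \/ g = 4 \/ g = 5 \/ g = 6 \/ g = 7 \/ g = 8 \/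
                    g = 9 \/ g = 10 \/ g = 11)%Z) by lia);
    decompose [or] Hg'; subst g; lia. }
destruct HDm as [t ->].
cut (exists s, k * (t * bigD k - bigD k ^ 2) = s * (12 * bigD k ^ 2))%Z; [easy |].
clear Hm Hp Hg HD Hle.
decompose [or] Hk'; subst k;
  match goal with |- context [bigD ?x] =>
    let y := eval vm_compute in (bigD x) in change (bigD x) with y in *
  end;
  match goal with |- exists s, (?B = s * ?A)%Z => exists (B / A)%Z end;
  Z.div_mod_to_equations; lia.
Qed.

(* Main.v *)
(* The multiplier v is a character of SL(2,Z), since the weight is an integer,
   hence it is determined by its value xi at T: v g = xi^(psi g) for an explicit
   integer polynomial psi in the entries of g. As km = k mod 12, the matrices of
   determinant m have determinant 1 modulo the order N of xi, where psi is still
   additive, and the coefficient chi_k(d) xi^(-bd) is xi^(-psi) of the matrix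
   with rows (a, b) and (0, d). Automorphy of T f follows by permuting these
   matrices, which represent the SL(2,Z)-orbits in determinant m. For the square
   integrability only the part high in the cusp matters, where the affine maps
   (az + b)/d do not leave the fundamental strip vertically, so that periodicity
   of |f| suffices.

   Summing over b mod d selects the n = k (d^2 - 1)/12 mod d, and an affine
   reindexing of the unconditionally convergent expansion gives d(n). Comparing
   the zeroth coefficients of T f and lambda f gives the eigenvalue; they are
   isolated by averaging over x = j/N with N -> oo, and the Whittaker function
   W_{k/2,iR} is not identically zero because t^(iR) and t^(-iR) are independent
   near t = 0 while their coefficients are quotients of nonzero Gamma values. *)

Require Import Defs.
From Stdlib Require Import Reals ZArith List.
From Coquelicot Require Import Coquelicot.
From Stdlib Require Import Lia Lra Psatz Permutation Classical.

(* ZArith shadows [shift]. *)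
Import Defs.

Open Scope R_scope.

(** * Exponentials and finite sums *)

(** Two facts about eta carry the multiplier system: its translation law and its nonvanishing at
    [Ci]. The defining equation of v, read at that single point, makes v multiplicative, and the
    relation T S T S T = S then yields v(S) from v(T) by algebra alone. The formula v g = xi^(psi g)
    follows by the Euclidean algorithm on the first column of g, and the additivity of [psi] is a
    finite computation on residues because [psi] is an integer polynomial. The expansion of f comes
    in the fixed two-sided order of [zsum_eq], while the Hecke sum adds, filters and relabels its
    terms, moving indices across 0. [usum], convergence along finite sets of indices, supports all
    of this, and [zsum_eq_usum] translates at both ends. [CGamma] and [kummerM] are raw limits and
    series whose values are defaults in case of divergence, so their nonvanishing is derived from
    explicit estimates that also give convergence. *)

Lemma C_eq (z w : C) : Re z = Re w -> Im z = Im w -> z = w.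
Proof. destruct z, w; cbn; congruence. Qed.

Lemma Cexp_plus (z w : C) : Cexp (z + w) = (Cexp z * Cexp w)%C.
Proof.
unfold Cexp; rewrite re_plus, im_plus, exp_plus, cos_plus, sin_plus.
apply C_eq; cbn; ring.
Qed.

Lemma Cexp_0 : Cexp (RtoC 0) = RtoC 1.
Proof. unfold Cexp; cbn; rewrite exp_0, cos_0, sin_0; apply C_eq; cbn; ring. Qed.

Lemma Cmod_Cexp (z : C) : Cmod (Cexp z) = exp (Re z).
Proof.
unfold Cexp; rewrite Cmod_mult, Cmod_R, Rabs_pos_eq by (left; apply exp_pos).
unfold Cmod; cbn [fst snd].
replace (cos (Im z) ^ 2 + sin (Im z) ^ 2) with 1; [rewrite sqrt_1; ring |].
rewrite <- (sin2_cos2 (Im z)); unfold Rsqr; ring.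
Qed.

Lemma Cexp_neq_0 (z : C) : Cexp z <> RtoC 0.
Proof. apply Cmod_gt_0; rewrite Cmod_Cexp; apply exp_pos. Qed.

Lemma e_plus (z w : C) : e (z + w) = (e z * e w)%C.
Proof. unfold e; rewrite <- Cexp_plus; f_equal; ring. Qed.

Lemma e_RtoC (x : R) : e (RtoC x) = (cos (2 * PI * x), sin (2 * PI * x)).
Proof.
unfold e, Cexp; replace (Re _) with 0 by (cbn; ring).
replace (Im _) with (2 * PI * x) by (cbn; ring).
rewrite exp_0; apply Cmult_1_l.
Qed.

Lemma e_Rplus (x y : R) : e (RtoC (x + y)) = (e (RtoC x) * e (RtoC y))%C.
Proof. rewrite RtoC_plus; apply e_plus. Qed.

Lemma e_INR (n : nat) : e (RtoC (INR n)) = RtoC 1.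
Proof.
induction n as [| n IH].
- rewrite e_RtoC; cbn [INR]; rewrite Rmult_0_r, cos_0, sin_0; reflexivity.
- rewrite S_INR, e_Rplus, IH, e_RtoC, Rmult_1_r, cos_2PI, sin_2PI.
  apply C_eq; cbn; ring.
Qed.

Lemma e_0 : e (RtoC 0) = RtoC 1.
Proof. exact (e_INR 0). Qed.

Lemma e_neq_0 (z : C) : e z <> RtoC 0.
Proof. apply Cexp_neq_0. Qed.

Lemma e_opp (x : R) : e (RtoC (- x)) = Cinv (e (RtoC x)).
Proof.
assert (H := e_neq_0 (RtoC x)).
rewrite <- (Cmult_1_l (e (RtoC (- x)))), <- (Cinv_l _ H), <- Cmult_assoc.
rewrite <- e_Rplus, Rplus_opp_r, e_0; ring.
Qed.

Lemma e_IZR (n : Z) : e (RtoC (IZR n)) = RtoC 1.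
Proof.
destruct (Z_le_gt_dec 0 n) as [H | H].
- rewrite <- (Z2Nat.id n), <- INR_IZR_INZ by lia; apply e_INR.
- replace (IZR n) with (- INR (Z.to_nat (- n))).
  + rewrite e_opp, e_INR; field.
  + rewrite INR_IZR_INZ, Z2Nat.id, opp_IZR by lia; ring.
Qed.

Lemma e_add_IZR (x : R) (n : Z) : e (RtoC (x + IZR n)) = e (RtoC x).
Proof. rewrite e_Rplus, e_IZR; ring. Qed.

Lemma e_congr (x y : R) (n : Z) : x = y + IZR n -> e (RtoC x) = e (RtoC y).
Proof. intros ->; apply e_add_IZR. Qed.

Lemma Cmod_e (x : R) : Cmod (e (RtoC x)) = 1.
Proof.
unfold e; rewrite Cmod_Cexp; replace (Re _) with 0 by (cbn; ring); apply exp_0.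
Qed.

Lemma e_pow (x : R) (n : nat) : Cpow (e (RtoC x)) n = e (RtoC (INR n * x)).
Proof.
induction n as [| n IH].
- rewrite Rmult_0_l, e_0; reflexivity.
- rewrite S_INR, Rmult_plus_distr_r, Rmult_1_l, e_Rplus, <- IH.
  cbn; apply Cmult_comm.
Qed.

Lemma CpowZ_e (x : R) (n : Z) : CpowZ (e (RtoC x)) n = e (RtoC (IZR n * x)).
Proof.
destruct n as [| p | p]; cbn [CpowZ].
- rewrite Rmult_0_l, e_0; reflexivity.
- rewrite e_pow, INR_IZR_INZ, positive_nat_Z; reflexivity.
- rewrite e_pow, INR_IZR_INZ, positive_nat_Z, <- e_opp.
  rewrite <- Ropp_mult_distr_l_reverse, <- opp_IZR; reflexivity.
Qed.

Lemma Ci_e : Ci = e (RtoC (1 / 4)).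
Proof.
rewrite e_RtoC; replace (2 * PI * (1 / 4)) with (PI / 2) by field.
rewrite cos_PI2, sin_PI2; reflexivity.
Qed.

Lemma chi_e (k d : Z) : chi k d = e (RtoC (IZR (3 * k * (d - 1)) / 12)).
Proof.
unfold chi; rewrite Ci_e, CpowZ_e; do 2 f_equal.
rewrite !mult_IZR; field.
Qed.

Lemma xi_pow (k n : Z) : CpowZ (xi k) n = e (RtoC (IZR (k * n) / 12)).
Proof. unfold xi; rewrite CpowZ_e; do 2 f_equal; rewrite mult_IZR; field. Qed.

Lemma e_12 (n p : Z) : (12 | n - p)%Z ->
  e (RtoC (IZR n / 12)) = e (RtoC (IZR p / 12)).
Proof.
intros [q Hq]; apply (e_congr _ _ q).
replace n with (p + q * 12)%Z by lia; rewrite plus_IZR, mult_IZR; field.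
Qed.

Lemma CpowZ_nonneg (z : C) (n : Z) : (0 <= n)%Z -> CpowZ z n = Cpow z (Z.to_nat n).
Proof. now destruct n as [| p | p]; [| | lia]. Qed.

Section FiniteSums.
Context {A : Type}.
Implicit Types (l : list A) (F G : A -> C).

Definition Rsum (l : list A) (F : A -> R) : R := fold_right (fun i s => F i + s) 0 l.

Lemma Csum_ext l F G : (forall i, In i l -> F i = G i) -> Csum l F = Csum l G.
Proof.
induction l as [| i l IH]; intros H; [reflexivity |].
unfold Csum; cbn; f_equal; [apply H; now left |].
apply IH; intros j Hj; apply H; now right.
Qed.

Lemma Csum_plus l F G : Csum l (fun i => F i + G i)%C = (Csum l F + Csum l G)%C.
Proof.
induction l as [| i l IH]; unfold Csum in *; cbn; [ring |]; rewrite IH; ring.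
Qed.

Lemma Csum_scal (c : C) l F : Csum l (fun i => c * F i)%C = (c * Csum l F)%C.
Proof.
induction l as [| i l IH]; unfold Csum in *; cbn; [ring |]; rewrite IH; ring.
Qed.

Lemma Csum_0 l F : (forall i, In i l -> F i = RtoC 0) -> Csum l F = RtoC 0.
Proof.
intros H; rewrite (Csum_ext l F (fun _ => RtoC 0 * RtoC 0)%C).
- rewrite Csum_scal; ring.
- intros i Hi; rewrite H by assumption; ring.
Qed.

Lemma Csum_app l1 l2 F : Csum (l1 ++ l2) F = (Csum l1 F + Csum l2 F)%C.
Proof.
induction l1 as [| i l IH]; unfold Csum in *; cbn; [ring |]; rewrite IH; ring.
Qed.

Lemma Csum_perm l1 l2 F : Permutation l1 l2 -> Csum l1 F = Csum l2 F.
Proof.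
induction 1; unfold Csum in *; cbn; try congruence; ring.
Qed.

Lemma Csum_filter (p : A -> bool) l F :
  (forall i, In i l -> p i = false -> F i = RtoC 0) ->
  Csum (filter p l) F = Csum l F.
Proof.
induction l as [| i l IH]; intros H; [reflexivity |]; cbn [filter].
assert (IH' := IH (fun j Hj => H j (or_intror Hj))).
destruct (p i) eqn:Hp; unfold Csum in *; cbn; rewrite IH'; [reflexivity |].
rewrite (H i (or_introl eq_refl) Hp); ring.
Qed.

Lemma Rsum_filter_0 (p : A -> bool) l (F : A -> R) :
  (forall i, In i l -> p i = false -> F i = 0) ->
  Rsum (filter p l) F = Rsum l F.
Proof.
induction l as [| i l IH]; intros H; [reflexivity |]; cbn [filter].
assert (IH' := IH (fun j Hj => H j (or_intror Hj))).
destruct (p i) eqn:Hp; unfold Rsum in *; cbn; rewrite IH'; [reflexivity |].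
rewrite (H i (or_introl eq_refl) Hp); ring.
Qed.

Lemma Rsum_ext l (F G : A -> R) : (forall i, In i l -> F i = G i) -> Rsum l F = Rsum l G.
Proof.
induction l as [| i l IH]; intros H; [reflexivity |].
unfold Rsum; cbn; f_equal; [apply H; now left |].
apply IH; intros j Hj; apply H; now right.
Qed.

Lemma Rsum_le l (F G : A -> R) : (forall i, In i l -> F i <= G i) -> Rsum l F <= Rsum l G.
Proof.
induction l as [| i l IH]; intros H; [apply Rle_refl |].
unfold Rsum; cbn; apply Rplus_le_compat; [apply H; now left |].
apply IH; intros j Hj; apply H; now right.
Qed.

Lemma Rsum_plus l (F G : A -> R) : Rsum l (fun i => F i + G i) = Rsum l F + Rsum l G.
Proof.
induction l as [| i l IH]; unfold Rsum in *; cbn; [ring |]; rewrite IH; ring.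
Qed.

Lemma Rsum_scal (c : R) l (F : A -> R) : Rsum l (fun i => c * F i) = c * Rsum l F.
Proof.
induction l as [| i l IH]; unfold Rsum in *; cbn; [ring |]; rewrite IH; ring.
Qed.

Lemma Rsum_app l1 l2 (F : A -> R) : Rsum (l1 ++ l2) F = Rsum l1 F + Rsum l2 F.
Proof.
induction l1 as [| i l IH]; unfold Rsum in *; cbn; [ring |]; rewrite IH; ring.
Qed.

Lemma Cmod_Csum l F : Cmod (Csum l F) <= Rsum l (fun i => Cmod (F i)).
Proof.
induction l as [| i l IH]; unfold Csum, Rsum in *; cbn; [rewrite Cmod_0; lra |].
eapply Rle_trans; [apply Cmod_triangle | lra].
Qed.

End FiniteSums.

Lemma Csum_map {A B : Type} (h : A -> B) (l : list A) (F : B -> C) :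
  Csum (map h l) F = Csum l (fun i => F (h i)).
Proof. induction l as [| i l IH]; unfold Csum in *; cbn; congruence. Qed.

Lemma Rsum_map {A B : Type} (h : A -> B) (l : list A) (F : B -> R) :
  Rsum (map h l) F = Rsum l (fun i => F (h i)).
Proof. induction l as [| i l IH]; unfold Rsum in *; cbn; congruence. Qed.

Lemma Csum_flat_map {A B : Type} (h : A -> list B) (l : list A) (F : B -> C) :
  Csum (flat_map h l) F = Csum l (fun i => Csum (h i) F).
Proof.
induction l as [| i l IH]; [reflexivity |]; cbn [flat_map]; rewrite Csum_app, IH.
reflexivity.
Qed.

Lemma in_zrange (n b : Z) : In b (zrange n) <-> (0 <= b < n)%Z.
Proof.
unfold zrange; rewrite in_map_iff; split.
- intros [j [<- Hj]]; apply in_seq in Hj; lia.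
- intros H; exists (Z.to_nat b); split; [lia | apply in_seq; lia].
Qed.

Lemma NoDup_of_nat_seq (i n : nat) : NoDup (map Z.of_nat (seq i n)).
Proof.
apply FinFun.Injective_map_NoDup; [intros x y; apply Nat2Z.inj | apply seq_NoDup].
Qed.

Lemma NoDup_zrange (n : Z) : NoDup (zrange n).
Proof. apply NoDup_of_nat_seq. Qed.

Lemma NoDup_divisors (n : Z) : NoDup (divisors n).
Proof. apply NoDup_filter, NoDup_of_nat_seq. Qed.

(** * Geometric sums and orthogonality of roots of unity *)

Lemma Csum_geom (q : C) (n : nat) :
  ((q - 1) * Csum (map Z.of_nat (seq 0 n)) (fun b => Cpow q (Z.to_nat b)) =
   Cpow q n - 1)%C.
Proof.
induction n as [| n IH]; [cbn; ring |].
rewrite seq_S, map_app, Csum_app, Cmult_plus_distr_l, IH.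
cbn [plus map Csum fold_right]; rewrite Nat2Z.id; cbn; ring.
Qed.

Lemma Csum_1 (n : Z) : (0 <= n)%Z -> Csum (zrange n) (fun _ => RtoC 1) = CZ n.
Proof.
intros H; rewrite <- (Z2Nat.id n H); generalize (Z.to_nat n); clear; intros n.
unfold zrange; rewrite Nat2Z.id; induction n as [| n IH]; [reflexivity |].
rewrite seq_S, map_app, Csum_app, IH; unfold CZ.
rewrite Nat2Z.inj_succ, <- Z.add_1_r, plus_IZR, RtoC_plus; cbn; ring.
Qed.

(** After reducing n modulo d the angle is 2 pi t with 0 <= t < 1, and cos (2 pi t) = 1 - 2 sin^2
    (pi t) equals 1 only at t = 0. *)
Lemma e_eq_1 (n d : Z) : (0 < d)%Z ->
  e (RtoC (IZR n / IZR d)) = RtoC 1 -> (d | n)%Z.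
Proof.
intros Hd He.
assert (Hd' : 0 < IZR d) by now apply IZR_lt.
assert (Hr := Z.mod_pos_bound n d Hd).
apply Z.mod_divide; [lia |].
rewrite (e_congr _ (IZR (n mod d) / IZR d) (n / d)) in He.
2:{ rewrite (Z.div_mod n d) at 1 by lia; rewrite plus_IZR, mult_IZR; field; lra. }
rewrite e_RtoC in He; assert (Hc := f_equal fst He); cbn in Hc.
destruct (Z.eq_dec (n mod d) 0) as [| Hn]; [assumption | exfalso].
set (t := IZR (n mod d) / IZR d) in *.
assert (Ht : 0 < t < 1).
{ unfold t; split.
  - apply Rdiv_lt_0_compat; [apply IZR_lt; lia | assumption].
  - apply (Rmult_lt_reg_r (IZR d)); [assumption |]; unfold Rdiv.
    rewrite Rmult_assoc, Rinv_l, Rmult_1_r, Rmult_1_l by lra; apply IZR_lt; lia. }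
assert (HP := PI_RGT_0).
replace (2 * PI * t) with (2 * (PI * t)) in Hc by ring.
rewrite cos_2a_sin in Hc.
assert (0 < sin (PI * t)) by (apply sin_gt_0; nra).
nra.
Qed.

Lemma Csum_roots_of_unity (n d : Z) : (0 < d)%Z ->
  Csum (zrange d) (fun b => e (RtoC (IZR (b * n) / IZR d))) =
  if (n mod d =? 0)%Z then CZ d else RtoC 0.
Proof.
intros Hd; assert (Hd' : IZR d <> 0) by (apply not_0_IZR; lia).
destruct (Z.eqb_spec (n mod d) 0) as [H | H].
- rewrite <- Csum_1 by lia; apply Csum_ext; intros b _.
  apply Z.mod_divide in H as [q ->]; [| lia].
  replace (IZR (b * (q * d)) / IZR d) with (IZR (b * q)); [apply e_IZR |].
  rewrite !mult_IZR; field; assumption.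
- set (q := e (RtoC (IZR n / IZR d))).
  assert (Hq : q <> RtoC 1).
  { intros Hq; apply H, Z.mod_divide; [lia |]; now apply e_eq_1. }
  assert (G := Csum_geom q (Z.to_nat d)); fold (zrange d) in G.
  assert (Hp : Cpow q (Z.to_nat d) = RtoC 1).
  { unfold q; rewrite e_pow, INR_IZR_INZ, Z2Nat.id by lia.
    replace (IZR d * (IZR n / IZR d)) with (IZR n) by (field; assumption).
    apply e_IZR. }
  rewrite Hp in G.
  rewrite (Csum_ext _ _ (fun b => Cpow q (Z.to_nat b))).
  + destruct (Ceq_dec (Csum (zrange d) (fun b => Cpow q (Z.to_nat b))) (RtoC 0))
      as [| Hs]; [assumption |].
    exfalso; apply (Cmult_neq_0 (q - 1) _ (fun K => Hq ltac:(
      rewrite <- (Cplus_0_r (RtoC 1)), <- K; ring)) Hs).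
    rewrite G; ring.
  + intros b Hb; apply in_zrange in Hb; unfold q.
    rewrite e_pow, INR_IZR_INZ, Z2Nat.id, mult_IZR by lia.
    do 2 f_equal; field; assumption.
Qed.

(** * Unconditional summation over the integers *)

(** Finite sets of indices are duplicate-free lists. The first clause is absolute summability, the
    second is convergence along the directed set of finite sets, so no order on Z is preferred. *)
Definition usum (u : Z -> C) (s : C) : Prop :=
  (exists B, forall l, NoDup l -> Rsum l (fun n => Cmod (u n)) <= B) /\
  (forall eps, 0 < eps -> exists l0, forall l, NoDup l -> incl l0 l ->
     Cmod (Csum l u - s) < eps).

Lemma usum_ext (u w : Z -> C) (s : C) :
  (forall n, u n = w n) -> usum u s -> usum w s.
Proof.
intros H [[B HB] Hs]; split.
- exists B; intros l Hl.
  rewrite (Rsum_ext _ _ (fun n => Cmod (u n))) by (intros; now rewrite H); auto.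
- intros eps He; destruct (Hs eps He) as [l0 Hl0]; exists l0; intros l Hl Hi.
  rewrite (Csum_ext l w u) by (intros; now rewrite H); auto.
Qed.

Lemma usum_plus (u w : Z -> C) (s t : C) :
  usum u s -> usum w t -> usum (fun n => u n + w n)%C (s + t)%C.
Proof.
intros [[B HB] Hs] [[B' HB'] Ht]; split.
- exists (B + B'); intros l Hl.
  apply Rle_trans with (Rsum l (fun n => Cmod (u n) + Cmod (w n))).
  + apply Rsum_le; intros; apply Cmod_triangle.
  + rewrite Rsum_plus; apply Rplus_le_compat; auto.
- intros eps He; destruct (Hs (eps / 2)) as [l0 Hl0]; [lra |].
  destruct (Ht (eps / 2)) as [l1 Hl1]; [lra |].
  exists (l0 ++ l1); intros l Hl Hi; rewrite Csum_plus.
  replace (Csum l u + Csum l w - (s + t))%C with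
    ((Csum l u - s) + (Csum l w - t))%C by ring.
  eapply Rle_lt_trans; [apply Cmod_triangle |].
  apply incl_app_inv in Hi as [Hi0 Hi1].
  specialize (Hl0 l Hl Hi0); specialize (Hl1 l Hl Hi1); lra.
Qed.

Lemma usum_scal (c : C) (u : Z -> C) (s : C) :
  usum u s -> usum (fun n => c * u n)%C (c * s)%C.
Proof.
intros [[B HB] Hs]; assert (Hc := Cmod_ge_0 c); split.
- exists (Cmod c * B); intros l Hl.
  rewrite (Rsum_ext _ _ (fun n => Cmod c * Cmod (u n))) by (intros; apply Cmod_mult).
  rewrite Rsum_scal; apply Rmult_le_compat_l; auto.
- intros eps He.
  destruct (Hs (eps / (Cmod c + 1))) as [l0 Hl0]; [apply Rdiv_lt_0_compat; lra |].
  exists l0; intros l Hl Hi; rewrite Csum_scal.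
  replace (c * Csum l u - c * s)%C with (c * (Csum l u - s))%C by ring.
  rewrite Cmod_mult; specialize (Hl0 l Hl Hi).
  apply Rle_lt_trans with (Cmod c * (eps / (Cmod c + 1))).
  + apply Rmult_le_compat_l; [assumption | lra].
  + apply (Rmult_lt_reg_r (Cmod c + 1)); [lra |].
    replace (Cmod c * (eps / (Cmod c + 1)) * (Cmod c + 1)) with (Cmod c * eps)
      by (field; lra).
    nra.
Qed.

Lemma usum_0 : usum (fun _ => RtoC 0) (RtoC 0).
Proof.
split.
- exists 0; intros l _; induction l as [| n l IH]; unfold Rsum in *; cbn in *; [lra |].
  rewrite Cmod_0 in *; lra.
- intros eps He; exists nil; intros l _ _.
  rewrite Csum_0 by reflexivity.
  replace (RtoC 0 - RtoC 0)%C with (RtoC 0) by ring; now rewrite Cmod_0.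
Qed.

Lemma usum_Csum {A : Type} (l : list A) (u : A -> Z -> C) (s : A -> C) :
  (forall i, In i l -> usum (u i) (s i)) ->
  usum (fun n => Csum l (fun i => u i n)) (Csum l s).
Proof.
induction l as [| i l IH]; intros H; [apply usum_0 |].
apply (usum_plus (u i) (fun n => Csum l (fun i => u i n))).
- apply H; now left.
- apply IH; intros j Hj; apply H; now right.
Qed.

Lemma usum_unique (u : Z -> C) (s t : C) : usum u s -> usum u t -> s = t.
Proof.
intros [_ Hs] [_ Ht].
destruct (Ceq_dec s t) as [| Hst]; [assumption | exfalso].
assert (Hd : 0 < Cmod (t - s)).
{ apply Cmod_gt_0; intros K; apply Hst.
  rewrite <- (Cplus_0_r s), <- K; ring. }
destruct (Hs (Cmod (t - s) / 2)) as [l0 H0]; [lra |].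
destruct (Ht (Cmod (t - s) / 2)) as [l1 H1]; [lra |].
set (l := nodup Z.eq_dec (l0 ++ l1)).
assert (Hl : incl (l0 ++ l1) l) by (intros x Hx; now apply nodup_In).
specialize (H0 l (NoDup_nodup _ _) (fun x Hx => Hl x (in_or_app _ _ _ (or_introl Hx)))).
specialize (H1 l (NoDup_nodup _ _) (fun x Hx => Hl x (in_or_app _ _ _ (or_intror Hx)))).
assert (H := Cmod_triangle (Csum l u - s) (- (Csum l u - t))).
rewrite Cmod_opp in H.
replace ((Csum l u - s) + - (Csum l u - t))%C with (t - s)%C in H by ring.
lra.
Qed.

Section Reindexing.
Variables (u w : Z -> C) (phi psi : Z -> Z).
Hypothesis Hu : forall n, u n <> RtoC 0 -> w (phi n) = u n /\ psi (phi n) = n.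
Hypothesis Hw : forall n, w n <> RtoC 0 -> u (psi n) = w n /\ phi (psi n) = n.

Let nonzero (n : Z) : bool := if Ceq_dec (w n) (RtoC 0) then false else true.
Let pull (l : list Z) := map psi (filter nonzero l).

Let nonzero_spec (n : Z) : nonzero n = true <-> w n <> RtoC 0.
Proof. unfold nonzero; destruct (Ceq_dec (w n) (RtoC 0)); split; easy. Qed.

Let nonzero_spec' (n : Z) : nonzero n = false -> w n = RtoC 0.
Proof. unfold nonzero; now destruct (Ceq_dec (w n) (RtoC 0)). Qed.

Let NoDup_pull (l : list Z) : NoDup l -> NoDup (pull l).
Proof.
intros Hl; apply NoDup_map_NoDup_ForallPairs; [| now apply NoDup_filter].
intros a b Ha Hb E; apply filter_In in Ha as [_ Ha], Hb as [_ Hb].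
apply nonzero_spec in Ha, Hb.
now rewrite <- (proj2 (Hw a Ha)), <- (proj2 (Hw b Hb)), E.
Qed.

(** The maps need to be mutually inverse only between the supports of u and w: in the application
    they are affine bijections between two residue classes, outside of which the terms vanish. *)
Lemma usum_reindex (s : C) : usum u s -> usum w s.
Proof using Hu Hw.
intros [[B HB] Hs]; split.
- exists B; intros l Hl; eapply Rle_trans; [| apply (HB _ (NoDup_pull l Hl))].
  right; unfold pull; rewrite Rsum_map.
  rewrite <- (Rsum_filter_0 nonzero l).
  + apply Rsum_ext; intros n Hn; apply filter_In in Hn as [_ Hn].
    apply nonzero_spec in Hn; now rewrite (proj1 (Hw n Hn)).
  + intros n _ Hn; rewrite nonzero_spec' by assumption; apply Cmod_0.
- intros eps He; destruct (Hs eps He) as [l0 Hl0]; exists (map phi l0).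
  intros l Hl Hi.
  (* The elements of l0 missed by the pulled-back list. As l contains the image of l0, u vanishes on
     them; adding them makes the list contain l0 without changing its sum. *)
  set (new := filter (fun n => if in_dec Z.eq_dec n (pull l) then false else true)
                (nodup Z.eq_dec l0)).
  assert (Hnew : forall n, In n new -> In n l0 /\ ~ In n (pull l)).
  { intros n Hn; apply filter_In in Hn as [H1 H2]; apply nodup_In in H1.
    now destruct (in_dec Z.eq_dec n (pull l)). }
  replace (Csum l w) with (Csum (pull l ++ new) u).
  + apply Hl0.
    * apply NoDup_app; [now apply NoDup_pull | apply NoDup_filter, NoDup_nodup |].
      intros n H1 H2; now apply (Hnew n H2).
    * intros n Hn; apply in_or_app.
      destruct (in_dec Z.eq_dec n (pull l)) as [H | H] eqn:E; [now left | right].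
      apply filter_In; split; [now apply nodup_In | now rewrite E].
  + rewrite Csum_app, (Csum_0 new).
    * rewrite Cplus_0_r; unfold pull; rewrite Csum_map.
      rewrite <- (Csum_filter nonzero l) by (intros; auto).
      apply Csum_ext; intros n Hn; apply filter_In in Hn as [_ Hn].
      apply nonzero_spec in Hn; now apply Hw.
    * intros n Hn; destruct (Hnew n Hn) as [H1 H2].
      destruct (Ceq_dec (u n) (RtoC 0)) as [| H0]; [assumption | exfalso; apply H2].
      destruct (Hu n H0) as [E1 E2]; rewrite <- E2; apply in_map, filter_In; split.
      -- now apply Hi, in_map.
      -- apply nonzero_spec; now rewrite E1.
Qed.
End Reindexing.

(** * Equivalence of two-sided absolute convergence with [usum] *)

Lemma im_le_Cmod (z : C) : Rabs (Im z) <= Cmod z.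
Proof. exact (Rle_trans _ _ _ (Rmax_r _ _) (Rmax_Cmod z)). Qed.

Lemma is_series_Cmod (p : nat -> C) : ex_series (fun n => Cmod (p n)) ->
  is_series (fun n => Re (p n)) (Re (CSeries p)) /\
  is_series (fun n => Im (p n)) (Im (CSeries p)).
Proof.
intros H; split; apply Series_correct;
  apply (ex_series_le (V := R_CompleteNormedModule)) with (2 := H); intros n.
- apply re_le_Cmod.
- apply im_le_Cmod.
Qed.

Lemma Csum_seq_Re (p : nat -> C) (n : nat) :
  Re (Csum (seq 0 (S n)) p) = sum_n (fun j => Re (p j)) n.
Proof.
induction n as [| n IH].
- rewrite sum_O; apply Rplus_0_r.
- rewrite seq_S, Csum_app, re_plus, IH, sum_Sn.
  change plus with Rplus; f_equal; apply Rplus_0_r.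
Qed.

Lemma Csum_seq_Im (p : nat -> C) (n : nat) :
  Im (Csum (seq 0 (S n)) p) = sum_n (fun j => Im (p j)) n.
Proof.
induction n as [| n IH].
- rewrite sum_O; apply Rplus_0_r.
- rewrite seq_S, Csum_app, im_plus, IH, sum_Sn.
  change plus with Rplus; f_equal; apply Rplus_0_r.
Qed.

Lemma Rsum_seq (p : nat -> R) (n : nat) : Rsum (seq 0 (S n)) p = sum_n p n.
Proof.
induction n as [| n IH].
- rewrite sum_O; apply Rplus_0_r.
- rewrite seq_S, Rsum_app, IH, sum_Sn.
  change plus with Rplus; f_equal; apply Rplus_0_r.
Qed.

Lemma Cmod_le_Re_Im (z : C) : Cmod z <= Rabs (Re z) + Rabs (Im z).
Proof.
destruct z as [x y]; unfold Re, Im; cbn [fst snd]; replace ((x, y) : C) with (RtoC x + Ci * RtoC y)%C.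
- eapply Rle_trans; [apply Cmod_triangle |].
  rewrite Cmod_mult, Cmod_Ci, !Cmod_R, Rmult_1_l; apply Rle_refl.
- apply C_eq; cbn; ring.
Qed.

Lemma CSeries_lim (p : nat -> C) : ex_series (fun n => Cmod (p n)) ->
  forall eps, 0 < eps -> exists N, forall n, (N <= n)%nat ->
    Cmod (Csum (seq 0 (S n)) p - CSeries p) < eps.
Proof.
intros H eps He; destruct (is_series_Cmod p H) as [H1 H2].
change (is_lim_seq (sum_n (fun n => Re (p n))) (Re (CSeries p))) in H1.
change (is_lim_seq (sum_n (fun n => Im (p n))) (Im (CSeries p))) in H2.
apply is_lim_seq_spec in H1, H2.
destruct (H1 (mkposreal (eps / 2) ltac:(lra))) as [N1 K1].
destruct (H2 (mkposreal (eps / 2) ltac:(lra))) as [N2 K2].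
exists (max N1 N2); intros n Hn; cbn [pos] in K1, K2.
eapply Rle_lt_trans; [apply Cmod_le_Re_Im |].
specialize (K1 n ltac:(lia)); specialize (K2 n ltac:(lia)).
rewrite <- (Csum_seq_Re p) in K1; rewrite <- (Csum_seq_Im p) in K2.
unfold Cminus; rewrite re_plus, im_plus, re_opp, im_opp.
unfold Rminus in K1, K2; lra.
Qed.

Lemma Rsum_incl {A : Type} (a : A -> R) (l L : list A) : (forall n, 0 <= a n) ->
  NoDup l -> incl l L -> Rsum l a <= Rsum L a.
Proof.
intros Ha; revert L; induction l as [| n l IH]; intros L Hnd Hi.
- clear Hi; induction L as [| n L IH]; unfold Rsum in *; cbn in *; [lra |].
  specialize (Ha n); lra.
- destruct (in_split n L (Hi n (or_introl eq_refl))) as (L1 & L2 & ->).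
  rewrite NoDup_cons_iff in Hnd; destruct Hnd as [Hn Hnd].
  assert (Hi' : incl l (L1 ++ L2)).
  { intros j Hj; specialize (Hi j (or_intror Hj)).
    apply in_app_or in Hi as [Hi | [-> | Hi]]; [| easy |]; apply in_or_app; auto. }
  specialize (IH (L1 ++ L2) Hnd Hi').
  rewrite Rsum_app in *; unfold Rsum in *; cbn; lra.
Qed.

(** A list of indices beyond N, joined to the initial segment up to N, still sums to at most the
    whole series, and the initial segment already exhausts it up to eps. *)
Lemma series_tail (a : nat -> R) : (forall n, 0 <= a n) -> ex_series a ->
  forall eps, 0 < eps -> exists N, forall l, NoDup l ->
    (forall n, In n l -> (N <= n)%nat) -> Rsum l a < eps.
Proof.
intros Ha Hs eps He; assert (HS := Series_correct _ Hs).
assert (HL : is_lim_seq (sum_n a) (Series a)) by exact HS; apply is_lim_seq_spec in HL.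
destruct (HL (mkposreal eps He)) as [N HN]; cbn [pos] in HN.
exists (S N); intros l Hl Hge.
set (M := list_max l).
assert (Hsub : Rsum l a + sum_n a N <= sum_n a (max N M)).
{ rewrite <- !Rsum_seq, <- Rsum_app.
  assert (Hnd : NoDup (l ++ seq 0 (S N))).
  { apply NoDup_app; [assumption | apply seq_NoDup |].
    intros n H1 H2; specialize (Hge n H1); apply in_seq in H2; lia. }
  set (L := seq 0 (S (max N M))).
  assert (Hincl : incl (l ++ seq 0 (S N)) L).
  { intros n Hn; apply in_seq; apply in_app_or in Hn as [Hn | Hn].
    - assert (n <= M)%nat; [| lia].
      assert (F := proj1 (list_max_le l M) (Nat.le_refl _)).
      rewrite Forall_forall in F; now apply F.
    - apply in_seq in Hn; lia. }
  now apply Rsum_incl. }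
assert (Hle : sum_n a (max N M) <= Series a).
{ apply is_lim_seq_incr_compare with (u := sum_n a); [exact HS |].
  intros n; rewrite sum_Sn; unfold plus; cbn; specialize (Ha (S n)); lra. }
specialize (HN N (le_n _)).
apply Rabs_def2 in HN; lra.
Qed.

Lemma NoDup_Rsum_bound (a : nat -> R) : (forall n, 0 <= a n) -> ex_series a ->
  exists B, forall l, NoDup l -> Rsum l a <= B.
Proof.
intros Ha Hs; destruct (series_tail a Ha Hs 1 Rlt_0_1) as [N HN].
exists (Rsum (seq 0 N) a + 1); intros l Hl.
assert (Hsplit : Rsum l a = Rsum (filter (fun n => Nat.ltb n N) l) a +
                 Rsum (filter (fun n => negb (Nat.ltb n N)) l) a).
{ clear; induction l as [| n l IH]; unfold Rsum in *; cbn [filter fold_right]; [ring |].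
  rewrite IH; destruct (Nat.ltb n N); cbn [negb fold_right]; ring. }
rewrite Hsplit; apply Rplus_le_compat.
- assert (Hnd : NoDup (filter (fun n => Nat.ltb n N) l)) by now apply NoDup_filter.
  assert (Hi : incl (filter (fun n => Nat.ltb n N) l) (seq 0 N)).
  { intros n Hn; apply filter_In in Hn as [_ Hn]; apply Nat.ltb_lt in Hn.
    apply in_seq; lia. }
  now apply Rsum_incl.
- left; apply HN; [now apply NoDup_filter |].
  intros n Hn; apply filter_In in Hn as [_ Hn].
  apply Bool.negb_true_iff, Nat.ltb_ge in Hn; exact Hn.
Qed.

Lemma Csum_filter_split {A : Type} (p : A -> bool) (l : list A) (F : A -> C) :
  (Csum l F = Csum (filter p l) F + Csum (filter (fun i => negb (p i)) l) F)%C.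
Proof.
induction l as [| i l IH]; unfold Csum in *; cbn [filter fold_right]; [ring |].
rewrite IH; destruct (p i); cbn [negb fold_right]; ring.
Qed.

Section TwoSided.
Variable u : Z -> C.
Let p n := u (Z.of_nat n).
Let q n := u (- Z.of_nat (S n))%Z.

Let pos_part (l : list Z) := map Z.to_nat (filter (fun n => (0 <=? n)%Z) l).
Let neg_part (l : list Z) :=
  map (fun n => pred (Z.to_nat (- n))) (filter (fun n => negb (0 <=? n)%Z) l).

Let in_pos (l : list Z) (n : nat) : In n (pos_part l) <-> In (Z.of_nat n) l.
Proof.
unfold pos_part; rewrite in_map_iff; split.
- intros [z [<- Hz]]; apply filter_In in Hz as [Hz H0].
  apply Z.leb_le in H0; now rewrite Z2Nat.id.
- intros H; exists (Z.of_nat n); split; [apply Nat2Z.id |].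
  apply filter_In; split; [assumption | apply Z.leb_le; lia].
Qed.

Let in_neg (l : list Z) (n : nat) : In n (neg_part l) <-> In (- Z.of_nat (S n))%Z l.
Proof.
unfold neg_part; rewrite in_map_iff; split.
- intros [z [<- Hz]]; apply filter_In in Hz as [Hz H0].
  apply Bool.negb_true_iff, Z.leb_gt in H0.
  now replace (- Z.of_nat (S (pred (Z.to_nat (- z)))))%Z with z by lia.
- intros H; exists (- Z.of_nat (S n))%Z; split; [lia |].
  apply filter_In; split; [assumption |].
  apply Bool.negb_true_iff, Z.leb_gt; lia.
Qed.

Let NoDup_pos (l : list Z) : NoDup l -> NoDup (pos_part l).
Proof.
intros Hl; apply NoDup_map_NoDup_ForallPairs; [| now apply NoDup_filter].
intros a b Ha Hb; apply filter_In in Ha as [_ Ha], Hb as [_ Hb].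
apply Z.leb_le in Ha, Hb; lia.
Qed.

Let NoDup_neg (l : list Z) : NoDup l -> NoDup (neg_part l).
Proof.
intros Hl; apply NoDup_map_NoDup_ForallPairs; [| now apply NoDup_filter].
intros a b Ha Hb; apply filter_In in Ha as [_ Ha], Hb as [_ Hb].
apply Bool.negb_true_iff, Z.leb_gt in Ha, Hb; lia.
Qed.

Let Rsum_split (l : list Z) : Rsum l (fun n => Cmod (u n)) =
  Rsum (pos_part l) (fun n => Cmod (p n)) + Rsum (neg_part l) (fun n => Cmod (q n)).
Proof.
unfold pos_part, neg_part; rewrite !Rsum_map.
rewrite (Rsum_ext _ (fun i => Cmod (p (Z.to_nat i))) (fun n => Cmod (u n))).
2:{ intros n Hn; apply filter_In in Hn as [_ Hn]; apply Z.leb_le in Hn.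
    unfold p; now rewrite Z2Nat.id. }
rewrite (Rsum_ext _ (fun i => Cmod (q (pred (Z.to_nat (- i))))) (fun n => Cmod (u n))).
2:{ intros n Hn; apply filter_In in Hn as [_ Hn].
    apply Bool.negb_true_iff, Z.leb_gt in Hn; unfold q; do 2 f_equal; lia. }
induction l as [| i l IH]; unfold Rsum in *; cbn [filter fold_right]; [ring |].
rewrite IH; destruct (0 <=? i)%Z; cbn [negb fold_right]; ring.
Qed.

Let Csum_split (l : list Z) : Csum l u = (Csum (pos_part l) p + Csum (neg_part l) q)%C.
Proof.
unfold pos_part, neg_part; rewrite !Csum_map.
rewrite (Csum_filter_split (fun n => (0 <=? n)%Z)); f_equal; apply Csum_ext;
  intros n Hn; apply filter_In in Hn as [_ Hn].
- apply Z.leb_le in Hn; unfold p; now rewrite Z2Nat.id.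
- apply Bool.negb_true_iff, Z.leb_gt in Hn; unfold q; f_equal; lia.
Qed.

(** Cutting l at N leaves a permutation of the initial segment, close to the sum of the series, and
    a remainder controlled by the tail of the absolute series. *)
Let tail_bound (f : nat -> C) : ex_series (fun n => Cmod (f n)) ->
  forall eps, 0 < eps -> exists N, forall l, NoDup l -> incl (seq 0 (S N)) l ->
  Cmod (Csum l f - CSeries f) < eps.
Proof.
intros Hf eps He.
destruct (CSeries_lim f Hf (eps / 2)) as [N1 H1]; [lra |].
destruct (series_tail (fun n => Cmod (f n)) (fun n => Cmod_ge_0 _) Hf (eps / 2))
  as [N2 H2]; [lra |].
exists (max N1 N2); intros l Hl Hi.
set (N := max N1 N2) in *.
rewrite (Csum_filter_split (fun n => Nat.leb n N)).
rewrite (Csum_perm (filter (fun n => Nat.leb n N) l) (seq 0 (S N))).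
- specialize (H1 N ltac:(lia)).
  specialize (H2 (filter (fun i => negb (Nat.leb i N)) l)).
  assert (H3 := Cmod_Csum (filter (fun i => negb (Nat.leb i N)) l) f).
  set (S1 := Csum (seq 0 (S N)) f) in *.
  set (S2 := Csum (filter (fun i => negb (Nat.leb i N)) l) f) in *.
  replace (S1 + S2 - CSeries f)%C with ((S1 - CSeries f) + S2)%C by ring.
  eapply Rle_lt_trans; [apply Cmod_triangle |].
  assert (Rsum (filter (fun i => negb (Nat.leb i N)) l) (fun n => Cmod (f n)) < eps / 2);
    [| lra].
  apply H2; [now apply NoDup_filter |].
  intros n Hn; apply filter_In in Hn as [_ Hn].
  apply Bool.negb_true_iff, Nat.leb_gt in Hn; lia.
- apply NoDup_Permutation; [now apply NoDup_filter | apply seq_NoDup |].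
  intros n; rewrite filter_In, Nat.leb_le, in_seq; split; [lia |].
  intros Hn; split; [apply Hi, in_seq; lia | lia].
Qed.

Let bounded_series (f : nat -> C) (g : nat -> Z) (B : R) :
  (forall n m, g n = g m -> n = m) -> (forall n, u (g n) = f n) ->
  (forall l, NoDup l -> Rsum l (fun n => Cmod (u n)) <= B) ->
  ex_series (fun n => Cmod (f n)).
Proof.
intros Hg Hu HB.
cut (ex_finite_lim_seq (sum_n (fun n => Cmod (f n)))); [intros [l Hl]; now exists l |].
apply (ex_finite_lim_seq_incr _ B).
- intros n; rewrite sum_Sn; change plus with Rplus.
  assert (H := Cmod_ge_0 (f (S n))); lra.
- intros n; rewrite <- Rsum_seq.
  eapply Rle_trans; [| apply (HB (map g (seq 0 (S n))))].
  + right; rewrite Rsum_map; apply Rsum_ext; intros; now rewrite Hu.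
  + apply FinFun.Injective_map_NoDup; [exact Hg | apply seq_NoDup].
Qed.

Let usum_series : ex_series (fun n => Cmod (p n)) -> ex_series (fun n => Cmod (q n)) ->
  usum u (CSeries p + CSeries q)%C.
Proof.
intros Hp Hq; split.
- destruct (NoDup_Rsum_bound _ (fun n => Cmod_ge_0 _) Hp) as [B1 H1].
  destruct (NoDup_Rsum_bound _ (fun n => Cmod_ge_0 _) Hq) as [B2 H2].
  exists (B1 + B2); intros l Hl; rewrite Rsum_split.
  apply Rplus_le_compat; [apply H1, NoDup_pos, Hl | apply H2, NoDup_neg, Hl].
- intros eps He.
  destruct (tail_bound p Hp (eps / 2)) as [N1 H1]; [lra |].
  destruct (tail_bound q Hq (eps / 2)) as [N2 H2]; [lra |].
  exists (map Z.of_nat (seq 0 (S N1)) ++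
          map (fun n => - Z.of_nat (S n))%Z (seq 0 (S N2))).
  intros l Hl Hi; apply incl_app_inv in Hi as [Hi1 Hi2].
  rewrite Csum_split.
  replace (Csum (pos_part l) p + Csum (neg_part l) q - (CSeries p + CSeries q))%C
    with ((Csum (pos_part l) p - CSeries p) + (Csum (neg_part l) q - CSeries q))%C
    by ring.
  eapply Rle_lt_trans; [apply Cmod_triangle |].
  assert (G1 : Cmod (Csum (pos_part l) p - CSeries p) < eps / 2).
  { apply H1; [now apply NoDup_pos |].
    intros n Hn; apply in_pos, Hi1; now apply in_map. }
  assert (G2 : Cmod (Csum (neg_part l) q - CSeries q) < eps / 2).
  { apply H2; [now apply NoDup_neg |].
    intros n Hn; apply in_neg, Hi2.
    now apply (in_map (fun n => - Z.of_nat (S n))%Z). }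
  lra.
Qed.

Lemma zsum_eq_usum (s : C) : zsum_eq u s <-> usum u s.
Proof.
split.
- intros (Hp & Hq & ->); now apply usum_series.
- intros Hu; destruct Hu as [[B HB] Hs].
  assert (Hp : ex_series (fun n => Cmod (p n))).
  { apply (bounded_series p Z.of_nat B); [lia | reflexivity | exact HB]. }
  assert (Hq : ex_series (fun n => Cmod (q n))).
  { apply (bounded_series q (fun n => - Z.of_nat (S n))%Z B);
      [lia | reflexivity | exact HB]. }
  split; [exact Hp | split; [exact Hq |]].
  apply (usum_unique u); [| now apply usum_series].
  split; [now exists B | assumption].
Qed.
End TwoSided.

(** * Fourier coefficients of the Hecke operator *)

(** This lets the coefficient formula carry chi_k(a) where the operator carries chi_k(d). Modulo 4:
    for k odd, a d = 1 forces a = d; for k = 2, a and d are both odd; for k = 0 nothing remains. *)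
Lemma chi_codivisor (k a d : Z) : (12 | k * (a * d - 1))%Z -> chi k a = chi k d.
Proof.
intros H; rewrite !chi_e; apply e_12.
cut (4 | k * (a - d))%Z; [intros [s Hs]; exists s; nia |].
assert (H4 : (4 | k * (a * d - 1))%Z) by (eapply Z.divide_trans; [now exists 3%Z | exact H]).
clear H; apply Z.mod_divide in H4; [| lia]; apply Z.mod_divide; [lia |].
rewrite (Zmult_mod k), (Zminus_mod (a * d)), (Zmult_mod a) in H4.
rewrite (Zmult_mod k), (Zminus_mod a).
assert (Ha := Z.mod_pos_bound a 4 ltac:(lia)).
assert (Hd := Z.mod_pos_bound d 4 ltac:(lia)).
assert (Hk := Z.mod_pos_bound k 4 ltac:(lia)).
revert H4 Ha Hd Hk; generalize (a mod 4)%Z (d mod 4)%Z (k mod 4)%Z.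
intros x y u H4 Hx Hy Hu.
assert (Hx' : (x = 0 \/ x = 1 \/ x = 2 \/ x = 3)%Z) by lia.
assert (Hy' : (y = 0 \/ y = 1 \/ y = 2 \/ y = 3)%Z) by lia.
assert (Hu' : (u = 0 \/ u = 1 \/ u = 2 \/ u = 3)%Z) by lia.
clear Hx Hy Hu.
destruct Hx' as [-> | [-> | [-> | ->]]], Hy' as [-> | [-> | [-> | ->]]],
  Hu' as [-> | [-> | [-> | ->]]]; revert H4; vm_compute; congruence.
Qed.

Lemma shift_neq_0 (k n : Z) : (1 <= k <= 11)%Z -> shift k n <> 0.
Proof.
intros Hk H; unfold shift in H.
assert (E : IZR (12 * n + k) = 0) by (rewrite plus_IZR, mult_IZR; lra).
apply eq_IZR_R0 in E; lia.
Qed.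

Lemma affine_Re_Im (a d b : Z) (z : C) : (0 < d)%Z ->
  ((CZ a * z + CZ b) / CZ d)%C =
  ((IZR a * Re z + IZR b) / IZR d, IZR a * Im z / IZR d).
Proof.
intros Hd; assert (IZR d <> 0) by (apply not_0_IZR; lia).
unfold Cdiv, CZ; rewrite <- RtoC_inv by assumption.
destruct z as [x y]; unfold Re, Im; cbn [fst snd].
apply C_eq; cbn; field; assumption.
Qed.

Lemma upper_affine (a d b : Z) (z : C) : (0 < a)%Z -> (0 < d)%Z -> upper z ->
  upper ((CZ a * z + CZ b) / CZ d)%C.
Proof.
intros Ha Hd Hz; rewrite affine_Re_Im by assumption; unfold upper in *; cbn.
apply IZR_lt in Ha, Hd; apply Rdiv_lt_0_compat; [now apply Rmult_lt_0_compat | assumption].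
Qed.

Lemma calW_translate (k n a d b : Z) (r : R) (z : C) : (0 < d)%Z ->
  calW n k r ((CZ a * z + CZ b) / CZ d)%C =
  (calW n k r ((CZ a * z + CZ 0) / CZ d)%C *
   e (RtoC (shift k n * IZR b / IZR d)))%C.
Proof.
intros Hd; rewrite !affine_Re_Im by assumption; unfold calW; cbn [Re Im fst snd].
symmetry; rewrite <- Cmult_assoc; f_equal; rewrite <- e_Rplus; do 2 f_equal.
field; apply not_0_IZR; lia.
Qed.

(** The index enters the Whittaker factor and the exponential through (n + alpha) y, its sign and (n
    + alpha) x, so multiplying n + alpha by a/d amounts to scaling z. Only the normalization 1 /
    sqrt |n + alpha| changes, by sqrt (d/a) = d / sqrt (a d). *)
Lemma calW_scale (k n n' a d : Z) (r : R) (z : C) : (1 <= k <= 11)%Z ->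
  (0 < a)%Z -> (0 < d)%Z -> shift k n' = IZR a / IZR d * shift k n ->
  calW n' k r z =
  (RtoC (/ sqrt (IZR (a * d)) * IZR d) *
   calW n k r ((CZ a * z + CZ 0) / CZ d)%C)%C.
Proof.
intros Hk Ha Hd Hs; rewrite affine_Re_Im by assumption; unfold calW.
apply IZR_lt in Ha, Hd; rewrite mult_IZR.
set (A := IZR a) in *; set (D := IZR d) in *.
assert (Hsh := shift_neq_0 k n Hk); set (s := shift k n) in *.
assert (HAD : 0 < A / D) by now apply Rdiv_lt_0_compat.
assert (Hsign : sign (shift k n') = sign s).
{ rewrite Hs, sign_mult, (sign_eq_1 (A / D)) by assumption; ring. }
rewrite Hsign, Hs, Rabs_mult, (Rabs_pos_eq (A / D)) by lra.
cbn [Re Im fst snd].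
replace (4 * PI * (A / D * Rabs s) * Im z) with (4 * PI * Rabs s * (A * Im z / D))
  by (field; lra).
replace (A / D * s * Re z) with (s * ((A * Re z + 0) / D)) by (field; lra).
rewrite !Cmult_assoc; do 2 f_equal; rewrite <- RtoC_mult; f_equal.
assert (HsA : 0 < sqrt A) by now apply sqrt_lt_R0.
assert (HsD : 0 < sqrt D) by now apply sqrt_lt_R0.
assert (Hss : 0 < sqrt (Rabs s)) by now apply sqrt_lt_R0, Rabs_pos_lt.
rewrite sqrt_mult, sqrt_div, sqrt_mult by (try apply Rabs_pos; lra).
transitivity (/ (sqrt A * sqrt D) * (sqrt D * sqrt D) * / sqrt (Rabs s)).
- field; lra.
- now rewrite sqrt_sqrt by lra.
Qed.

Section HeckeFourier.
Variables (k : Z) (r : R) (m : Z) (f : C -> C) (c : Z -> C) (z : C).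
Hypothesis hk : (1 <= k <= 11)%Z.
Hypothesis hm : (0 < m)%Z.
Hypothesis hkm : ((k * m) mod 12 = k mod 12)%Z.
Hypothesis hz : upper z.
Hypothesis hf : has_fourier_coeffs k r f c.

Let q := (k * (m - 1) / 12)%Z.

Let q_spec : (k * (m - 1) = 12 * q)%Z.
Proof.
destruct (multiple_exact k m hkm) as [s Hs]; unfold q.
rewrite Hs, Z.div_mul by lia; ring.
Qed.

(** Since (n + k/12) / d - k d / 12 = (n - t) / d, the b-th summand has phase e(b (n - t) / d), and
    the sum over b is an orthogonality relation. *)
Let hecke_fourier_inner (a d t : Z) : (a * d = m)%Z -> (0 < d)%Z ->
  (k * (d ^ 2 - 1) = 12 * t)%Z ->
  usum (fun n => c n * calW n k r ((CZ a * z + CZ 0) / CZ d) *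
                 if ((n - t) mod d =? 0)%Z then CZ d else RtoC 0)%C
       (Csum (zrange d) (fun b => hecke_term k f a d b z)).
Proof.
intros Hm Hd Ht; assert (Ha : (0 < a)%Z) by nia.
apply (usum_ext (fun n => Csum (zrange d) (fun b =>
  CpowZ (xi k) (- b * d) * (c n * calW n k r ((CZ a * z + CZ b) / CZ d))))%C).
- intros n; rewrite <- Csum_roots_of_unity, <- Csum_scal by assumption.
  apply Csum_ext; intros b _.
  rewrite calW_translate, xi_pow by assumption.
  transitivity (c n * calW n k r ((CZ a * z + CZ 0) / CZ d) *
     (e (RtoC (IZR (k * (- b * d)) / 12)) * e (RtoC (shift k n * IZR b / IZR d))))%C;
    [ring |].
  f_equal; rewrite <- e_Rplus; do 2 f_equal.
  assert (IZR d <> 0) by (apply not_0_IZR; lia).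
  apply (f_equal IZR) in Ht.
  assert (E : IZR t = IZR k * (IZR d * IZR d - 1) / 12).
  { rewrite mult_IZR in Ht; replace (d ^ 2 - 1)%Z with (d * d - 1)%Z in Ht by ring.
    rewrite minus_IZR, !mult_IZR in Ht; lra. }
  rewrite !mult_IZR, minus_IZR, E, opp_IZR; unfold shift; field; assumption.
- apply usum_Csum; intros b _; unfold hecke_term; apply usum_scal.
  apply zsum_eq_usum, hf, upper_affine; assumption.
Qed.

(** The surviving index t + d l is renamed q + a l: after adding k/12 they are d and a times the
    same number k d / 12 + l, which is the proportionality required by [calW_scale]. The factor d of
    the orthogonality relation and 1 / sqrt m combine into its normalizing constant. *)
Let hecke_fourier_outer (a d : Z) : (a * d = m)%Z -> (0 < d)%Z ->
  usum (fun n => if ((n - q) mod a =? 0)%Z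
          then chi k d * c (hecke_index k m n a) * calW n k r z else RtoC 0)%C
       (RtoC (/ sqrt (IZR m)) *
        (chi k d * Csum (zrange d) (fun b => hecke_term k f a d b z)))%C.
Proof.
intros Hm Hd; assert (Ha : (0 < a)%Z) by nia.
destruct (sqr_exact k a d) as [t Ht].
{ exists q; rewrite Hm, q_spec; ring. }
assert (Ht' : (k * (d ^ 2 - 1) = 12 * t)%Z) by lia.
assert (Hidx : forall l, hecke_index k m (q + a * l) a = (t + d * l)%Z).
{ intros l; unfold hecke_index.
  replace (12 * (q + a * l) * m + k * (m - a ^ 2))%Z
    with ((t + d * l) * (12 * a ^ 2))%Z; [apply Z.div_mul; nia |].
  transitivity ((12 * q) * m + 12 * a * l * m + k * (m - a ^ 2))%Z; [| ring].
  rewrite <- q_spec, <- Hm.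
  transitivity (12 * t * a ^ 2 + 12 * d * l * a ^ 2)%Z; [ring | rewrite <- Ht'; ring]. }
assert (HW : forall l, calW (q + a * l) k r z =
  (RtoC (/ sqrt (IZR m) * IZR d) *
   calW (t + d * l) k r ((CZ a * z + CZ 0) / CZ d))%C).
{ intros l; rewrite <- Hm; apply calW_scale; try assumption; unfold shift.
  assert (0 < IZR d) by now apply IZR_lt.
  assert (E1 : IZR q = IZR k * (IZR a * IZR d - 1) / 12).
  { rewrite <- Hm in q_spec; apply (f_equal IZR) in q_spec.
    rewrite !mult_IZR, minus_IZR, mult_IZR in q_spec; lra. }
  assert (E2 : IZR t = IZR k * (IZR d * IZR d - 1) / 12).
  { apply (f_equal IZR) in Ht'; replace (d ^ 2 - 1)%Z with (d * d - 1)%Z in Ht' by ring.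
    rewrite !mult_IZR, minus_IZR, !mult_IZR in Ht'; lra. }
  rewrite !plus_IZR, !mult_IZR, E1, E2; field; lra. }
assert (Hu := usum_scal (chi k d) _ _ (hecke_fourier_inner a d t Hm Hd Ht')).
apply (usum_scal (RtoC (/ sqrt (IZR m)))) in Hu; revert Hu.
apply (usum_reindex _ _ (fun n => q + a * ((n - t) / d))%Z
                        (fun n => t + d * ((n - q) / a))%Z).
- intros n Hn; destruct (Z.eqb_spec ((n - t) mod d) 0) as [E | E];
    [| exfalso; apply Hn; ring].
  apply Z.mod_divide in E as [l El]; [| lia].
  assert (En : n = (t + d * l)%Z) by lia; subst n; clear Hn.
  replace (t + d * l - t)%Z with (l * d)%Z by ring; rewrite Z.div_mul by lia.
  replace (q + a * l - q)%Z with (l * a)%Z by ring.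
  rewrite Z.div_mul, Z.mod_mul by lia; split; [| reflexivity].
  rewrite Z.eqb_refl, Hidx, HW, RtoC_mult; unfold CZ; ring.
- intros n Hn; destruct (Z.eqb_spec ((n - q) mod a) 0) as [E | E];
    [| exfalso; now apply Hn].
  apply Z.mod_divide in E as [l El]; [| lia].
  assert (En : n = (q + a * l)%Z) by lia; subst n; clear Hn.
  replace (q + a * l - q)%Z with (l * a)%Z by ring; rewrite Z.div_mul by lia.
  replace (t + d * l - t)%Z with (l * d)%Z by ring.
  rewrite Z.div_mul, Z.mod_mul by lia; split; [| reflexivity].
  rewrite Z.eqb_refl, Hidx, HW, RtoC_mult; unfold CZ; ring.
Qed.

(** The involution d -> m/d carries the divisors d of m with m/d dividing n - q to the divisors of
    gcd(m, n - q); [chi_codivisor] moves chi_k across it. *)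
Let hecke_coeff_calW (n : Z) : (hecke_coeff k m c n * calW n k r z)%C =
  Csum (divisors m) (fun d => if ((n - q) mod (m / d) =? 0)%Z
    then chi k d * c (hecke_index k m n (m / d)) * calW n k r z else RtoC 0)%C.
Proof.
unfold hecke_coeff; fold q.
rewrite Cmult_comm, <- Csum_scal.
assert (Hg : (0 < Z.gcd m (n - q))%Z).
{ assert (H := Z.gcd_nonneg m (n - q)).
  destruct (Z.eq_dec (Z.gcd m (n - q)) 0) as [E |]; [| lia].
  apply Z.gcd_eq_0 in E; lia. }
assert (Hco : forall d, (0 < d)%Z -> (d | m)%Z ->
  (0 < m / d)%Z /\ (m = m / d * d)%Z /\ (m / (m / d) = d)%Z).
{ intros d Hd [s Hs]; assert (0 < s)%Z by nia; subst m.
  rewrite Z.div_mul by lia; split; [assumption | split; [ring |]].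
  rewrite Z.mul_comm, Z.div_mul by lia; reflexivity. }
rewrite <- (Csum_filter (fun d => ((n - q) mod (m / d) =? 0)%Z) (divisors m)).
2:{ intros d _ Hd; now rewrite Hd. }
rewrite (Csum_perm _ (map (fun d => m / d)%Z
  (filter (fun d => ((n - q) mod (m / d) =? 0)%Z) (divisors m)))).
- rewrite Csum_map; apply Csum_ext; intros d Hd.
  apply filter_In in Hd as [Hd E]; rewrite E.
  apply divisors_spec in Hd as [Hd Hdm]; [| assumption].
  rewrite (chi_codivisor k (m / d) d); [ring |].
  exists q; rewrite <- (proj1 (proj2 (Hco d Hd Hdm))), q_spec; ring.
- apply NoDup_Permutation.
  + apply NoDup_divisors.
  + apply NoDup_map_NoDup_ForallPairs; [| apply NoDup_filter, NoDup_divisors].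
    intros x y Hx Hy E; apply filter_In in Hx as [Hx _], Hy as [Hy _].
    apply divisors_spec in Hx as [Hx Hxm], Hy as [Hy Hym]; try assumption.
    destruct (Hco x Hx Hxm) as (_ & _ & <-), (Hco y Hy Hym) as (_ & _ & <-).
    now rewrite E.
  + intros a; rewrite divisors_spec, in_map_iff by assumption; split.
    * intros [Ha Hd].
      assert (Ham : (a | m)%Z) by (eapply Z.divide_trans; [exact Hd | apply Z.gcd_divide_l]).
      destruct (Hco a Ha Ham) as (H1 & H2 & H3).
      exists (m / a)%Z; split; [exact H3 |].
      apply filter_In; rewrite H3; split.
      -- apply divisors_spec; [assumption | split; [assumption |]].
         exists a; lia.
      -- apply Z.eqb_eq, Z.mod_divide; [lia |].
         eapply Z.divide_trans; [exact Hd | apply Z.gcd_divide_r].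
    * intros [d [<- Hd]]; apply filter_In in Hd as [Hd E].
      apply divisors_spec in Hd as [Hd Hdm]; [| assumption].
      destruct (Hco d Hd Hdm) as (H1 & H2 & H3).
      split; [assumption |]; apply Z.gcd_greatest.
      -- exists d; lia.
      -- apply Z.mod_divide; [lia |]; now apply Z.eqb_eq.
Qed.

Lemma hecke_fourier :
  zsum_eq (fun n => (hecke_coeff k m c n * calW n k r z)%C) (hecke k m f z).
Proof using hk hm hkm hz hf.
apply zsum_eq_usum.
eapply usum_ext; [intros n; symmetry; apply hecke_coeff_calW |].
unfold hecke; rewrite <- Csum_scal; apply usum_Csum; intros d Hd.
apply divisors_spec in Hd as [Hd [s Hs]]; [| assumption].
apply hecke_fourier_outer; [| assumption].
rewrite Hs, Z.div_mul by lia; reflexivity.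
Qed.
End HeckeFourier.

(** * The multiplier system *)

Lemma exp_minus_2PI_small : exp (- (2 * PI)) <= 1 / 3.
Proof.
rewrite exp_Ropp.
assert (H := exp_ineq1_le (2 * PI)); assert (HP := PI2_1); unfold PI2 in HP.
apply (Rmult_le_reg_r (exp (2 * PI))); [apply exp_pos |].
rewrite Rinv_l by (assert (K := exp_pos (2 * PI)); lra); lra.
Qed.

(** At z = i the factors are 1 - q^n with q = exp (-2 pi) real. The summand q^N / 2 is the slack
    that closes the induction: each step loses at most q^(N+1), as the product is at most 1, and q^N
    / 2 - q^(N+1) >= q^(N+1) / 2 because q <= 1/3. *)
Lemma eta_prod_Ci (N : nat) :
  Im (eta_prod Ci N) = 0 /\ Re (eta_prod Ci (S N)) <= Re (eta_prod Ci N) /\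
  1 / 2 + exp (- (2 * PI)) ^ N / 2 <= Re (eta_prod Ci N).
Proof.
set (q := exp (- (2 * PI))).
assert (Hq : 0 < q) by apply exp_pos.
assert (Hq3 : q <= 1 / 3) by apply exp_minus_2PI_small.
assert (He : forall n, e (RtoC (INR n) * Ci) = RtoC (q ^ n)).
{ intros n; induction n as [| n IH].
  - replace (RtoC (INR 0) * Ci)%C with (RtoC 0) by (cbn [INR]; ring).
    apply e_0.
  - replace (RtoC (INR (S n)) * Ci)%C with (Ci + RtoC (INR n) * Ci)%C
      by (rewrite S_INR, RtoC_plus; ring).
    rewrite e_plus, IH; cbn [pow]; rewrite RtoC_mult; f_equal.
    unfold e, Cexp.
    replace (RtoC (2 * PI) * Ci * Ci)%C with (RtoC (- (2 * PI)))
      by (apply C_eq; cbn; ring).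
    cbn [Re Im RtoC fst snd]; rewrite cos_0, sin_0; apply Cmult_1_r. }
assert (Hstep : forall n, eta_prod Ci (S n) = (eta_prod Ci n * RtoC (1 - q ^ S n))%C).
{ intros n; cbn [eta_prod]; rewrite He, RtoC_minus; reflexivity. }
assert (HRe : forall n, Re (eta_prod Ci (S n)) = Re (eta_prod Ci n) * (1 - q ^ S n)).
{ intros n; rewrite Hstep; unfold Re, Im, RtoC, Cmult; cbn [fst snd]; ring. }
assert (HIm : forall n, Im (eta_prod Ci (S n)) = Im (eta_prod Ci n) * (1 - q ^ S n)).
{ intros n; rewrite Hstep; unfold Re, Im, RtoC, Cmult; cbn [fst snd]; ring. }
assert (Hpow : forall n, 0 < q ^ n <= 1).
{ intros n; split; [now apply pow_lt |].
  rewrite <- (pow1 n); apply pow_incr; lra. }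
assert (Hall : Im (eta_prod Ci N) = 0 /\ Re (eta_prod Ci N) <= 1 /\
               1 / 2 + q ^ N / 2 <= Re (eta_prod Ci N)).
{ induction N as [| N (I1 & I2 & I3)].
  - cbn; lra.
  - rewrite HRe, HIm, I1; assert (H1 := Hpow N); assert (H2 := Hpow (S N)).
    cbn [pow] in *; repeat split; [ring | nra | nra]. }
destruct Hall as (H1 & H2 & H3); split; [exact H1 | split; [| exact H3]].
rewrite HRe; assert (G1 := Hpow N); assert (G2 := Hpow (S N)); nra.
Qed.

(** The real parts decrease and stay above 1/2, so their limit is a genuine one, not the default
    value of [Lim_seq], and is at least 1/2. *)
Lemma eta_Ci_neq_0 : eta Ci <> RtoC 0.
Proof.
unfold eta; apply Cmult_neq_0; [apply e_neq_0 |]; intros H.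
apply (f_equal Re) in H; unfold Clim_seq in H; cbn [Re RtoC fst] in H.
assert (Hlow : forall n, 1 / 2 <= Re (eta_prod Ci n)).
{ intros n; destruct (eta_prod_Ci n) as (_ & _ & H3).
  assert (K := pow_lt _ n (exp_pos (- (2 * PI)))); lra. }
destruct (ex_finite_lim_seq_decr (fun n => Re (eta_prod Ci n)) (1 / 2)) as [l Hl].
- intros n; apply eta_prod_Ci.
- exact Hlow.
- rewrite (is_lim_seq_unique _ _ Hl) in H; cbn [real] in H.
  assert (Hle := is_lim_seq_le _ _ _ _ Hlow (is_lim_seq_const (1 / 2)) Hl).
  cbn in Hle; lra.
Qed.

Lemma eta_translate (z : C) :
  eta (z + RtoC 1)%C = (e (RtoC (1 / 24)) * eta z)%C.
Proof.
unfold eta.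
assert (Hp : forall N, eta_prod (z + RtoC 1)%C N = eta_prod z N).
{ induction N as [| N IH]; [reflexivity |]; cbn [eta_prod]; rewrite IH.
  replace (RtoC (INR (S N)) * (z + RtoC 1))%C
    with (RtoC (INR (S N)) * z + RtoC (INR (S N)))%C by ring.
  now rewrite e_plus, e_INR, Cmult_1_r. }
replace (Clim_seq (eta_prod (z + RtoC 1))) with (Clim_seq (eta_prod z)).
- replace ((z + RtoC 1) / RtoC 24)%C with (RtoC (1 / 24) + z / RtoC 24)%C.
  + rewrite e_plus; ring.
  + rewrite RtoC_div by lra; field; intros K; apply RtoC_inj in K; lra.
- unfold Clim_seq; f_equal; f_equal; apply Lim_seq_ext; intros n; now rewrite Hp.
Qed.

Lemma autj_neq_0 (g : SL2Z) (z : C) : upper z -> autj g z <> RtoC 0.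
Proof.
intros Hz H; unfold upper, autj, CZ in *; destruct z as [x y]; cbn in Hz.
assert (HR := f_equal Re H); assert (HI := f_equal Im H).
cbn in HR, HI.
assert (Hc : IZR (g21 g) = 0) by nra.
rewrite Hc in HR; assert (Hd : IZR (g22 g) = 0) by lra.
apply eq_IZR in Hc, Hd; assert (Hdet := SL2Z_det g); rewrite Hc, Hd in Hdet; lia.
Qed.

Lemma Im_mobius (g : SL2Z) (z : C) : upper z ->
  Im (mobius g z) = Im z / Cmod (autj g z) ^ 2.
Proof.
intros Hz; assert (Hj := autj_neq_0 g z Hz).
assert (Hdet := f_equal IZR (SL2Z_det g)); rewrite minus_IZR, !mult_IZR in Hdet.
rewrite Cmod2_alt; unfold mobius.
assert (Hs : Re (autj g z) ^ 2 + Im (autj g z) ^ 2 <> 0).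
{ rewrite <- Cmod2_alt; apply pow_nonzero; intros K; now apply Cmod_eq_0 in K. }
unfold autj, CZ in *; destruct z as [x y]; unfold Re, Im in *; cbn [fst snd] in *.
unfold Cdiv, Cinv, Cmult, Cplus, RtoC in *; cbn [fst snd] in *.
match goal with |- _ = y / ?N =>
  transitivity (y * (IZR (g11 g) * IZR (g22 g) - IZR (g12 g) * IZR (g21 g)) / N) end.
- field; intros K; apply Hs; etransitivity; [| exact K]; ring.
- now rewrite Hdet, Rmult_1_r.
Qed.

Lemma upper_mobius (g : SL2Z) (z : C) : upper z -> upper (mobius g z).
Proof.
intros Hz; unfold upper; rewrite Im_mobius by assumption.
apply Rdiv_lt_0_compat; [exact Hz |].
apply pow_lt, Cmod_gt_0, autj_neq_0, Hz.
Qed.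

Lemma upper_Ci : upper Ci.
Proof. unfold upper; cbn; lra. Qed.

Lemma CpowZ_mult (z w : C) (n : Z) : (0 <= n)%Z ->
  CpowZ (z * w) n = (CpowZ z n * CpowZ w n)%C.
Proof. intros Hn; rewrite !CpowZ_nonneg by assumption; apply Cpow_mult_l. Qed.

Lemma CpowZ_neq_0 (z : C) (n : Z) : (0 <= n)%Z -> z <> RtoC 0 -> CpowZ z n <> RtoC 0.
Proof. intros Hn Hz; rewrite CpowZ_nonneg by assumption; now apply Cpow_nz. Qed.

(** * Integer matrices and the values of v at T and S *)

Definition mat : Type := (Z * Z) * (Z * Z).
Definition mmul (A B : mat) : mat :=
  let '((a, b), (c, d)) := A in let '((a', b'), (c', d')) := B in
  ((a * a' + b * c', a * b' + b * d'), (c * a' + d * c', c * b' + d * d'))%Z.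
Definition mat_of (g : SL2Z) : mat := ((g11 g, g12 g), (g21 g, g22 g)).

Lemma mmul_assoc (A B D : mat) : mmul A (mmul B D) = mmul (mmul A B) D.
Proof.
destruct A as [[? ?] [? ?]], B as [[? ?] [? ?]], D as [[? ?] [? ?]]; cbn.
apply f_equal2; apply f_equal2; ring.
Qed.

(** The eta equations of p and h at i and of g at h i are compared; the automorphy factors satisfy
    the chain rule, and an integral power splits without any choice of branch. Taking p as any
    element with the product matrix makes the lemma indifferent to the determinant proof stored in
    [SL2Z]. *)
Lemma multiplier_mul (k : Z) (v : SL2Z -> C) (g h p : SL2Z) : (0 <= k)%Z ->
  is_eta_multiplier k v -> mat_of p = mmul (mat_of g) (mat_of h) ->
  v p = (v g * v h)%C.
Proof.
intros Hk [_ Hv] Hp; injection Hp; intros E22 E21 E12 E11; clear Hp.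
assert (Hh := autj_neq_0 h Ci upper_Ci).
assert (Hhz := upper_mobius h Ci upper_Ci).
assert (Hg := autj_neq_0 g (mobius h Ci) Hhz).
assert (Hj : autj p Ci = (autj g (mobius h Ci) * autj h Ci)%C).
{ unfold mobius; unfold autj in *; rewrite E21, E22; unfold CZ in *.
  rewrite !plus_IZR, !mult_IZR, !RtoC_plus, !RtoC_mult; field; exact Hh. }
assert (Hp := autj_neq_0 p Ci upper_Ci).
assert (Hm : mobius p Ci = mobius g (mobius h Ci)).
{ unfold mobius at 1 2; rewrite Hj, E11, E12.
  set (J := autj g (mobius h Ci)) in *; clearbody J.
  unfold mobius, autj in *; unfold CZ in *.
  rewrite !plus_IZR, !mult_IZR, !RtoC_plus, !RtoC_mult; field; split; assumption. }
assert (Q1 := Hv p Ci upper_Ci); assert (Q2 := Hv h Ci upper_Ci).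
assert (Q3 := Hv g (mobius h Ci) Hhz).
rewrite <- Hm, Q2, Q1, Hj, CpowZ_mult in Q3 by assumption.
set (X := CpowZ (autj g (mobius h Ci)) k) in *.
set (Y := CpowZ (autj h Ci) k) in *.
set (W := CpowZ (eta Ci) (2 * k)) in *.
assert (HX : X <> RtoC 0) by now apply CpowZ_neq_0.
assert (HY : Y <> RtoC 0) by now apply CpowZ_neq_0.
assert (HW : W <> RtoC 0) by (apply CpowZ_neq_0; [lia | apply eta_Ci_neq_0]).
transitivity (v p * (X * Y) * W / (X * Y * W))%C; [field; tauto |].
rewrite Q3; field; tauto.
Qed.

Definition SL2_T : SL2Z := mkSL2Z 1 1 0 1 eq_refl.
Definition SL2_S : SL2Z := mkSL2Z 0 (-1) 1 0 eq_refl.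

Lemma mobius_T (z : C) : mobius SL2_T z = (z + RtoC 1)%C.
Proof.
unfold mobius, autj, SL2_T, CZ; cbn [g11 g12 g21 g22]; field.
Qed.

Lemma autj_T (z : C) : autj SL2_T z = RtoC 1.
Proof. unfold autj, SL2_T, CZ; cbn [g21 g22]; ring. Qed.

Lemma multiplier_T (k : Z) (v : SL2Z -> C) : (0 <= k)%Z -> is_eta_multiplier k v ->
  v SL2_T = e (RtoC (IZR k / 12)).
Proof.
intros Hk [_ Hv]; assert (H := Hv SL2_T Ci upper_Ci).
rewrite mobius_T, eta_translate, autj_T, CpowZ_mult, CpowZ_e in H by lia.
assert (HW : CpowZ (eta Ci) (2 * k) <> RtoC 0)
  by (apply CpowZ_neq_0; [lia | apply eta_Ci_neq_0]).
rewrite (CpowZ_nonneg (RtoC 1)), Cpow_1_l, Cmult_1_r in H by assumption.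
replace (IZR (2 * k) * (1 / 24)) with (IZR k / 12) in H
  by (rewrite mult_IZR; field).
set (W := CpowZ (eta Ci) (2 * k)) in *.
transitivity (v SL2_T * W / W)%C; [field; assumption | rewrite <- H; field; assumption].
Qed.

Lemma multiplier_neq_0 (k : Z) (v : SL2Z -> C) (g : SL2Z) :
  is_eta_multiplier k v -> v g <> RtoC 0.
Proof.
intros [H _] K; specialize (H g); rewrite K, Cmod_0 in H; lra.
Qed.

Lemma multiplier_S (k : Z) (v : SL2Z -> C) : (0 <= k)%Z -> is_eta_multiplier k v ->
  v SL2_S = e (RtoC (IZR (- 3 * k) / 12)).
Proof.
intros Hk Hv.
assert (HT := multiplier_T k v Hk Hv).
pose (ST := mkSL2Z 0 (-1) 1 1 eq_refl).
pose (TST := mkSL2Z 1 0 1 1 eq_refl).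
assert (H1 := multiplier_mul k v SL2_S SL2_T ST Hk Hv eq_refl).
assert (H2 := multiplier_mul k v SL2_T ST TST Hk Hv eq_refl).
(* Uses the relation T S T S T = S. *)
assert (H3 := multiplier_mul k v TST ST SL2_S Hk Hv eq_refl).
rewrite H2, H1, HT in H3; assert (HS := multiplier_neq_0 k v SL2_S Hv).
set (s := v SL2_S) in *; set (t := e (RtoC (IZR k / 12))) in *.
assert (Ht : t <> RtoC 0) by apply e_neq_0.
assert (H4 : (s * (t * t * t) = 1)%C).
{ transitivity (t * (s * t) * (s * t) / s)%C; [field; assumption |].
  rewrite <- H3; field; assumption. }
replace (IZR (-3 * k) / 12) with (- (IZR k / 12 + IZR k / 12 + IZR k / 12))
  by (rewrite mult_IZR; field).
rewrite e_opp, !e_Rplus; fold t.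
transitivity (s * (t * t * t) / (t * t * t))%C;
  [field; assumption | rewrite H4; field; assumption].
Qed.

(* An integer polynomial which modulo 12 induces the abelianization
   SL(2,Z) -> Z/12 normalized by T |-> 1; modulo a divisor N of 12 it is
   additive on all integral matrices of determinant 1 mod N. *)
Definition psi (M : mat) : Z :=
  let '((a, b), (c, d)) := M in
  ((1 - c * c) * (b * d + 3 * (c - 1) * d + c + 3) + c * (a + d - 3))%Z.

Definition mdet (M : mat) : Z := let '((a, b), (c, d)) := M in (a * d - b * c)%Z.

Definition mred (N : Z) (M : mat) : mat :=
  let '((a, b), (c, d)) := M in ((a mod N, b mod N), (c mod N, d mod N))%Z.

Definition mats (N : Z) : list mat :=
  filter (fun M => (mdet M mod N =? 1 mod N)%Z)
    (list_prod (list_prod (zrange N) (zrange N)) (list_prod (zrange N) (zrange N))).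

Definition is_upper (M : mat) : bool := let '(_, (c, _)) := M in (c =? 0)%Z.

Definition psi_additive (N : Z) (A B : mat) : bool :=
  (psi (mmul A B) mod N =? (psi A + psi B) mod N)%Z.

(** One factor, on either side, is upper triangular, as T and the coset representatives are. For N =
    12 this leaves 1152 times 48 pairs instead of 1152 squared. *)
Definition psi_check (N : Z) : bool :=
  let l := mats N in let u := filter is_upper l in
  forallb (fun A => forallb (fun B => andb (psi_additive N A B) (psi_additive N B A)) u) l.

(** The listed moduli are the possible orders 12 / gcd(12, k) of xi for 1 <= k <= 11. *)
Lemma psi_check_ok : forallb psi_check (12 :: 6 :: 4 :: 3 :: 2 :: nil)%Z = true.
Proof. vm_compute; reflexivity. Qed.

(** Polynomial expressions respect congruence: the tactic descends through sums, differences and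
    products until each leaf compares x mod N with x. *)
Ltac congruence_mod N :=
  match goal with |- (?x mod _ = ?y mod _)%Z => change (eqm N x y) end;
  repeat first [ reflexivity | apply (Zminus_eqm N) | apply (Zplus_eqm N)
               | apply (Zmult_eqm N) | apply Zmod_mod ].

Lemma psi_mred (N : Z) (A : mat) : (psi (mred N A) mod N = psi A mod N)%Z.
Proof. destruct A as [[a b] [c d]]; unfold psi, mred; congruence_mod N. Qed.

Lemma psi_mmul_mred (N : Z) (A B : mat) :
  (psi (mmul (mred N A) (mred N B)) mod N = psi (mmul A B) mod N)%Z.
Proof.
destruct A as [[a b] [c d]], B as [[a' b'] [c' d']]; unfold psi, mmul, mred.
congruence_mod N.
Qed.

Lemma mdet_mred (N : Z) (A : mat) : (mdet (mred N A) mod N = mdet A mod N)%Z.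
Proof. destruct A as [[a b] [c d]]; unfold mdet, mred; congruence_mod N. Qed.

Lemma in_mats (N : Z) (A : mat) : (0 < N)%Z -> (mdet A mod N = 1 mod N)%Z ->
  In (mred N A) (mats N).
Proof.
intros HN HA; apply filter_In; rewrite mdet_mred, HA, Z.eqb_refl; split; [| reflexivity].
destruct A as [[a b] [c d]]; unfold mred.
repeat apply in_prod; apply in_zrange; apply Z.mod_pos_bound; assumption.
Qed.

Lemma psi_mul_mod (N : Z) (A B : mat) : In N (12 :: 6 :: 4 :: 3 :: 2 :: nil)%Z ->
  (mdet A mod N = 1 mod N)%Z -> (mdet B mod N = 1 mod N)%Z -> is_upper B = true ->
  (psi (mmul A B) mod N = (psi A + psi B) mod N)%Z /\
  (psi (mmul B A) mod N = (psi B + psi A) mod N)%Z.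
Proof.
intros HN HA HB Hu.
assert (Hpos : (0 < N)%Z) by (cbn in HN; lia).
assert (H := psi_check_ok); rewrite forallb_forall in H; specialize (H N HN).
unfold psi_check in H; rewrite forallb_forall in H.
specialize (H _ (in_mats N A Hpos HA)); rewrite forallb_forall in H.
assert (Hu' : is_upper (mred N B) = true).
{ destruct B as [[a b] [c d]]; cbn in Hu |- *.
  apply Z.eqb_eq in Hu; subst c; now rewrite Z.mod_0_l by lia. }
specialize (H (mred N B) (proj2 (filter_In _ _ _) (conj (in_mats N B Hpos HB) Hu'))).
apply andb_prop in H as [H1 H2]; unfold psi_additive in H1, H2.
apply Z.eqb_eq in H1, H2; rewrite psi_mmul_mred in H1, H2.
rewrite Zplus_mod, !psi_mred, <- Zplus_mod in H1, H2; now split.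
Qed.

(** N is the order of xi. Divisibility of k x by 12, which is xi^x = 1, thus becomes a congruence
    modulo N, the setting of the finite check. *)
Lemma order_exists (k : Z) : (1 <= k <= 11)%Z ->
  exists N, In N (12 :: 6 :: 4 :: 3 :: 2 :: nil)%Z /\
    forall x, (12 | k * x)%Z <-> (N | x)%Z.
Proof.
intros Hk; exists (12 / Z.gcd k 12)%Z.
assert (Hk' : (k = 1 \/ k = 2 \/ k = 3 \/ k = 4 \/ k = 5 \/ k = 6 \/ k = 7 \/
               k = 8 \/ k = 9 \/ k = 10 \/ k = 11)%Z) by lia.
clear Hk; decompose [or] Hk'; subst k; clear Hk';
  match goal with |- In ?n _ /\ _ => let n' := eval vm_compute in n in change n with n' end;
  (split; [cbn; tauto |]); intros x;
  rewrite <- !Z.mod_divide by lia; Z.div_mod_to_equations; lia.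
Qed.

Lemma psi_mul (k : Z) (A B : mat) : (1 <= k <= 11)%Z ->
  (12 | k * (mdet A - 1))%Z -> (12 | k * (mdet B - 1))%Z -> is_upper B = true ->
  (12 | k * psi (mmul A B) - k * (psi A + psi B))%Z /\
  (12 | k * psi (mmul B A) - k * (psi B + psi A))%Z.
Proof.
intros Hk HA HB Hu; destruct (order_exists k Hk) as (N & HN & HkN).
rewrite HkN in HA, HB.
assert (Hpos : (0 < N)%Z) by (cbn in HN; lia).
assert (Hmod : forall x y, (N | x - y)%Z <-> (x mod N = y mod N)%Z).
{ intros x y; rewrite <- Z.mod_divide by lia; split; intros H.
  - replace x with (y + (x - y))%Z by ring.
    rewrite Zplus_mod, H, Z.add_0_r; apply Zmod_mod.
  - now rewrite Zminus_mod, H, Z.sub_diag. }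
rewrite Hmod in HA, HB.
destruct (psi_mul_mod N A B HN HA HB Hu) as [H1 H2].
rewrite <- !Z.mul_sub_distr_l, !HkN, !Hmod; now split.
Qed.

(** S is not upper triangular, so multiplication by S on the left has its own check, with psi(S) =
    -3. *)
Definition psi_S_check : bool :=
  forallb (fun A => psi (mmul (mred 12 (mat_of SL2_S)) A) mod 12 =? (psi A - 3) mod 12)%Z
    (mats 12).

Lemma psi_S (A : mat) : (mdet A = 1)%Z ->
  (12 | psi (mmul (mat_of SL2_S) A) - (psi A - 3))%Z.
Proof.
intros HA; assert (H : psi_S_check = true) by (vm_compute; reflexivity).
unfold psi_S_check in H; rewrite forallb_forall in H.
specialize (H _ (in_mats 12 A eq_refl (f_equal (fun x => (x mod 12)%Z) HA))).
apply Z.eqb_eq in H.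
rewrite psi_mmul_mred, Zminus_mod, psi_mred, <- Zminus_mod in H.
apply Z.mod_divide; [lia |]; now rewrite Zminus_mod, H, Z.sub_diag.
Qed.

(** * The explicit formula for v on SL(2,Z) *)

Section MultiplierFormula.
Variables (k : Z) (v : SL2Z -> C).
Hypothesis hk : (1 <= k <= 11)%Z.
Hypothesis hv : is_eta_multiplier k v.

Let phase (M : mat) : C := e (RtoC (IZR (k * psi M) / 12)).
(** Quantifying over every g with matrix M makes this a property of the matrix alone, so that goals
    can be rewritten along equalities of matrices. *)
Let good (M : mat) : Prop := forall g, mat_of g = M -> v g = phase M.

Let mdet_of (g : SL2Z) : mdet (mat_of g) = 1%Z.
Proof. exact (SL2Z_det g). Qed.

Definition SL2_mul (g h : SL2Z) : SL2Z.
Proof.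
refine (mkSL2Z (g11 g * g11 h + g12 g * g21 h) (g11 g * g12 h + g12 g * g22 h)
               (g21 g * g11 h + g22 g * g21 h) (g21 g * g12 h + g22 g * g22 h) _).
transitivity ((g11 g * g22 g - g12 g * g21 g) * (g11 h * g22 h - g12 h * g21 h))%Z;
  [ring | rewrite !SL2Z_det; reflexivity].
Defined.

Let mat_of_mul (g h : SL2Z) : mat_of (SL2_mul g h) = mmul (mat_of g) (mat_of h).
Proof. reflexivity. Qed.

(** An equivalence, because the descent below needs to pass from g to t g and conclude about g. *)
Let good_mul (t g : SL2Z) :
  phase (mmul (mat_of t) (mat_of g)) = (v t * phase (mat_of g))%C ->
  good (mmul (mat_of t) (mat_of g)) <-> good (mat_of g).
Proof.
intros E; assert (Ht := multiplier_neq_0 k v t hv); split; intros H h Hh.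
- specialize (H (SL2_mul t h)); rewrite E in H.
  rewrite (multiplier_mul k v t h (SL2_mul t h)) in H; [| lia | assumption | reflexivity].
  transitivity (v t * v h / v t)%C; [field; assumption |].
  rewrite H; [field; assumption | rewrite <- Hh; reflexivity].
- rewrite E; rewrite (multiplier_mul k v t g h); [| lia | assumption | exact Hh].
  f_equal; now apply H.
Qed.

Let good_T (g : SL2Z) :
  good (mmul (mat_of SL2_T) (mat_of g)) <-> good (mat_of g).
Proof.
apply good_mul; rewrite (multiplier_T k) by (try lia; assumption); unfold phase.
rewrite <- e_Rplus, <- Rdiv_plus_distr, <- plus_IZR; apply e_12.
destruct (psi_mul k (mat_of g) (mat_of SL2_T) hk) as [_ H].
- rewrite mdet_of; exists 0%Z; ring.
- exists 0%Z; cbn; ring.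
- reflexivity.
- replace (k + k * psi (mat_of g))%Z
    with (k * (psi (mat_of SL2_T) + psi (mat_of g)))%Z; [exact H |].
  replace (psi (mat_of SL2_T)) with 1%Z by reflexivity; ring.
Qed.

Let good_S (g : SL2Z) :
  good (mmul (mat_of SL2_S) (mat_of g)) <-> good (mat_of g).
Proof.
apply good_mul; rewrite (multiplier_S k) by (try lia; assumption); unfold phase.
rewrite <- e_Rplus, <- Rdiv_plus_distr, <- plus_IZR; apply e_12.
destruct (psi_S (mat_of g) (mdet_of g)) as [s Hs].
exists (k * s)%Z.
replace (psi (mmul (mat_of SL2_S) (mat_of g)))%Z with (s * 12 + (psi (mat_of g) - 3))%Z
  by lia.
ring.
Qed.

Definition SL2_Tpow (n : Z) : SL2Z.
Proof. refine (mkSL2Z 1 n 0 1 _); ring. Defined.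

Let mat_Tpow (n : Z) (g : SL2Z) : mat_of (SL2_mul (SL2_Tpow n) g) =
  ((g11 g + n * g21 g, g12 g + n * g22 g), (g21 g, g22 g))%Z.
Proof.
unfold mat_of, SL2_mul, SL2_Tpow; cbn [g11 g12 g21 g22].
apply f_equal2; apply f_equal2; ring.
Qed.

Let good_Tpow (g : SL2Z) (n : Z) :
  good (mat_of (SL2_mul (SL2_Tpow n) g)) <-> good (mat_of g).
Proof.
assert (Hstep : forall p, good (mat_of (SL2_mul (SL2_Tpow (Z.succ p)) g)) <->
                          good (mat_of (SL2_mul (SL2_Tpow p) g))).
{ intros p; rewrite <- (good_T (SL2_mul (SL2_Tpow p) g)).
  replace (mmul (mat_of SL2_T) (mat_of (SL2_mul (SL2_Tpow p) g)))
    with (mat_of (SL2_mul (SL2_Tpow (Z.succ p)) g)); [tauto |].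
  rewrite !mat_Tpow; unfold mmul, mat_of, SL2_T; cbn [g11 g12 g21 g22].
  apply f_equal2; apply f_equal2; ring. }
induction n as [| n IH | n IH] using Z.peano_ind.
- replace (mat_of (SL2_mul (SL2_Tpow 0) g)) with (mat_of g); [tauto |].
  rewrite mat_Tpow; unfold mat_of; apply f_equal2; apply f_equal2; ring.
- now rewrite Hstep.
- now rewrite <- IH, <- Hstep, Z.succ_pred.
Qed.

(** Multiplying by a power of T leaves the identity matrix, where v is 1 because it is nonzero and
    equal to its own square. *)
Let good_unipotent (g : SL2Z) : g21 g = 0%Z -> g11 g = 1%Z -> good (mat_of g).
Proof.
intros Hc Ha; assert (Hd := SL2Z_det g); rewrite Hc, Ha in Hd.
rewrite <- (good_Tpow g (- g12 g)), mat_Tpow, Hc, Ha.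
replace (g22 g) with 1%Z by lia.
intros h Hh; injection Hh; intros E22 E21 E12 E11.
assert (Hv := multiplier_mul k v h h h ltac:(lia) hv).
assert (Hn := multiplier_neq_0 k v h hv).
transitivity (v h * v h / v h)%C; [field; assumption |].
rewrite <- Hv.
- replace (phase _) with (RtoC 1); [field; assumption |].
  rewrite <- e_0; unfold phase; do 2 f_equal.
  replace (psi _) with 0%Z; [rewrite Z.mul_0_r; field |].
  replace (g12 g + - g12 g * 1)%Z with 0%Z by ring; reflexivity.
- rewrite Hh; replace (g12 g + - g12 g * 1)%Z with 0%Z by ring.
  replace (1 + - g12 g * 0)%Z with 1%Z by ring; reflexivity.
Qed.

(** Euclidean algorithm on the first column: a power of T replaces the upper entry by its remainder
    modulo the lower one and S exchanges the two up to sign, so the absolute value of the lower left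
    entry decreases. *)
Lemma multiplier_formula (g : SL2Z) :
  v g = e (RtoC (IZR (k * psi (mat_of g)) / 12)).
Proof using hk hv.
cut (good (mat_of g)); [intros H; now apply H |].
assert (Hind : forall N g, (Z.abs (g21 g) < Z.of_nat N)%Z -> good (mat_of g));
  [| now apply (Hind (S (Z.abs_nat (g21 g)))); lia].
clear g; intros N; induction N as [| N IH]; intros g Hg; [lia |].
destruct (Z.eq_dec (g21 g) 0) as [Hc | Hc].
- assert (Hd := SL2Z_det g); rewrite Hc in Hd.
  assert (Hu : (g11 g = 1 \/ g11 g = -1)%Z).
  { apply Z.eq_mul_1 with (g22 g); lia. }
  destruct Hu as [Ha | Ha]; [now apply good_unipotent |].
  (* S^2 = -I turns the diagonal -1, -1 into 1, 1. *)
  rewrite <- good_S, <- mat_of_mul, <- good_S, <- mat_of_mul.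
  apply good_unipotent; cbn -[Z.mul Z.add]; lia.
- rewrite <- (good_Tpow g (- (g11 g / g21 g))), <- good_S, <- mat_of_mul.
  apply IH; cbn -[Z.mul Z.add].
  assert (E := Z.div_mod (g11 g) (g21 g) Hc).
  replace (1 * (1 * g11 g + - (g11 g / g21 g) * g21 g) + 0 * (0 * g11 g + 1 * g21 g))%Z
    with (g11 g mod g21 g)%Z by lia.
  assert (Hm := Z.mod_bound_or (g11 g) (g21 g) Hc); lia.
Qed.
End MultiplierFormula.

(** * Automorphy of the Hecke operator *)

Lemma Arg_scale (t : R) (w : C) : 0 < t -> Arg (RtoC t * w)%C = Arg w.
Proof.
intros Ht; unfold Arg; rewrite Cmod_mult, Cmod_R, Rabs_pos_eq by lra.
replace (Re (RtoC t * w)%C) with (t * Re w) by (destruct w; cbn; ring).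
replace (Im (RtoC t * w)%C) with (t * Im w) by (destruct w; cbn; ring).
replace (t * Re w / (t * Cmod w)) with (Re w / Cmod w).
- destruct (Rle_dec 0 (Im w)), (Rle_dec 0 (t * Im w)); try reflexivity; exfalso; nra.
- unfold Rdiv; rewrite Rinv_mult.
  transitivity (t * / t * (Re w * / Cmod w)); [rewrite Rinv_r by lra; ring | ring].
Qed.

(** A total injective relation replaces an explicit permutation. Partners chosen one by one form a
    duplicate-free list inside l of the same length as l, hence a permutation of l. *)
Lemma Csum_bijection {A : Type} (l : list A) (rel : A -> A -> Prop) (F G : A -> C) :
  NoDup l -> (forall x, In x l -> exists y, In y l /\ rel x y) ->
  (forall x x' y, In x l -> In x' l -> rel x y -> rel x' y -> x = x') ->
  (forall x y, In x l -> In y l -> rel x y -> F x = G y) -> Csum l F = Csum l G.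
Proof.
intros Hl Hex Hinj HFG.
assert (H : forall l1, NoDup l1 -> incl l1 l -> exists l2,
  NoDup l2 /\ incl l2 l /\ length l2 = length l1 /\
  (forall y, In y l2 -> exists x, In x l1 /\ rel x y) /\ Csum l1 F = Csum l2 G).
{ induction l1 as [| x l1 IH]; intros Hnd Hi.
  - exists nil; split; [constructor | split; [intros y [] | split; [reflexivity |]]].
    split; [intros y [] | reflexivity].
  - rewrite NoDup_cons_iff in Hnd; destruct Hnd as [Hx Hnd].
    destruct (IH Hnd (fun y Hy => Hi y (or_intror Hy))) as (l2 & H1 & H2 & H3 & H4 & H5).
    assert (Hxl := Hi x (or_introl eq_refl)).
    destruct (Hex x Hxl) as (y & Hy & Hr).
    exists (y :: l2); repeat split.
    + constructor; [| assumption]; intros Hy2.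
      destruct (H4 y Hy2) as (x' & Hx' & Hr'); apply Hx.
      rewrite (Hinj x x' y); auto; apply Hi; now right.
    + intros y' [<- | Hy']; auto.
    + cbn; now rewrite H3.
    + intros y' [<- | Hy']; [exists x; split; [now left | assumption] |].
      destruct (H4 y' Hy') as (x' & Hx' & Hr'); exists x'; split; [now right | assumption].
    + unfold Csum in *; cbn; rewrite H5, (HFG x y); auto. }
destruct (H l Hl (incl_refl l)) as (l2 & H1 & H2 & H3 & _ & ->).
apply Csum_perm, NoDup_Permutation_bis; [assumption | now rewrite H3 | assumption].
Qed.

(** * Representatives of the SL(2,Z)-orbits of matrices of determinant m *)

Section Cosets.
Variable m : Z.
Hypothesis hm : (0 < m)%Z.

(* The pair (d, b) stands for the matrix with rows (m/d, b) and (0, d). *)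
Definition cosets : list (Z * Z) :=
  flat_map (fun d => map (pair d) (zrange d)) (divisors m).

Definition coset_mat (p : Z * Z) : mat := ((m / fst p, snd p), (0, fst p))%Z.

Lemma in_cosets (d b : Z) : In (d, b) cosets <->
  (0 < d)%Z /\ (d | m)%Z /\ (0 <= b < d)%Z.
Proof using hm.
unfold cosets; rewrite in_flat_map; split.
- intros [d' [Hd Hb]]; apply in_map_iff in Hb as [b' [E Hb]]; injection E as -> ->.
  apply divisors_spec in Hd; [| assumption]; apply in_zrange in Hb; tauto.
- intros (H1 & H2 & H3); exists d; split; [now apply divisors_spec |].
  apply in_map, in_zrange, H3.
Qed.

Lemma NoDup_cosets : NoDup cosets.
Proof.
unfold cosets; assert (H := NoDup_divisors m); revert H.
generalize (divisors m); intros l; induction l as [| d l IH]; intros Hl; [constructor |].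
rewrite NoDup_cons_iff in Hl; destruct Hl as [Hd Hl]; cbn [flat_map].
apply NoDup_app; [| now apply IH |].
- apply FinFun.Injective_map_NoDup; [intros x y E; now injection E | apply NoDup_zrange].
- intros [d' b] H1 H2; apply in_map_iff in H1 as [b' [E _]]; injection E as -> ->.
  apply in_flat_map in H2 as [d'' [H3 H4]]; apply in_map_iff in H4 as [b'' [E' _]].
  injection E' as -> ->; contradiction.
Qed.

Lemma codivisor (d : Z) : (0 < d)%Z -> (d | m)%Z -> (0 < m / d)%Z /\ (m / d * d = m)%Z.
Proof using hm.
intros Hd [s Hs]; assert (0 < s)%Z by nia; subst m; rewrite Z.div_mul by lia.
split; [assumption | reflexivity].
Qed.

(** Dividing the first column by its gcd a gives a primitive column (A, D); a Bezout relation
    completes it to an element of SL(2,Z) whose inverse makes M upper triangular. *)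
Lemma hermite_form (M : mat) : mdet M = m -> exists (g : SL2Z) (p : Z * Z),
  In p cosets /\ M = mmul (mat_of g) (coset_mat p).
Proof using hm.
destruct M as [[p q] [s t]]; unfold mdet; intros Hdet.
set (a := Z.gcd p s).
assert (Ha : (0 < a)%Z).
{ assert (H := Z.gcd_nonneg p s); fold a in H.
  destruct (Z.eq_dec a 0) as [E |]; [| lia].
  apply Z.gcd_eq_0 in E as [-> ->]; lia. }
destruct (Z.gcd_divide_l p s) as [A HA], (Z.gcd_divide_r p s) as [D HD].
destruct (Z.gcd_bezout p s a eq_refl) as (u & w & Huw); fold a in HA, HD.
assert (Hb : (A * u + D * w = 1)%Z).
{ apply (Z.mul_reg_l _ _ a); [lia |].
  transitivity (u * (A * a) + w * (D * a))%Z; [ring |].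
  rewrite <- HA, <- HD, Huw; ring. }
set (d := (A * t - D * q)%Z).
assert (Had : (a * d = m)%Z) 
  by (transitivity (A * a * t - q * (D * a))%Z;
      [unfold d; ring | rewrite <- HA, <- HD; exact Hdet]).
assert (Hd : (0 < d)%Z) by nia.
(* The inverse of the matrix with rows (A, -w), (D, u) sends the second column (q, t) to (b0, d).
   Composing that matrix with T^n then brings b0 to its residue b modulo d. *)
set (b0 := (u * q + w * t)%Z).
pose (n := (b0 / d)%Z); pose (b := (b0 mod d)%Z).
assert (Hb0 : (b0 = d * n + b)%Z) by (apply Z.div_mod; lia).
assert (Hbd : (0 <= b < d)%Z) by (apply Z.mod_pos_bound; lia).
assert (Hg : (A * (D * n + u) - (A * n - w) * D = 1)%Z) by (rewrite <- Hb; ring).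
exists (mkSL2Z A (A * n - w) D (D * n + u) Hg), (d, b); split.
- apply in_cosets; split; [assumption | split; [exists a; lia | assumption]].
- unfold mmul, coset_mat, mat_of; cbn [g11 g12 g21 g22 fst snd].
  replace (m / d)%Z with a by (rewrite <- Had, Z.div_mul; lia).
  assert (E1 : (q = A * b + (A * n - w) * d)%Z).
  { transitivity (A * b0 - w * d)%Z; [| rewrite Hb0; ring].
    unfold b0, d; transitivity (q * (A * u + D * w))%Z; [rewrite Hb; ring | ring]. }
  assert (E2 : (t = D * b + (D * n + u) * d)%Z).
  { transitivity (D * b0 + u * d)%Z; [| rewrite Hb0; ring].
    unfold b0, d; transitivity (t * (A * u + D * w))%Z; [rewrite Hb; ring | ring]. }
  apply f_equal2; apply f_equal2; lia.
Qed.

Lemma mat_inv_l (g : SL2Z) (M : mat) :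
  mmul ((g22 g, - g12 g), (- g21 g, g11 g))%Z (mmul (mat_of g) M) = M.
Proof.
rewrite mmul_assoc; assert (H := SL2Z_det g).
destruct M as [[a b] [c d]]; unfold mmul, mat_of.
replace (g22 g * g11 g + - g12 g * g21 g)%Z with 1%Z by lia.
replace (- g21 g * g12 g + g11 g * g22 g)%Z with 1%Z by lia.
apply f_equal2; apply f_equal2; ring.
Qed.

Lemma mat_inv_r (g : SL2Z) (M : mat) :
  mmul (mmul M (mat_of g)) ((g22 g, - g12 g), (- g21 g, g11 g))%Z = M.
Proof.
rewrite <- mmul_assoc; assert (H := SL2Z_det g).
destruct M as [[a b] [c d]]; unfold mmul, mat_of.
replace (g11 g * g22 g + g12 g * - g21 g)%Z with 1%Z by lia.
replace (g21 g * - g12 g + g22 g * g11 g)%Z with 1%Z by lia.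
apply f_equal2; apply f_equal2; ring.
Qed.

(** Comparing first columns makes h upper triangular with diagonal 1, 1 or -1, -1; positivity of the
    diagonals selects the former, and the range of b and b' forces the off-diagonal entry to be
    0. *)
Lemma cosets_distinct (p p' : Z * Z) (h : mat) : In p cosets -> In p' cosets ->
  mdet h = 1%Z -> coset_mat p = mmul h (coset_mat p') -> p = p'.
Proof using hm.
destruct p as [d b], p' as [d' b'], h as [[x y] [u w]]; intros Hp Hp' Hdet E.
apply in_cosets in Hp as (Hd & Hdm & Hb), Hp' as (Hd' & Hdm' & Hb').
destruct (codivisor d Hd Hdm) as [Ha Had], (codivisor d' Hd' Hdm') as [Ha' Had'].
unfold coset_mat, mmul, mdet in *; cbn [fst snd] in *.
injection E; intros E22 E21 E12 E11; clear E.
assert (u = 0)%Z by nia; subst u.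
assert (Hx : (x = 1 \/ x = -1)%Z) by (apply Z.eq_mul_1 with w; lia).
assert (x = 1)%Z by nia; subst x; assert (w = 1)%Z by lia; subst w.
assert (d = d') by lia; subst d'.
assert (y = 0)%Z by nia; subst y; f_equal; lia.
Qed.

(** Cancelling g on the right puts the matrices of p and p' in one SL(2,Z)-orbit, so right
    multiplication by g is injective on orbits. *)
Lemma coset_permutation (g g1 g2 : SL2Z) (p p' q : Z * Z) :
  In p cosets -> In p' cosets ->
  mmul (coset_mat p) (mat_of g) = mmul (mat_of g1) (coset_mat q) ->
  mmul (coset_mat p') (mat_of g) = mmul (mat_of g2) (coset_mat q) -> p = p'.
Proof using hm.
intros Hp Hp' H1 H2.
pose (inv := fun h => ((g22 h, - g12 h), (- g21 h, g11 h))%Z : mat).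
apply (cosets_distinct p p' (mmul (mat_of g1) (inv g2)) Hp Hp').
- assert (D1 := SL2Z_det g1); assert (D2 := SL2Z_det g2).
  unfold mdet, mmul, mat_of, inv.
  transitivity ((g11 g1 * g22 g1 - g12 g1 * g21 g1) *
                (g11 g2 * g22 g2 - g12 g2 * g21 g2))%Z; [ring | now rewrite D1, D2].
- rewrite <- (mat_inv_r g (coset_mat p)), <- (mat_inv_r g (coset_mat p')), H1, H2.
  fold (inv g); rewrite <- !mmul_assoc; f_equal; rewrite !mmul_assoc.
  f_equal; rewrite <- mmul_assoc; symmetry; apply mat_inv_l.
Qed.
End Cosets.

Definition coset_act (m : Z) (p : Z * Z) (z : C) : C :=
  ((CZ (m / fst p) * z + CZ (snd p)) / CZ (fst p))%C.

(** On the matrix with rows (a, b), (0, d) the value of [psi] is b d - 3 (d - 1), and xi^(3 (d - 1))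
    = i^(k (d - 1)) = chi_k(d). *)
Lemma hecke_cosets (k m : Z) (f : C -> C) (z : C) :
  hecke k m f z = (RtoC (/ sqrt (IZR m)) * Csum (cosets m) (fun p =>
    e (RtoC (IZR (- (k * psi (coset_mat m p))) / 12)) * f (coset_act m p z)))%C.
Proof.
unfold hecke, cosets; rewrite Csum_flat_map; f_equal; apply Csum_ext; intros d _.
rewrite Csum_map, <- Csum_scal; apply Csum_ext; intros b _.
unfold hecke_term, coset_act; cbn [fst snd].
rewrite Cmult_assoc; f_equal.
rewrite chi_e, xi_pow, <- e_Rplus, <- Rdiv_plus_distr, <- plus_IZR; do 4 f_equal.
unfold psi, coset_mat; cbn [fst snd]; ring.
Qed.

Lemma CZ_neq_0 (d : Z) : (0 < d)%Z -> CZ d <> RtoC 0.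
Proof. intros Hd H; apply RtoC_inj, eq_IZR in H; lia. Qed.

(** Comparing lower rows gives j(h, w) d' = d j(g, z) for w the image of z under the matrix of q. As
    d and d' are positive, both factors have the same argument. *)
Lemma coset_act_mobius (m : Z) (p q : Z * Z) (g h : SL2Z) (z : C) : upper z ->
  (0 < m)%Z -> In p (cosets m) -> In q (cosets m) ->
  mmul (coset_mat m p) (mat_of g) = mmul (mat_of h) (coset_mat m q) ->
  coset_act m p (mobius g z) = mobius h (coset_act m q z) /\
  Arg (autj h (coset_act m q z)) = Arg (autj g z).
Proof.
destruct p as [d b], q as [d' b']; intros Hz Hm Hp Hq E.
apply in_cosets in Hp as (Hd & Hdm & _), Hq as (Hd' & Hdm' & _); try assumption.
assert (Hj := autj_neq_0 g z Hz).
assert (Hu : upper (coset_act m (d', b') z)).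
{ apply upper_affine; try assumption; now apply (codivisor m Hm). }
assert (Hj' := autj_neq_0 h _ Hu).
assert (Nd := CZ_neq_0 d Hd); assert (Nd' := CZ_neq_0 d' Hd').
unfold coset_mat, mmul, mat_of in E; cbn [fst snd] in E.
injection E; intros E22 E21 E12 E11; clear E.
unfold coset_act in *; cbn [fst snd] in *.
set (a := (m / d)%Z) in *; set (a' := (m / d')%Z) in *.
assert (HC : forall x y, x = y -> CZ x = CZ y) by congruence.
apply HC in E11, E12, E21, E22; unfold CZ in *.
rewrite !plus_IZR, !mult_IZR, !RtoC_plus, !RtoC_mult in *.
assert (Hjj : (autj h ((CZ a' * z + CZ b') / CZ d') * CZ d' = CZ d * autj g z)%C).
{ unfold autj, CZ.
  transitivity ((IZR (g21 h) * IZR a' + IZR (g22 h) * 0) * z +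
    (IZR (g21 h) * IZR b' + IZR (g22 h) * IZR d'))%C; [field; assumption |].
  rewrite <- E21, <- E22; ring. }
unfold CZ in Hjj; split.
- unfold mobius at 2.
  assert (Hnum : ((CZ (g11 h) * ((CZ a' * z + CZ b') / CZ d') + CZ (g12 h)) * CZ d' =
    CZ a * (CZ (g11 g) * z + CZ (g12 g)) + CZ b * autj g z)%C).
  { unfold autj, CZ.
    transitivity ((IZR (g11 h) * IZR a' + IZR (g12 h) * 0) * z +
      (IZR (g11 h) * IZR b' + IZR (g12 h) * IZR d'))%C; [field; assumption |].
    rewrite <- E11, <- E12; ring. }
  unfold mobius, CZ in *.
  set (J' := autj h _) in *; set (J := autj g z) in *.
  set (P := (_ + RtoC (IZR (g12 h)))%C) in *.
  transitivity (P * IZR d' / (J' * IZR d'))%C; [| field; split; assumption].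
  rewrite Hnum, Hjj; field; split; assumption.
- rewrite <- (Arg_scale (IZR d')) by now apply IZR_lt.
  rewrite Cmult_comm, Hjj; apply Arg_scale; now apply IZR_lt.
Qed.

Lemma hecke_automorphic (k : Z) (v : SL2Z -> C) (m : Z) (f : C -> C) (g : SL2Z) (z : C) :
  (1 <= k <= 11)%Z -> is_eta_multiplier k v -> (0 < m)%Z ->
  ((k * m) mod 12 = k mod 12)%Z ->
  (forall g z, upper z -> f (mobius g z) =
    (v g * Cexp (Ci * CZ k * RtoC (Arg (autj g z))) * f z)%C) ->
  upper z ->
  hecke k m f (mobius g z) =
    (v g * Cexp (Ci * CZ k * RtoC (Arg (autj g z))) * hecke k m f z)%C.
Proof.
intros Hk Hv Hm Hkm Hf Hz; rewrite !hecke_cosets.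
set (J := Cexp _).
rewrite (Cmult_comm (v g * J)), <- Cmult_assoc; f_equal.
rewrite (Cmult_comm _ (v g * J)), <- Csum_scal.
destruct (multiple_exact k m Hkm) as [s Hs].
apply (Csum_bijection (cosets m) (fun p q => exists h,
  mmul (coset_mat m p) (mat_of g) = mmul (mat_of h) (coset_mat m q))).
- apply NoDup_cosets.
- intros [d b] Hp; destruct (hermite_form m Hm (mmul (coset_mat m (d, b)) (mat_of g)))
    as (h & q & Hq & E); [| now exists q; split; [| exists h]].
  apply in_cosets in Hp as (Hd & Hdm & _); [| assumption].
  destruct (codivisor m Hm d Hd Hdm) as [_ Had].
  assert (Hdet := SL2Z_det g).
  unfold mdet, mmul, coset_mat, mat_of; cbn [fst snd].
  transitivity ((m / d * d) * (g11 g * g22 g - g12 g * g21 g))%Z; [ring |].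
  rewrite Hdet, Had; ring.
- intros p p' q Hp Hp' [h1 E1] [h2 E2].
  now apply (coset_permutation m Hm g h1 h2 p p' q).
- intros p q Hp Hq [h E].
  destruct (coset_act_mobius m p q g h z Hz Hm Hp Hq E) as [-> HA].
  assert (Hco : forall p, In p (cosets m) -> (12 | k * (mdet (coset_mat m p) - 1))%Z).
  { intros [d b] H; apply in_cosets in H as (Hd & Hdm & _); [| assumption].
    unfold mdet, coset_mat; cbn [fst snd].
    rewrite (proj2 (codivisor m Hm d Hd Hdm)); exists s; lia. }
  assert (Hsl : forall g, (12 | k * (mdet (mat_of g) - 1))%Z).
  { intros g'; exists 0%Z.
    change (mdet (mat_of g')) with (g11 g' * g22 g' - g12 g' * g21 g')%Z.
    rewrite SL2Z_det; ring. }
  rewrite Hf, HA; fold J.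
  2:{ destruct q as [d b]; apply in_cosets in Hq as (Hd & Hdm & _); [| assumption].
      apply upper_affine; try assumption; now apply (codivisor m Hm). }
  rewrite !(multiplier_formula k v Hk Hv).
  transitivity (e (RtoC (IZR (- (k * psi (coset_mat m p))) / 12)) *
    e (RtoC (IZR (k * psi (mat_of h)) / 12)) * (J * f (coset_act m q z)))%C; [ring |].
  transitivity (e (RtoC (IZR (k * psi (mat_of g)) / 12)) *
    e (RtoC (IZR (- (k * psi (coset_mat m q))) / 12)) * (J * f (coset_act m q z)))%C;
    [| ring].
  (* Modulo the order of xi, psi(M_p) + psi(g) = psi(M_p g) = psi(h M_q) = psi(h) + psi(M_q), where
     M_p and M_q are the coset matrices. *)
  f_equal; rewrite <- !e_Rplus, <- !Rdiv_plus_distr, <- !plus_IZR; apply e_12.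
  destruct (psi_mul k (mat_of g) (coset_mat m p) Hk (Hsl g) (Hco p Hp) eq_refl)
    as [_ [x Hx]].
  destruct (psi_mul k (mat_of h) (coset_mat m q) Hk (Hsl h) (Hco q Hq) eq_refl)
    as [[y Hy] _].
  rewrite E in Hx; exists (x - y)%Z; lia.
Qed.

(** Replacing b by b + d translates the argument of f by 1 and produces xi, while the coefficient
    changes by xi^(-d^2); they cancel because k d^2 = k modulo 12. *)
Lemma hecke_term_periodic (k : Z) (v : SL2Z -> C) (m : Z) (f : C -> C) (a d b : Z) (z : C) :
  (1 <= k <= 11)%Z -> is_eta_multiplier k v ->
  ((k * m) mod 12 = k mod 12)%Z ->
  (forall g z, upper z -> f (mobius g z) =
    (v g * Cexp (Ci * CZ k * RtoC (Arg (autj g z))) * f z)%C) ->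
  (0 < m)%Z -> (a * d = m)%Z -> (0 < d)%Z -> upper z ->
  hecke_term k f a d (b + d) z = hecke_term k f a d b z.
Proof.
intros Hk Hv Hkm Hf Hm Had Hd Hz; unfold hecke_term.
assert (Nd := CZ_neq_0 d Hd).
replace ((CZ a * z + CZ (b + d)) / CZ d)%C
  with (mobius SL2_T ((CZ a * z + CZ b) / CZ d)%C).
2:{ rewrite mobius_T; unfold CZ in *; rewrite plus_IZR, RtoC_plus; field; assumption. }
rewrite Hf by (apply upper_affine; try assumption; nia).
rewrite autj_T, (multiplier_T k v) by (try lia; assumption).
replace (Arg (RtoC 1)) with 0.
2:{ unfold Arg; cbn [Re Im RtoC fst snd]; rewrite Cmod_1, Rdiv_1_r, acos_1.
    destruct (Rle_dec 0 0); [reflexivity | lra]. }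
rewrite Cmult_0_r, Cexp_0, Cmult_1_r, !xi_pow, Cmult_assoc; f_equal.
rewrite <- e_Rplus, <- Rdiv_plus_distr, <- plus_IZR; apply e_12.
destruct (multiple_exact k m Hkm) as [s Hs].
destruct (sqr_exact k a d) as [t Ht]; [exists s; rewrite Had; exact Hs |].
exists (- t)%Z; nia.
Qed.

(** * Regularity and the Laplace equation *)

Lemma CDerive_unique (h : R -> C) (t a b : R) :
  is_derive (fun s => Re (h s)) t a -> is_derive (fun s => Im (h s)) t b ->
  CDerive h t = (a, b).
Proof.
intros Ha Hb; unfold CDerive; apply f_equal2; now apply is_derive_unique.
Qed.

Lemma ex_CDerive_lin (c : C) (g h : R -> C) (t : R) :
  ex_CDerive g t -> ex_CDerive h t ->
  ex_CDerive (fun s => c * g s + h s)%C t /\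
  CDerive (fun s => c * g s + h s)%C t = (c * CDerive g t + CDerive h t)%C.
Proof.
intros [[g1 G1] [g2 G2]] [[h1 H1] [h2 H2]]; destruct c as [a b].
assert (D1 : is_derive (fun s => Re ((a, b) * g s + h s)%C) t (a * g1 - b * g2 + h1)).
{ apply (is_derive_ext (fun s => (a * Re (g s) - b * Im (g s)) + Re (h s)));
    [reflexivity |].
  apply @is_derive_plus; [| assumption].
  apply @is_derive_minus; now apply is_derive_scal. }
assert (D2 : is_derive (fun s => Im ((a, b) * g s + h s)%C) t (a * g2 + b * g1 + h2)).
{ apply (is_derive_ext (fun s => (a * Im (g s) + b * Re (g s)) + Im (h s)));
    [reflexivity |].
  apply @is_derive_plus; [| assumption].
  apply @is_derive_plus; now apply is_derive_scal. }
split; [split; eexists; eassumption |].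
rewrite (CDerive_unique (fun s => (a, b) * g s + h s)%C _ _ _ D1 D2).
rewrite (CDerive_unique g _ _ _ G1 G2), (CDerive_unique h _ _ _ H1 H2).
reflexivity.
Qed.

Lemma ex_CDerive_affine (s b : R) (h : R -> C) (t : R) : ex_CDerive h (s * t + b) ->
  ex_CDerive (fun u => h (s * u + b)) t /\
  CDerive (fun u => h (s * u + b)) t = (RtoC s * CDerive h (s * t + b))%C.
Proof.
intros [[h1 H1] [h2 H2]].
assert (Da : is_derive (fun u => s * u + b) t s) by (auto_derive; [trivial | ring]).
assert (D1 := is_derive_comp _ _ _ _ _ H1 Da).
assert (D2 := is_derive_comp _ _ _ _ _ H2 Da).
split; [split; eexists; eassumption |].
rewrite (CDerive_unique (fun u => h (s * u + b)) _ _ _ D1 D2).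
rewrite (CDerive_unique h _ _ _ H1 H2).
apply C_eq; cbn; unfold scal; cbn; unfold mult; cbn; ring.
Qed.

Lemma ex_CDerive_ext_loc (g h : R -> C) (t : R) : locally t (fun u => g u = h u) ->
  (ex_CDerive g t -> ex_CDerive h t) /\ CDerive g t = CDerive h t.
Proof.
intros H; unfold ex_CDerive, CDerive.
assert (H1 : locally t (fun u => Re (g u) = Re (h u)))
  by (revert H; apply filter_imp; congruence).
assert (H2 : locally t (fun u => Im (g u) = Im (h u)))
  by (revert H; apply filter_imp; congruence).
split.
- intros [G1 G2]; split; [now apply (ex_derive_ext_loc _ _ _ H1)
                         | now apply (ex_derive_ext_loc _ _ _ H2)].
- apply f_equal2; now apply Derive_ext_loc.
Qed.

Lemma open_upper (z : C) : upper z -> locally z upper.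
Proof.
intros Hz; unfold upper in *; exists (mkposreal (Im z) Hz); intros w [_ Hw].
cbn in Hw; unfold AbsRing_ball, abs, minus, plus, opp in Hw; cbn in Hw.
unfold Im in *; apply Rabs_def2 in Hw; lra.
Qed.

Lemma locally_pos (y : R) : 0 < y -> locally y (fun t => 0 < t).
Proof. intros Hy; apply (open_gt 0 y Hy). Qed.

Section Extensionality.
Variables f g : C -> C.
Hypothesis Hfg : forall z, upper z -> f z = g z.

Let slice_x_ext (z : C) : upper z -> locally (Re z) (fun x => slice_x f z x = slice_x g z x).
Proof. intros Hz; apply filter_forall; intros x; now apply Hfg. Qed.

Let slice_y_ext (z : C) : upper z -> locally (Im z) (fun y => slice_y f z y = slice_y g z y).
Proof.
intros Hz; generalize (locally_pos _ Hz); apply filter_imp; intros y Hy; now apply Hfg.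
Qed.

Lemma dx_ext (z : C) : upper z -> dx f z = dx g z.
Proof using Hfg. intros Hz; now apply ex_CDerive_ext_loc, slice_x_ext. Qed.

Lemma dy_ext (z : C) : upper z -> dy f z = dy g z.
Proof using Hfg. intros Hz; now apply ex_CDerive_ext_loc, slice_y_ext. Qed.

Lemma C1_upper_ext : C1_upper f -> C1_upper g.
Proof using Hfg.
intros H z Hz; destruct (H z Hz) as (H1 & H2 & H3 & H4); repeat split.
- now apply (ex_CDerive_ext_loc _ _ _ (slice_x_ext z Hz)).
- now apply (ex_CDerive_ext_loc _ _ _ (slice_x_ext z Hz)).
- now apply (ex_CDerive_ext_loc _ _ _ (slice_y_ext z Hz)).
- now apply (ex_CDerive_ext_loc _ _ _ (slice_y_ext z Hz)).
- apply (continuous_ext_loc _ (dx f)); [| assumption].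
  generalize (open_upper z Hz); apply filter_imp; exact dx_ext.
- apply (continuous_ext_loc _ (dy f)); [| assumption].
  generalize (open_upper z Hz); apply filter_imp; exact dy_ext.
Qed.
End Extensionality.

Lemma C2_upper_ext (f g : C -> C) : (forall z, upper z -> f z = g z) ->
  C2_upper f -> C2_upper g.
Proof.
intros H (H1 & H2 & H3); split; [now apply (C1_upper_ext f) |]; split.
- apply (C1_upper_ext (dx f)); [now apply dx_ext | assumption].
- apply (C1_upper_ext (dy f)); [now apply dy_ext | assumption].
Qed.

Lemma Delta_ext (k : Z) (f g : C -> C) (z : C) : (forall z, upper z -> f z = g z) ->
  upper z -> Delta k f z = Delta k g z.
Proof.
intros H Hz; unfold Delta; rewrite (dx_ext f g), (dx_ext (dx f) (dx g)),
  (dy_ext (dy f) (dy g)); auto; [now apply dy_ext | now apply dx_ext].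
Qed.

Lemma continuous_Clin (c : C) (f g : C -> C) (z : C) : continuous f z -> continuous g z ->
  continuous (fun w => c * f w + g w)%C z.
Proof.
intros Hf Hg; apply (continuous_plus (K := C_AbsRing) (V := C_NormedModule)); [| exact Hg].
apply (continuous_scal_r (K := C_AbsRing) (V := C_NormedModule)); exact Hf.
Qed.

Section Linearity.
Variables (c : C) (f g : C -> C).

Lemma dx_lin (z : C) : C1_upper f -> C1_upper g -> upper z ->
  dx (fun w => c * f w + g w)%C z = (c * dx f z + dx g z)%C.
Proof. intros Hf Hg Hz; apply ex_CDerive_lin; [now apply Hf | now apply Hg]. Qed.

Lemma dy_lin (z : C) : C1_upper f -> C1_upper g -> upper z ->
  dy (fun w => c * f w + g w)%C z = (c * dy f z + dy g z)%C.
Proof. intros Hf Hg Hz; apply ex_CDerive_lin; [now apply Hf | now apply Hg]. Qed.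

Lemma C1_upper_lin : C1_upper f -> C1_upper g -> C1_upper (fun w => c * f w + g w)%C.
Proof.
intros Hf Hg z Hz.
destruct (Hf z Hz) as (F1 & F2 & F3 & F4), (Hg z Hz) as (G1 & G2 & G3 & G4).
split; [now apply ex_CDerive_lin |]; split; [now apply ex_CDerive_lin |]; split.
- apply (continuous_ext_loc _ (fun w => c * dx f w + dx g w)%C).
  + generalize (open_upper z Hz); apply filter_imp; intros w Hw; symmetry.
    now apply dx_lin.
  + now apply continuous_Clin.
- apply (continuous_ext_loc _ (fun w => c * dy f w + dy g w)%C).
  + generalize (open_upper z Hz); apply filter_imp; intros w Hw; symmetry.
    now apply dy_lin.
  + now apply continuous_Clin.
Qed.
End Linearity.

Lemma C2_upper_lin (c : C) (f g : C -> C) : C2_upper f -> C2_upper g ->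
  C2_upper (fun w => c * f w + g w)%C.
Proof.
intros (F1 & F2 & F3) (G1 & G2 & G3); split; [now apply C1_upper_lin |]; split.
- apply (C1_upper_ext (fun w => c * dx f w + dx g w)%C); [| now apply C1_upper_lin].
  intros z Hz; symmetry; now apply dx_lin.
- apply (C1_upper_ext (fun w => c * dy f w + dy g w)%C); [| now apply C1_upper_lin].
  intros z Hz; symmetry; now apply dy_lin.
Qed.

Lemma Delta_lin (k : Z) (c : C) (f g : C -> C) (z : C) : C2_upper f -> C2_upper g ->
  upper z -> Delta k (fun w => c * f w + g w)%C z = (c * Delta k f z + Delta k g z)%C.
Proof.
intros (F1 & F2 & F3) (G1 & G2 & G3) Hz; unfold Delta.
rewrite dx_lin by assumption.
rewrite (dx_ext _ (fun w => c * dx f w + dx g w)%C)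
  by (try assumption; intros; now apply dx_lin).
rewrite (dy_ext _ (fun w => c * dy f w + dy g w)%C)
  by (try assumption; intros; now apply dy_lin).
rewrite dx_lin, dy_lin by assumption; ring.
Qed.

(** * Composition with real affine maps z -> s z + x0 *)

Section Affine.
Variables (s x0 : R).
Hypothesis Hs : 0 < s.

Definition aff (z : C) : C := (s * Re z + x0, s * Im z).

Lemma upper_aff (z : C) : upper z -> upper (aff z).
Proof using Hs. unfold upper; cbn; intros Hz; now apply Rmult_lt_0_compat. Qed.

Lemma continuous_aff (z : C) : continuous aff z.
Proof.
intros P [eps HP].
assert (He : 0 < eps / s) by (apply Rdiv_lt_0_compat; [apply cond_pos | assumption]).
exists (mkposreal _ He); intros w [H1 H2]; apply HP; split; cbn in *;
  unfold AbsRing_ball, abs, minus, plus, opp in *; cbn in *.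
- replace (s * Re w + x0 + - (s * Re z + x0)) with (s * (fst w + - fst z))
    by (unfold Re; ring).
  rewrite Rabs_mult, Rabs_pos_eq by lra.
  apply (Rmult_lt_compat_l s) in H1; [| assumption].
  replace (s * (eps / s)) with (pos eps) in H1 by (field; lra); exact H1.
- replace (s * Im w + - (s * Im z)) with (s * (snd w + - snd z))
    by (unfold Im; ring).
  rewrite Rabs_mult, Rabs_pos_eq by lra.
  apply (Rmult_lt_compat_l s) in H2; [| assumption].
  replace (s * (eps / s)) with (pos eps) in H2 by (field; lra); exact H2.
Qed.

Variable f : C -> C.

Let CDerive_aff (z : C) : C1_upper f -> upper z ->
  (ex_CDerive (slice_x (fun w => f (aff w)) z) (Re z) /\
   dx (fun w => f (aff w)) z = (RtoC s * dx f (aff z))%C) /\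
  (ex_CDerive (slice_y (fun w => f (aff w)) z) (Im z) /\
   dy (fun w => f (aff w)) z = (RtoC s * dy f (aff z))%C).
Proof.
intros Hf Hz; destruct (Hf _ (upper_aff z Hz)) as (F1 & F2 & _ & _); split.
- apply (ex_CDerive_affine s x0 (slice_x f (aff z)) (Re z)); exact F1.
- assert (E : forall u, slice_y (fun w => f (aff w)) z u =
                        slice_y f (aff z) (s * u + 0)).
  { intros u; unfold slice_y; now rewrite Rplus_0_r. }
  cbn [aff Im snd] in F2; change (Im (aff z)) with (s * Im z) in F2.
  rewrite <- (Rplus_0_r (s * Im z)) in F2.
  destruct (ex_CDerive_affine s 0 _ _ F2) as [G1 G2].
  assert (EL : locally (Im z) (fun u =>
    slice_y f (aff z) (s * u + 0) = slice_y (fun w => f (aff w)) z u))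
    by (apply filter_forall; intros; now rewrite E).
  destruct (ex_CDerive_ext_loc _ _ _ EL) as [L1 L2]; split; [now apply L1 |].
  unfold dy; etransitivity; [symmetry; exact L2 | etransitivity; [exact G2 |]].
  now rewrite Rplus_0_r.
Qed.

Lemma dx_aff (z : C) : C1_upper f -> upper z ->
  dx (fun w => f (aff w)) z = (RtoC s * dx f (aff z))%C.
Proof using Hs. intros Hf Hz; now apply CDerive_aff. Qed.

Lemma dy_aff (z : C) : C1_upper f -> upper z ->
  dy (fun w => f (aff w)) z = (RtoC s * dy f (aff z))%C.
Proof using Hs. intros Hf Hz; now apply CDerive_aff. Qed.

Lemma C1_upper_aff : C1_upper f -> C1_upper (fun w => f (aff w)).
Proof using Hs.
intros Hf z Hz; destruct (Hf _ (upper_aff z Hz)) as (_ & _ & F3 & F4).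
split; [now apply CDerive_aff |]; split; [now apply CDerive_aff |]; split.
- apply (continuous_ext_loc _ (fun w => RtoC s * dx f (aff w))%C).
  + generalize (open_upper z Hz); apply filter_imp; intros w Hw; symmetry.
    now apply dx_aff.
  + apply (continuous_scal_r (K := C_AbsRing) (V := C_NormedModule)).
    apply (continuous_comp aff (dx f)); [apply continuous_aff | exact F3].
- apply (continuous_ext_loc _ (fun w => RtoC s * dy f (aff w))%C).
  + generalize (open_upper z Hz); apply filter_imp; intros w Hw; symmetry.
    now apply dy_aff.
  + apply (continuous_scal_r (K := C_AbsRing) (V := C_NormedModule)).
    apply (continuous_comp aff (dy f)); [apply continuous_aff | exact F4].
Qed.
End Affine.

Lemma C1_upper_0 : C1_upper (fun _ => RtoC 0).
Proof.
assert (H : forall t, ex_CDerive (fun _ => RtoC 0) t /\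
                      CDerive (fun _ => RtoC 0) t = RtoC 0).
{ intros t; split; [split; apply ex_derive_const |].
  unfold CDerive; now rewrite !Derive_const. }
intros z Hz; split; [apply H |]; split; [apply H |]; split.
- apply (continuous_ext (fun _ => RtoC 0)); [intros w; symmetry; apply H |].
  apply continuous_const.
- apply (continuous_ext (fun _ => RtoC 0)); [intros w; symmetry; apply H |].
  apply continuous_const.
Qed.

Lemma C1_upper_scal (c : C) (f : C -> C) : C1_upper f -> C1_upper (fun w => c * f w)%C.
Proof.
intros Hf; apply (C1_upper_ext (fun w => c * f w + RtoC 0)%C).
- intros; ring.
- apply (C1_upper_lin c f (fun _ => RtoC 0)); [assumption | apply C1_upper_0].
Qed.

Lemma dx_scal (c : C) (f : C -> C) (z : C) : C1_upper f -> upper z ->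
  dx (fun w => c * f w)%C z = (c * dx f z)%C.
Proof.
intros Hf Hz; rewrite (dx_ext _ (fun w => c * f w + RtoC 0)%C)
  by (try assumption; intros; ring).
rewrite (dx_lin c f (fun _ => RtoC 0)) by (try assumption; apply C1_upper_0).
replace (dx (fun _ => RtoC 0) z) with (RtoC 0); [ring |].
unfold dx, CDerive, slice_x; now rewrite !Derive_const.
Qed.

Lemma dy_scal (c : C) (f : C -> C) (z : C) : C1_upper f -> upper z ->
  dy (fun w => c * f w)%C z = (c * dy f z)%C.
Proof.
intros Hf Hz; rewrite (dy_ext _ (fun w => c * f w + RtoC 0)%C)
  by (try assumption; intros; ring).
rewrite (dy_lin c f (fun _ => RtoC 0)) by (try assumption; apply C1_upper_0).
replace (dy (fun _ => RtoC 0) z) with (RtoC 0); [ring |].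
unfold dy, CDerive, slice_y; now rewrite !Derive_const.
Qed.

Lemma C2_upper_aff (s x0 : R) (f : C -> C) : 0 < s -> C2_upper f ->
  C2_upper (fun w => f (aff s x0 w)).
Proof.
intros Hs (F1 & F2 & F3); split; [now apply C1_upper_aff |]; split.
- apply (C1_upper_ext (fun w => RtoC s * dx f (aff s x0 w))%C).
  + intros z Hz; symmetry; now apply dx_aff.
  + apply (C1_upper_scal (RtoC s) (fun w => dx f (aff s x0 w))); now apply C1_upper_aff.
- apply (C1_upper_ext (fun w => RtoC s * dy f (aff s x0 w))%C).
  + intros z Hz; symmetry; now apply dy_aff.
  + apply (C1_upper_scal (RtoC s) (fun w => dy f (aff s x0 w))); now apply C1_upper_aff.
Qed.

(** Each term of [Delta] has as many factors y as derivatives, so the powers of s cancel. *)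
Lemma Delta_aff (k : Z) (s x0 : R) (f : C -> C) (z : C) : 0 < s -> C2_upper f -> upper z ->
  Delta k (fun w => f (aff s x0 w)) z = Delta k f (aff s x0 z).
Proof.
intros Hs (F1 & F2 & F3) Hz; unfold Delta.
rewrite (dx_ext (dx _) (fun w => RtoC s * dx f (aff s x0 w))%C)
  by (try assumption; intros; now apply dx_aff).
rewrite (dy_ext (dy _) (fun w => RtoC s * dy f (aff s x0 w))%C)
  by (try assumption; intros; now apply dy_aff).
rewrite dx_scal, dy_scal by (try assumption; now apply C1_upper_aff).
rewrite (dx_aff s x0 Hs (dx f)), (dy_aff s x0 Hs (dy f)), dx_aff by assumption.
change (Im (aff s x0 z)) with (s * Im z).
rewrite Rpow_mult_distr; cbn [pow]; rewrite !RtoC_mult; ring.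
Qed.

(** * Square integrability *)

Definition cont_upper (h : R -> R -> R) : Prop :=
  forall x y, 0 < y -> continuity_2d_pt h x y.

Lemma cont_upper_y (h : R -> R -> R) (x y : R) : cont_upper h -> 0 < y ->
  continuous (h x) y.
Proof.
intros Hh Hy; specialize (Hh x y Hy); apply continuity_2d_pt_filterlim in Hh.
apply (filterlim_comp _ _ _ (fun t => (x, t)) (fun z => h (fst z) (snd z)) _
         (locally (x, y))); [| exact Hh].
intros P [eps HP]; exists eps; intros t Ht; apply HP; split; [apply ball_center | exact Ht].
Qed.

Lemma ex_RInt_upper (h : R -> R -> R) (x a b : R) : cont_upper h -> 0 < a -> 0 < b ->
  ex_RInt (h x) a b.
Proof.
intros Hh Ha Hb; apply (ex_RInt_continuous (V := R_CompleteNormedModule)).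
intros y Hy; apply cont_upper_y; [assumption |].
apply Rlt_le_trans with (Rmin a b); [now apply Rmin_glb_lt | apply Hy].
Qed.

(* Substituting [y = phi x + t (Y - phi x)] makes the bounds constant. *)
Lemma RInt_upper_continuous (h : R -> R -> R) (phi : R -> R) (Y x0 : R) :
  cont_upper h -> 0 < Y -> 0 < phi x0 -> continuous phi x0 ->
  continuous (fun x => RInt (h x) (phi x) Y) x0.
Proof.
intros Hh HY Hp0 Hphi.
pose (y := fun x t => (Y - phi x) * t + phi x).
pose (g := fun x t => (Y - phi x) * h x (y x t)).
assert (Hpos : locally x0 (fun x => 0 < phi x)).
{ apply (Hphi (fun t => 0 < t)), locally_pos, Hp0. }
assert (Hy : forall x t, 0 < phi x -> 0 <= t <= 1 -> 0 < y x t).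
{ intros x t Hx Ht; unfold y.
  replace ((Y - phi x) * t + phi x) with (Y * t + phi x * (1 - t)) by ring.
  destruct (Req_dec t 0) as [-> |]; [lra |].
  assert (0 < Y * t) by (apply Rmult_lt_0_compat; lra).
  assert (0 <= phi x * (1 - t)) by (apply Rmult_le_pos; lra); lra. }
assert (Hex : forall x, 0 < phi x -> ex_RInt (h x) ((Y - phi x) * 0 + phi x)
                                       ((Y - phi x) * 1 + phi x)).
{ intros x Hx; apply ex_RInt_upper; [assumption | lra | lra]. }
assert (Hsub : forall x, 0 < phi x ->
  ex_RInt (g x) 0 1 /\ RInt (h x) (phi x) Y = RInt (g x) 0 1).
{ intros x Hx; split.
  - apply (ex_RInt_comp_lin (h x) (Y - phi x) (phi x) 0 1); now apply Hex.
  - transitivity (RInt (h x) ((Y - phi x) * 0 + phi x) ((Y - phi x) * 1 + phi x)).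
    + f_equal; ring.
    + symmetry; apply (RInt_comp_lin (h x) (Y - phi x) (phi x) 0 1); now apply Hex. }
assert (Hphi2 : forall t, continuity_2d_pt (fun x _ => phi x) x0 t).
{ intros t; apply (continuity_1d_2d_pt_comp phi (fun x _ => x)).
  - now apply continuity_pt_filterlim.
  - apply continuity_2d_pt_id1. }
assert (HY2 : forall t, continuity_2d_pt (fun x _ => Y - phi x) x0 t).
{ intros t; apply continuity_2d_pt_minus; [apply continuity_2d_pt_const | apply Hphi2]. }
assert (Hg : forall t, 0 <= t <= 1 -> continuity_2d_pt g x0 t).
{ intros t Ht; unfold g; apply continuity_2d_pt_mult; [apply HY2 |].
  assert (Hyc : continuity_2d_pt y x0 t).
  { unfold y; apply continuity_2d_pt_plus; [| apply Hphi2].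
    apply continuity_2d_pt_mult; [apply HY2 | apply continuity_2d_pt_id2]. }
  intros eps; destruct (Hh x0 (y x0 t) (Hy x0 t Hp0 Ht) eps) as [d Hd].
  destruct (Hyc d) as [d' Hd'].
  exists (mkposreal (Rmin d d') (Rmin_stable_in_posreal d d')); intros u v Hu Hv.
  cbn [pos] in Hu, Hv; apply Hd.
  - eapply Rlt_le_trans; [exact Hu | apply Rmin_l].
  - apply Hd'; (eapply Rlt_le_trans; [eassumption | apply Rmin_r]). }
apply (continuous_ext_loc _ (fun x => RInt (g x) 0 1)).
{ revert Hpos; apply filter_imp; intros x Hx; symmetry; now apply Hsub. }
apply continuity_pt_filterlim, continuity_pt_locally; intros eps.
assert (He : 0 < eps / 2) by (assert (H := cond_pos eps); lra).
(* Compactness of the segment over x0 provides one radius valid for all t between 0 and 1. *)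
destruct (uniform_continuity_2d_1d' g 0 1 x0 Hg (mkposreal _ He)) as [d Hd].
assert (Hnear : locally x0 (fun x => Rabs (x - x0) < d)) by (now exists d).
generalize (filter_and _ _ Hpos Hnear); apply filter_imp; intros x [Hx Hxd].
apply Rabs_def2 in Hxd.
destruct (Hsub x Hx) as [Ex _], (Hsub x0 Hp0) as [E0 _].
assert (Hm := RInt_minus (V := R_CompleteNormedModule) (g x) (g x0) 0 1 Ex E0).
change minus with Rminus in Hm; rewrite <- Hm.
apply Rle_lt_trans with ((1 - 0) * (eps / 2)); [| assert (H := cond_pos eps); lra].
apply abs_RInt_le_const; [lra | now apply @ex_RInt_minus |].
intros t Ht; left.
assert (H := cond_pos d).
apply (Hd t x0 t x); try lra; rewrite Rminus_diag, Rabs_R0; lra.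
Qed.

Lemma ex_RInt_upper2 (h : R -> R -> R) (phi : R -> R) (Y a b : R) :
  cont_upper h -> 0 < Y -> a <= b -> (forall x, a <= x <= b -> 0 < phi x) ->
  (forall x, a <= x <= b -> continuous phi x) ->
  ex_RInt (fun x => RInt (h x) (phi x) Y) a b.
Proof.
intros Hh HY Hab Hp Hc; apply (ex_RInt_continuous (V := R_CompleteNormedModule)).
intros x Hx; rewrite Rmin_left, Rmax_right in Hx by assumption.
apply RInt_upper_continuous; auto.
Qed.

Lemma ex_RInt_upper_const (h : R -> R -> R) (y Y a b : R) :
  cont_upper h -> 0 < y -> 0 < Y -> a <= b ->
  ex_RInt (fun x => RInt (h x) y Y) a b.
Proof.
intros Hh Hy HY Hab; apply (ex_RInt_upper2 h (fun _ => y)); auto.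
intros; apply continuous_const.
Qed.

Definition arc (x : R) : R := sqrt (1 - x ^ 2).

Lemma arc_pos (x : R) : - (1 / 2) <= x <= 1 / 2 -> 0 < arc x <= 1.
Proof.
intros Hx; split; [apply sqrt_lt_R0; nra |].
rewrite <- sqrt_1; apply sqrt_le_1_alt; nra.
Qed.

Lemma arc_continuous (x : R) : continuous arc x.
Proof.
apply (continuous_comp (fun x => 1 - x ^ 2) sqrt); [| apply continuous_sqrt].
apply (ex_derive_continuous (fun x => 1 - x ^ 2)); auto_derive; trivial.
Qed.

Lemma ex_RInt_arc (h : R -> R -> R) (Y : R) : cont_upper h -> 0 < Y ->
  ex_RInt (fun x => RInt (h x) (arc x) Y) (- (1 / 2)) (1 / 2).
Proof.
intros Hh HY; apply ex_RInt_upper2; [assumption | assumption | lra | |].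
- intros x Hx; now apply arc_pos.
- intros x _; apply arc_continuous.
Qed.

Lemma RInt_Chasles_upper (h : R -> R -> R) (x a b c : R) : cont_upper h ->
  0 < a -> 0 < b -> 0 < c -> RInt (h x) a b + RInt (h x) b c = RInt (h x) a c.
Proof.
intros Hh Ha Hb Hc; apply (RInt_Chasles (V := R_CompleteNormedModule));
  now apply ex_RInt_upper.
Qed.

Lemma RInt_upper_ge_0 (h : R -> R -> R) (x a b : R) : cont_upper h ->
  (forall x y, 0 <= h x y) -> 0 < a -> a <= b -> 0 <= RInt (h x) a b.
Proof.
intros Hh Hp Ha Hab; apply RInt_ge_0; [assumption | apply ex_RInt_upper; lra || assumption |].
intros; apply Hp.
Qed.

Definition dens (f : C -> C) (x y : R) : R := Cmod (f (x, y)) ^ 2 / y ^ 2.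

Lemma dens_ge_0 (f : C -> C) (x y : R) : 0 <= dens f x y.
Proof.
unfold dens; destruct (Req_dec y 0) as [-> |].
- replace (0 ^ 2) with 0 by ring; unfold Rdiv; rewrite Rinv_0; lra.
- apply Rdiv_le_0_compat; [apply pow2_ge_0 | now apply pow2_gt_0].
Qed.

Lemma continuous_part_2d (f : C -> C) (z : C) : continuous f z ->
  continuity_2d_pt (fun x y => Re (f (x, y))) (Re z) (Im z) /\
  continuity_2d_pt (fun x y => Im (f (x, y))) (Re z) (Im z).
Proof.
intros Hf; destruct z as [x y]; split; intros eps;
  destruct (Hf (ball (f (x, y)) eps) (locally_ball _ eps)) as [d Hd];
  exists d; intros u v Hu Hv; apply (Hd (u, v)); split; assumption.
Qed.

Lemma cont_upper_dens (f : C -> C) : (forall z, upper z -> continuous f z) ->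
  cont_upper (dens f).
Proof.
intros Hf x y Hy; destruct (continuous_part_2d f (x, y) (Hf (x, y) Hy)) as [H1 H2].
apply (continuity_2d_pt_ext (fun x y =>
  (Re (f (x, y)) * Re (f (x, y)) + Im (f (x, y)) * Im (f (x, y))) * / (y * y))).
{ intros u w; unfold dens; rewrite Cmod2_alt; unfold Rdiv; f_equal; [ring |].
  f_equal; ring. }
apply continuity_2d_pt_mult.
- apply continuity_2d_pt_plus; now apply continuity_2d_pt_mult.
- apply continuity_2d_pt_inv; [| apply Rgt_not_eq, Rmult_lt_0_compat; exact Hy].
  apply continuity_2d_pt_mult; apply continuity_2d_pt_id2.
Qed.

Lemma continuous_C (f : C -> C) (z : C) : continuous (fun w => Re (f w)) z ->
  continuous (fun w => Im (f w)) z -> continuous f z.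
Proof.
intros H1 H2 P [eps HP].
assert (A : locally z (fun w => ball (Re (f z)) eps (Re (f w))))
  by exact (H1 _ (locally_ball _ eps)).
assert (B : locally z (fun w => ball (Im (f z)) eps (Im (f w))))
  by exact (H2 _ (locally_ball _ eps)).
unfold filtermap; generalize (filter_and _ _ A B); apply filter_imp.
intros w [Aw Bw]; apply HP; now split.
Qed.

(** [C1_upper] speaks of partial derivatives. That in x exists nearby and is continuous at z, that
    in y exists at z; together they give total differentiability, hence continuity. *)
Lemma C1_upper_continuous (f : C -> C) (z : C) : C1_upper f -> upper z -> continuous f z.
Proof.
intros Hf Hz; assert (Hop := open_upper z Hz); destruct z as [x y].
destruct (Hf _ Hz) as (_ & [F2r F2i] & F3 & _).
destruct (continuous_part_2d _ _ F3) as [G1 G2].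
apply continuity_2d_pt_filterlim in G1, G2.
apply continuous_C.
- apply (continuous_ext (fun w : R * R => Re (f (fst w, snd w)))); [now intros [? ?] |].
  apply (filterdiff_continuous (K := R_AbsRing)
    (U := prod_NormedModule _ R_NormedModule R_NormedModule) (V := R_NormedModule)).
  eexists; apply (is_derive_filterdiff (fun x y => Re (f (x, y))) x y
    (fun x y => Re (dx f (x, y))) (Derive (fun y => Re (f (x, y))) y)).
  + revert Hop; apply filter_imp; intros [u w] Hu.
    apply Derive_correct; now apply (Hf (u, w) Hu).
  + apply Derive_correct; exact F2r.
  + exact G1.
- apply (continuous_ext (fun w : R * R => Im (f (fst w, snd w)))); [now intros [? ?] |].
  apply (filterdiff_continuous (K := R_AbsRing)
    (U := prod_NormedModule _ R_NormedModule R_NormedModule) (V := R_NormedModule)).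
  eexists; apply (is_derive_filterdiff (fun x y => Im (f (x, y))) x y
    (fun x y => Im (dx f (x, y))) (Derive (fun y => Im (f (x, y))) y)).
  + revert Hop; apply filter_imp; intros [u w] Hu.
    apply Derive_correct; now apply (Hf (u, w) Hu).
  + apply Derive_correct; exact F2i.
  + exact G2.
Qed.

Definition strip_norm2 (y0 : R) (f : C -> C) (Y : R) : R :=
  RInt (fun x => RInt (dens f x) y0 Y) (- (1 / 2)) (1 / 2).

(** For y0 >= 1 the fundamental domain above y0 is a half-strip, whose images under affine maps are
    half-strips again; continuity takes care of the compact part below y0. *)
Definition cusp_bounded (y0 : R) (f : C -> C) : Prop :=
  (forall z, upper z -> continuous f z) /\
  exists M, forall Y, y0 <= Y -> strip_norm2 y0 f Y <= M.

Lemma trunc_norm2_mono (f : C -> C) (Y Y' : R) : (forall z, upper z -> continuous f z) ->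
  1 <= Y -> Y <= Y' -> trunc_norm2 f Y <= trunc_norm2 f Y'.
Proof.
intros Hf H1 H2; assert (Hd := cont_upper_dens f Hf).
apply RInt_le; [lra | apply (ex_RInt_arc (dens f)); [assumption | lra] | | ].
- apply (ex_RInt_arc (dens f)); [assumption | lra].
- intros x Hx; change (RInt (dens f x) (arc x) Y <= RInt (dens f x) (arc x) Y').
  destruct (arc_pos x) as [A1 A2]; [lra |].
  rewrite <- (RInt_Chasles_upper (dens f) x (arc x) Y Y') by (assumption || lra).
  assert (H := RInt_upper_ge_0 (dens f) x Y Y' Hd (dens_ge_0 f) ltac:(lra) H2); lra.
Qed.

Lemma cusp_bounded_square_integrable (y0 : R) (f : C -> C) : 1 <= y0 ->
  cusp_bounded y0 f -> square_integrable f.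
Proof.
intros Hy [Hf [M HM]]; assert (Hd := cont_upper_dens f Hf).
assert (Hsplit : forall Y, y0 <= Y ->
  trunc_norm2 f Y = trunc_norm2 f y0 + strip_norm2 y0 f Y).
{ intros Y HY; unfold strip_norm2.
  change (trunc_norm2 f Y) with (RInt (fun x => RInt (dens f x) (arc x) Y) (- (1/2)) (1/2)).
  change (trunc_norm2 f y0) with (RInt (fun x => RInt (dens f x) (arc x) y0) (- (1/2)) (1/2)).
  assert (E := RInt_plus (V := R_CompleteNormedModule)
    (fun x => RInt (dens f x) (arc x) y0) (fun x => RInt (dens f x) y0 Y)
    (- (1/2)) (1/2)).
  change plus with Rplus in E; rewrite <- E.
  - apply RInt_ext; intros x Hx; rewrite Rmin_left, Rmax_right in Hx by lra.
    symmetry; destruct (arc_pos x) as [A1 A2]; [lra |].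
    apply RInt_Chasles_upper; assumption || lra.
  - apply ex_RInt_arc; assumption || lra.
  - apply ex_RInt_upper_const; assumption || lra. }
exists (trunc_norm2 f y0 + M); intros Y HY; destruct (Rle_dec y0 Y) as [H | H].
- rewrite Hsplit by assumption; apply Rplus_le_compat_l; now apply HM.
- apply Rle_trans with (trunc_norm2 f y0).
  + apply trunc_norm2_mono; assumption || lra.
  (* Splitting at Y = y0 shows that [strip_norm2 y0 f y0] is 0, hence M >= 0. *)
  + assert (E := Hsplit y0 (Rle_refl _)); specialize (HM y0 (Rle_refl _)); lra.
Qed.

Lemma RInt_le_lin (h f g : R -> R) (a b p q : R) : a <= b ->
  ex_RInt h a b -> ex_RInt f a b -> ex_RInt g a b ->
  (forall x, a < x < b -> h x <= p * f x + q * g x) ->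
  RInt h a b <= p * RInt f a b + q * RInt g a b.
Proof.
intros Hab Hh Hf Hg H.
assert (Hf' : ex_RInt (fun x => p * f x) a b) by exact (ex_RInt_scal f a b p Hf).
assert (Hg' : ex_RInt (fun x => q * g x) a b) by exact (ex_RInt_scal g a b q Hg).
replace (p * RInt f a b) with (RInt (fun x => p * f x) a b)
  by exact (RInt_scal f a b p Hf).
replace (q * RInt g a b) with (RInt (fun x => q * g x) a b)
  by exact (RInt_scal g a b q Hg).
replace (RInt (fun x => p * f x) a b + RInt (fun x => q * g x) a b)
  with (RInt (fun x => p * f x + q * g x) a b) by exact (RInt_plus _ _ a b Hf' Hg').
apply RInt_le; [assumption | assumption | exact (ex_RInt_plus _ _ a b Hf' Hg') | exact H].
Qed.

(** Pointwise, |c f + g|^2 <= 2 |c|^2 |f|^2 + 2 |g|^2. *)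
Lemma cusp_bounded_lin (y0 : R) (c : C) (f g : C -> C) : 0 < y0 ->
  cusp_bounded y0 f -> cusp_bounded y0 g ->
  cusp_bounded y0 (fun z => c * f z + g z)%C.
Proof.
intros Hy [Hf [M HM]] [Hg [N HN]].
assert (Hc : forall z, upper z -> continuous (fun z => c * f z + g z)%C z)
  by (intros; apply continuous_Clin; auto).
split; [exact Hc |].
exists (2 * Cmod c ^ 2 * M + 2 * N); intros Y HY.
apply Rle_trans with (2 * Cmod c ^ 2 * strip_norm2 y0 f Y + 2 * strip_norm2 y0 g Y).
2:{ assert (H1 := HM Y HY); assert (H2 := HN Y HY).
    assert (H3 := pow2_ge_0 (Cmod c)).
    assert (2 * Cmod c ^ 2 * strip_norm2 y0 f Y <= 2 * Cmod c ^ 2 * M)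
      by (apply Rmult_le_compat_l; lra).
    lra. }
assert (Df := cont_upper_dens f Hf); assert (Dg := cont_upper_dens g Hg).
assert (Dh := cont_upper_dens _ Hc).
assert (Hin : forall x, RInt (dens (fun z => c * f z + g z)%C x) y0 Y <=
  2 * Cmod c ^ 2 * RInt (dens f x) y0 Y + 2 * RInt (dens g x) y0 Y).
{ intros x; apply RInt_le_lin; [lra | | | |]; try (apply ex_RInt_upper; assumption || lra).
  intros y Hyy.
    unfold dens.
    assert (H1 := Cmod_triangle (c * f (x, y)) (g (x, y))); rewrite Cmod_mult in H1.
    assert (Hpos := Cmod_ge_0 (c * f (x, y) + g (x, y))).
    assert (Hi : 0 < / y ^ 2) by (apply Rinv_0_lt_compat, pow_lt; lra).
    set (A := Cmod c) in *; set (B := Cmod (f (x, y))) in *; set (G := Cmod (g (x, y))) in *.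
    set (S := Cmod (c * f (x, y) + g (x, y))) in *.
    replace (2 * A ^ 2 * (B ^ 2 / y ^ 2) + 2 * (G ^ 2 / y ^ 2))
      with ((2 * (A * B) ^ 2 + 2 * G ^ 2) * / y ^ 2) by (unfold Rdiv; ring).
    apply Rmult_le_compat_r; [lra |].
    apply Rle_trans with ((A * B + G) ^ 2); [apply pow_incr; lra |].
    assert (H2 := pow2_ge_0 (A * B - G)); nra. }
apply RInt_le_lin; [lra | | | |]; try (apply ex_RInt_upper_const; assumption || lra).
intros x _; apply Hin.
Qed.

Lemma cusp_bounded_ext (y0 : R) (f g : C -> C) : 0 < y0 ->
  (forall z, upper z -> f z = g z) -> cusp_bounded y0 f -> cusp_bounded y0 g.
Proof.
intros Hy H [Hf [M HM]]; split.
- intros z Hz; apply (continuous_ext_loc _ f); [| now apply Hf].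
  generalize (open_upper z Hz); now apply filter_imp.
- exists M; intros Y HY; eapply Rle_trans; [| apply (HM Y HY)]; right.
  apply RInt_ext; intros x _; apply RInt_ext; intros y Hyy.
  rewrite Rmin_left in Hyy by assumption.
  unfold dens; rewrite H; [reflexivity | unfold upper; cbn; lra].
Qed.

Lemma cusp_bounded_0 (y0 : R) : 0 < y0 -> cusp_bounded y0 (fun _ => RtoC 0).
Proof.
intros Hy; split; [intros; apply continuous_const |].
exists 0; intros Y HY; right; unfold strip_norm2.
rewrite (RInt_ext _ (fun _ => 0)); [rewrite RInt_const; apply Rmult_0_r |].
intros x _; rewrite (RInt_ext _ (fun _ => 0)); [rewrite RInt_const; apply Rmult_0_r |].
intros y _; unfold dens; rewrite Cmod_0, pow_i by lia; apply Rmult_0_l.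
Qed.

Lemma RInt_periodic (G : R -> R) : (forall x, continuous G x) ->
  (forall x, G (x + 1) = G x) -> forall K : nat,
  RInt G (- (1 / 2) - INR K) (1 / 2 + INR K) =
  (2 * INR K + 1) * RInt G (- (1 / 2)) (1 / 2).
Proof.
intros Hc Hp.
assert (Hex : forall a b, ex_RInt G a b).
{ intros a b; apply (ex_RInt_continuous (V := R_CompleteNormedModule)); auto. }
assert (Hn : forall (n : nat) x, G (x + INR n) = G x).
{ induction n as [| n IH]; intros x; [now rewrite Rplus_0_r |].
  rewrite S_INR, <- Rplus_assoc, Hp; apply IH. }
assert (Hsh : forall a b c, (forall x, G (x + c) = G x) ->
  RInt G (a + c) (b + c) = RInt G a b).
{ intros a b c H; assert (E := RInt_comp_lin (V := R_CompleteNormedModule) G 1 c a b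
    (Hex _ _)).
  rewrite !Rmult_1_l in E; rewrite <- E; apply RInt_ext; intros x _.
  change scal with Rmult; rewrite !Rmult_1_l; apply H. }
assert (Hch : forall a b c, RInt G a b + RInt G b c = RInt G a c).
{ intros; apply (RInt_Chasles (V := R_CompleteNormedModule)); auto. }
induction K as [| K IH].
- cbn [INR]; rewrite Rminus_0_r, Rplus_0_r.
  now rewrite Rmult_0_r, Rplus_0_l, Rmult_1_l.
- rewrite <- (Hch _ (- (1 / 2) - INR K)), <- (Hch (- (1 / 2) - INR K) (1 / 2 + INR K)).
  rewrite IH.
  rewrite <- (Hsh (1 / 2 + INR K) (1 / 2 + INR (S K)) (- INR (S K))).
  2:{ intros x; rewrite <- (Hn (S K) (x + - INR (S K))).
      now replace (x + - INR (S K) + INR (S K)) with x by ring. }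
  rewrite <- (Hsh (- (1 / 2) - INR (S K)) (- (1 / 2) - INR K) (INR (S K)) (Hn (S K))).
  rewrite S_INR.
  replace (- (1 / 2) - (INR K + 1) + (INR K + 1)) with (- (1 / 2)) by ring.
  replace (- (1 / 2) - INR K + (INR K + 1)) with (1 / 2) by field.
  replace (1 / 2 + INR K + - (INR K + 1)) with (- (1 / 2)) by field.
  replace (1 / 2 + (INR K + 1) + - (INR K + 1)) with (1 / 2) by ring.
  generalize (RInt G (- (1 / 2)) (1 / 2)); intros t; change R in t.
  match goal with |- ?a = ?b => change (@eq R a b) end; ring.
Qed.

Lemma cusp_bounded_aff (y0 s x0 : R) (f : C -> C) : 0 < y0 -> 0 < s -> 1 <= s * y0 ->
  (forall z, upper z -> continuous f z) ->
  (forall z, upper z -> Cmod (f (z + RtoC 1)%C) = Cmod (f z)) ->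
  square_integrable f -> cusp_bounded y0 (fun z => f (aff s x0 z)).
Proof.
intros Hy Hs Hsy Hf Hper [M HM].
assert (Hfa : forall z, upper z -> continuous (fun z => f (aff s x0 z)) z).
{ intros z Hz; apply (continuous_comp (aff s x0) f); [now apply continuous_aff |].
  now apply Hf, upper_aff. }
split; [exact Hfa |].
(* This K places the image interval, centred at x0 with half-width s/2, inside -1/2 - K, 1/2 + K,
   which is 2 K + 1 periods long. *)
destruct (INR_unbounded (s / 2 + Rabs x0)) as [K HK].
exists ((2 * INR K + 1) * M); intros Y HY.
assert (HsY : 1 <= s * Y) by nra.
assert (Hd := cont_upper_dens f Hf).
pose (G := fun x => RInt (dens f x) 1 (s * Y)).
assert (HGc : forall x, continuous G x).
{ intros x; apply (RInt_upper_continuous (dens f) (fun _ => 1));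
    [assumption | lra | lra | apply continuous_const]. }
assert (HGex : forall a b, ex_RInt G a b).
{ intros a b; apply (ex_RInt_continuous (V := R_CompleteNormedModule)); auto. }
assert (HG0 : forall x, 0 <= G x).
{ intros x; apply RInt_upper_ge_0; [assumption | apply dens_ge_0 | lra | assumption]. }
assert (HGp : forall x, G (x + 1) = G x).
{ intros x; apply RInt_ext; intros y Hyy; rewrite Rmin_left in Hyy by assumption.
  unfold dens; rewrite <- (Hper (x, y)); [| unfold upper; cbn; lra].
  replace ((x + 1, y) : C) with ((x, y) + RtoC 1)%C by (apply C_eq; cbn; ring).
  reflexivity. }
apply Rle_trans with (RInt G (s * - (1 / 2) + x0) (s * (1 / 2) + x0)).
{ assert (E := RInt_comp_lin (V := R_CompleteNormedModule) G s x0 (- (1 / 2)) (1 / 2)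
    (HGex _ _)).
  rewrite <- E; apply RInt_le; [lra | | |].
  - apply ex_RInt_upper_const; [now apply cont_upper_dens | lra | lra | lra].
  - apply (ex_RInt_comp_lin (V := R_NormedModule)), HGex.
  - intros x _; change scal with Rmult; unfold G.
    assert (Ex : ex_RInt (dens f (s * x + x0)) (s * y0 + 0) (s * Y + 0))
      by (apply ex_RInt_upper; [assumption | lra | lra]).
    assert (E' := RInt_comp_lin (V := R_CompleteNormedModule) (dens f (s * x + x0))
                    s 0 y0 Y Ex).
    apply (ex_RInt_comp_lin (V := R_NormedModule)) in Ex.
    apply Rle_trans with (s * RInt (dens f (s * x + x0)) (s * y0 + 0) (s * Y + 0)).
    + right; rewrite <- E'.
      assert (E2 := RInt_scal (V := R_CompleteNormedModule) _ _ _ s Ex).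
      change scal with Rmult in E2 |- *; rewrite <- E2.
      apply RInt_ext; intros y Hyy; rewrite Rmin_left in Hyy by assumption.
      unfold dens, aff; cbn [Re Im fst snd]; rewrite Rplus_0_r.
      match goal with |- ?a = ?b => change (@eq R a b) end; field.
      split; lra.
    + apply Rmult_le_compat_l; [lra |]; rewrite !Rplus_0_r.
      rewrite <- (RInt_Chasles_upper (dens f) _ 1 (s * y0) (s * Y)) by (assumption || lra).
      assert (H := RInt_upper_ge_0 (dens f) (s * x + x0) 1 (s * y0) Hd (dens_ge_0 f)
                     ltac:(lra) Hsy); lra. }
apply Rle_trans with (RInt G (- (1 / 2) - INR K) (1 / 2 + INR K)).
{ assert (Hch : forall a b c, RInt G a b + RInt G b c = RInt G a c).
  { intros; apply (RInt_Chasles (V := R_CompleteNormedModule)); auto. }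
  assert (H0 : forall a b, a <= b -> 0 <= RInt G a b)
    by (intros; apply RInt_ge_0; auto).
  rewrite <- (Hch (- (1 / 2) - INR K) (s * - (1 / 2) + x0)).
  rewrite <- (Hch (s * - (1 / 2) + x0) (s * (1 / 2) + x0) (1 / 2 + INR K)).
  assert (A1 := Rle_abs x0); assert (A2 := Rle_abs (- x0)); rewrite Rabs_Ropp in A2.
  assert (B1 := H0 (- (1 / 2) - INR K) (s * - (1 / 2) + x0) ltac:(lra)).
  assert (B2 := H0 (s * (1 / 2) + x0) (1 / 2 + INR K) ltac:(lra)); lra. }
rewrite RInt_periodic by assumption.
assert (HKp := pos_INR K).
apply Rmult_le_compat_l; [lra |].
(* Over |x| <= 1/2 the arc lies below height 1, so G is at most the corresponding inner integral
   over the fundamental domain. *)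
eapply Rle_trans; [| apply (HM (s * Y) HsY)].
apply RInt_le; [lra | apply HGex | apply (ex_RInt_arc (dens f)); [assumption | lra] |].
intros x Hx; change (G x <= RInt (dens f x) (arc x) (s * Y)); unfold G.
destruct (arc_pos x) as [A1 A2]; [lra |].
rewrite <- (RInt_Chasles_upper (dens f) x (arc x) 1 (s * Y)) by (assumption || lra).
assert (H := RInt_upper_ge_0 (dens f) x (arc x) 1 Hd (dens_ge_0 f) A1 A2); lra.
Qed.

(** The conditions that each summand f((a z + b) / d) satisfies by itself and that pass to linear
    combinations; automorphy is obtained for the whole sum only. *)
Definition eigen_bounded (k : Z) (lam y0 : R) (f : C -> C) : Prop :=
  C2_upper f /\
  (forall z, upper z -> (Delta k f z + RtoC lam * f z)%C = RtoC 0) /\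
  cusp_bounded y0 f.

Lemma eigen_bounded_lin (k : Z) (lam y0 : R) (c : C) (f g : C -> C) : 0 < y0 ->
  eigen_bounded k lam y0 f -> eigen_bounded k lam y0 g ->
  eigen_bounded k lam y0 (fun z => c * f z + g z)%C.
Proof.
intros Hy (F1 & F2 & F3) (G1 & G2 & G3); split; [now apply C2_upper_lin | split].
- intros z Hz; rewrite Delta_lin by assumption.
  transitivity (c * (Delta k f z + RtoC lam * f z) + (Delta k g z + RtoC lam * g z))%C;
    [ring | rewrite F2, G2 by assumption; ring].
- now apply cusp_bounded_lin.
Qed.

Lemma eigen_bounded_ext (k : Z) (lam y0 : R) (f g : C -> C) : 0 < y0 ->
  (forall z, upper z -> f z = g z) ->
  eigen_bounded k lam y0 f -> eigen_bounded k lam y0 g.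
Proof.
intros Hy H (F1 & F2 & F3); split; [now apply (C2_upper_ext f) | split].
- intros z Hz; rewrite <- (Delta_ext k f g), <- H by assumption; now apply F2.
- now apply (cusp_bounded_ext y0 f).
Qed.

Lemma eigen_bounded_0 (k : Z) (lam y0 : R) : 0 < y0 ->
  eigen_bounded k lam y0 (fun _ => RtoC 0).
Proof.
intros Hy.
assert (D : forall z, dx (fun _ => RtoC 0) z = RtoC 0 /\ dy (fun _ => RtoC 0) z = RtoC 0).
{ intros z; split; unfold dx, dy, slice_x, slice_y, CDerive; now rewrite !Derive_const. }
split; [| split; [| now apply cusp_bounded_0]].
- split; [apply C1_upper_0 | split];
    apply (C1_upper_ext (fun _ => RtoC 0)); try apply C1_upper_0;
    intros z _; symmetry; apply D.
- intros z Hz; unfold Delta.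
  rewrite (dx_ext (dx _) (fun _ => RtoC 0)), (dy_ext (dy _) (fun _ => RtoC 0))
    by (try assumption; intros; apply D).
  rewrite !(proj1 (D z)), (proj2 (D z)); ring.
Qed.

Lemma eigen_bounded_Csum {A : Type} (k : Z) (lam y0 : R) (l : list A) (c : A -> C)
  (h : A -> C -> C) : 0 < y0 -> (forall i, In i l -> eigen_bounded k lam y0 (h i)) ->
  eigen_bounded k lam y0 (fun z => Csum l (fun i => c i * h i z)%C).
Proof.
intros Hy; induction l as [| i l IH]; intros H; [now apply eigen_bounded_0 |].
apply (eigen_bounded_lin k lam y0 (c i) (h i) (fun z => Csum l (fun i => c i * h i z)%C)).
- assumption.
- apply H; now left.
- apply IH; intros j Hj; apply H; now right.
Qed.

Lemma eigen_bounded_coset (k : Z) (v : SL2Z -> C) (r : R) (m : Z) (f : C -> C)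
  (p : Z * Z) : (0 < m)%Z -> is_eta_multiplier k v -> maass v k r f ->
  In p (cosets m) ->
  eigen_bounded k (1 / 4 + r ^ 2) (IZR m) (fun z => f (coset_act m p z)).
Proof.
intros Hm Hv Hf Hp; destruct p as [d b].
apply in_cosets in Hp as (Hd & Hdm & _); [| assumption].
destruct (codivisor m Hm d Hd Hdm) as [Ha Had].
set (a := (m / d)%Z) in *.
assert (Hm' : 1 <= IZR m) by (apply IZR_le; lia).
assert (Hd' : 0 < IZR d) by now apply IZR_lt.
assert (Ha' : 1 <= IZR a) by (apply IZR_le; lia).
assert (Hs : 0 < IZR a / IZR d) by (apply Rdiv_lt_0_compat; lra).
apply (eigen_bounded_ext _ _ _ (fun z => f (aff (IZR a / IZR d) (IZR b / IZR d) z)));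
  [lra | |].
{ intros z _; unfold coset_act, aff; cbn [fst snd]; fold a.
  rewrite affine_Re_Im by assumption; f_equal; apply f_equal2; field; lra. }
split; [| split].
- now apply C2_upper_aff, (maass_C2 v k r f).
- intros z Hz; rewrite Delta_aff; [| assumption | apply (maass_C2 v k r f Hf) | assumption].
  now apply (maass_eigen v k r f Hf), upper_aff.
- apply cusp_bounded_aff; [lra | assumption | | | |].
  (* With s = a/d and a d = m, height m is mapped to a^2 >= 1; this is why y0 is taken to be m for
     all cosets at once. *)
  + replace (IZR a / IZR d * IZR m) with (IZR a * IZR a)
      by (rewrite <- Had, mult_IZR; field; lra).
    nra.
  + intros z Hz; apply C1_upper_continuous; [| assumption].
    apply (maass_C2 v k r f Hf).
  + intros z Hz; rewrite <- mobius_T, (maass_aut v k r f Hf) by assumption.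
    rewrite !Cmod_mult, (proj1 Hv), Cmod_Cexp.
    replace (Re _) with 0 by (unfold CZ; cbn; ring); rewrite exp_0; ring.
  + apply (maass_L2 v k r f Hf).
Qed.

Lemma maass_hecke (k : Z) (v : SL2Z -> C) (r : R) (m : Z) (f : C -> C) :
  (1 <= k <= 11)%Z -> is_eta_multiplier k v -> (0 < m)%Z ->
  ((k * m) mod 12 = k mod 12)%Z -> maass v k r f -> maass v k r (hecke k m f).
Proof.
intros Hk Hv Hm Hkm Hf.
assert (Hm' : 1 <= IZR m) by (apply IZR_le; lia).
assert (H : eigen_bounded k (1 / 4 + r ^ 2) (IZR m) (hecke k m f)).
{ apply (eigen_bounded_ext _ _ _ (fun z => RtoC (/ sqrt (IZR m)) * Csum (cosets m) (fun p =>
    e (RtoC (IZR (- (k * psi (coset_mat m p))) / 12)) * f (coset_act m p z)) + RtoC 0)%C);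
    [lra | |].
  - intros z _; rewrite hecke_cosets; ring.
  - apply (eigen_bounded_lin k _ _ _ (fun z => Csum (cosets m) (fun p =>
      e (RtoC (IZR (- (k * psi (coset_mat m p))) / 12)) * f (coset_act m p z))%C)
      (fun _ => RtoC 0)); [lra | | apply eigen_bounded_0; lra].
    apply (eigen_bounded_Csum k _ _ _ _ (fun p z => f (coset_act m p z))); [lra |].
    intros p Hp; now apply (eigen_bounded_coset k v). }
destruct H as (H1 & H2 & H3); constructor; [| assumption | assumption |].
- intros g z Hz; apply hecke_automorphic; try assumption.
  apply (maass_aut v k r f Hf).
- now apply (cusp_bounded_square_integrable (IZR m)).
Qed.

(** * The Whittaker function does not vanish identically *)

Lemma sin_Rabs_le (y : R) : Rabs (sin y) <= Rabs y.
Proof.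
destruct (MVT_gen sin 0 y cos) as [c [_ E]].
- intros x _; apply is_derive_Reals, derivable_pt_lim_sin.
- intros x _; apply continuity_sin.
- rewrite sin_0, !Rminus_0_r in E; rewrite E, Rabs_mult.
  assert (H := COS_bound c); assert (Rabs (cos c) <= 1) by (apply Rabs_le; lra).
  assert (P := Rabs_pos y); nra.
Qed.

Lemma cos_1_Rabs_le (y : R) : Rabs (cos y - 1) <= y ^ 2.
Proof.
replace y with (2 * (y / 2)) at 1 by field.
rewrite cos_2a_sin.
assert (H := sin_Rabs_le (y / 2)); apply Rsqr_le_abs_1 in H; unfold Rsqr in H.
assert (P := pow2_ge_0 (sin (y / 2))).
rewrite Rabs_left1 by nra; nra.
Qed.

Lemma sin_id_Rabs_le (y : R) : Rabs y <= 1 -> Rabs (sin y - y) <= y ^ 2.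
Proof.
intros Hy; destruct (MVT_gen sin 0 y cos) as [c [Hc E]].
- intros x _; apply is_derive_Reals, derivable_pt_lim_sin.
- intros x _; apply continuity_sin.
- rewrite sin_0, !Rminus_0_r in E; rewrite E.
  replace (cos c * y - y) with ((cos c - 1) * y) by ring.
  rewrite Rabs_mult; assert (H := cos_1_Rabs_le c).
  assert (Hcy : c ^ 2 <= y ^ 2).
  { destruct (Rle_dec 0 y).
    - rewrite Rmin_left, Rmax_right in Hc by lra; apply pow_incr; lra.
    - rewrite Rmin_right, Rmax_left in Hc by lra; nra. }
  assert (P := Rabs_pos y); assert (P' := Rabs_pos (cos c - 1)); nra.
Qed.

(** From exp (-x) >= 1 - x comes exp x <= 1 / (1 - x), and (1 + x + 2 x^2) (1 - x) = 1 + x^2 (1 - 2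
    x) >= 1 for x <= 1/2. *)
Lemma exp_taylor_1 (x : R) : x <= 1 / 2 -> 0 <= exp x - 1 - x <= 2 * x ^ 2.
Proof.
intros Hx; assert (H1 := exp_ineq1_le x); assert (H2 := exp_ineq1_le (- x)).
rewrite exp_Ropp in H2; assert (P := exp_pos x).
split; [lra |].
assert (H3 : exp x * (1 - x) <= 1).
{ apply (Rmult_le_compat_l (exp x)) in H2; [| lra].
  rewrite Rinv_r in H2 by lra; lra. }
assert (H4 : 1 <= (1 + x + 2 * x ^ 2) * (1 - x)).
{ replace ((1 + x + 2 * x ^ 2) * (1 - x)) with (1 + x ^ 2 * (1 - 2 * x)) by ring.
  assert (0 <= x ^ 2 * (1 - 2 * x)) by (apply Rmult_le_pos; [apply pow2_ge_0 | lra]).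
  lra. }
cut (exp x <= 1 + x + 2 * x ^ 2); [lra |].
apply (Rmult_le_reg_r (1 - x)); lra.
Qed.

Lemma Cexp_taylor_1 (w : C) : Cmod w <= 1 / 2 ->
  Cmod (Cexp w - 1 - w) <= 10 * Cmod w ^ 2.
Proof.
intros Hw; destruct w as [x y].
assert (Hx := re_le_Cmod (x, y)); cbn [Re fst] in Hx.
assert (Hy := im_le_Cmod (x, y)); cbn [Im snd] in Hy.
rewrite Cmod2_alt in *; cbn [Re Im fst snd] in *.
assert (X := Rle_abs x); assert (Y := Rle_abs y).
destruct (exp_taylor_1 x) as [E1 E2]; [lra |].
assert (C1 := cos_1_Rabs_le y); assert (S1 := sin_Rabs_le y).
assert (S2 := sin_id_Rabs_le y ltac:(lra)).
eapply Rle_trans; [apply Cmod_le_Re_Im |].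
replace (Re (Cexp (x, y) - 1 - (x, y))%C) with ((exp x - 1 - x) + exp x * (cos y - 1))
  by (unfold Cexp; cbn; ring).
replace (Im (Cexp (x, y) - 1 - (x, y))%C) with ((exp x - 1) * sin y + (sin y - y))
  by (unfold Cexp; cbn; ring).
assert (X' := Rle_abs (- x)); rewrite Rabs_Ropp in X'.
assert (Hexp : exp x <= 2).
{ assert (0 <= (1 / 2 - x) * (1 / 2 + x)) by (apply Rmult_le_pos; lra); nra. }
assert (Hxx : x ^ 2 <= 1 / 2 * Rabs x).
{ rewrite <- pow2_abs; assert (P := Rabs_pos x); nra. }
assert (He1 : Rabs (exp x - 1) <= 2 * Rabs x).
{ replace (exp x - 1) with ((exp x - 1 - x) + x) by ring.
  eapply Rle_trans; [apply Rabs_triang |].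
  rewrite (Rabs_pos_eq (exp x - 1 - x)) by lra; lra. }
assert (R1 : Rabs ((exp x - 1 - x) + exp x * (cos y - 1)) <= 2 * x ^ 2 + 2 * y ^ 2).
{ eapply Rle_trans; [apply Rabs_triang |]; rewrite Rabs_mult.
  rewrite (Rabs_pos_eq (exp x - 1 - x)), (Rabs_pos_eq (exp x))
    by (assumption || left; apply exp_pos).
  assert (P := Rabs_pos (cos y - 1)); assert (Q := exp_pos x); nra. }
assert (R2 : Rabs ((exp x - 1) * sin y + (sin y - y)) <= x ^ 2 + 2 * y ^ 2).
{ eapply Rle_trans; [apply Rabs_triang |]; rewrite Rabs_mult.
  assert (P := Rabs_pos (exp x - 1)); assert (Q := Rabs_pos (sin y)).
  assert (T : Rabs (exp x - 1) * Rabs (sin y) <= 2 * Rabs x * Rabs y)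
    by (apply Rmult_le_compat; assumption).
  rewrite <- (pow2_abs x), <- (pow2_abs y) at 1.
  assert (U := pow2_ge_0 (Rabs x - Rabs y)); rewrite <- (pow2_abs y) in *; nra. }
nra.
Qed.

(* The increments are summable relative to the size of u, by telescoping
   of 1 / (n (n + 1)) = 1 / n - 1 / (n + 1). *)
Lemma Clim_seq_neq_0 (u : nat -> C) (K : R) (N : nat) : 0 <= K ->
  (forall n, (N <= n)%nat -> u n <> RtoC 0) ->
  (forall n, (N <= n)%nat ->
     Cmod (u (S n) - u n) <= K / (INR n * INR (S n)) * Cmod (u n)) ->
  Clim_seq u <> RtoC 0.
Proof.
intros HK Hu Hinc.
(* From n0 on K/n <= 1/4, so the total drift 2 U K / n0 is at most U/2. *)
destruct (INR_unbounded (INR N + 4 * K)) as [n0 Hn0].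
assert (HN := pos_INR N).
destruct (Nat.eq_dec n0 0) as [-> | Hn0']; [cbn in Hn0; lra |].
assert (Hn0pos : 1 <= INR n0) by (change 1 with (INR 1); apply le_INR; lia).
assert (HNn0 : (N <= n0)%nat) by (apply INR_le; lra).
set (U := Cmod (u n0)).
assert (HU : 0 < U) by (apply Cmod_gt_0, Hu; assumption).
assert (Hq : K / INR n0 <= 1 / 4).
{ apply (Rmult_le_reg_r (INR n0)); [lra |].
  unfold Rdiv; rewrite Rmult_assoc, Rinv_l by lra; lra. }
assert (Hinv : forall n, (n0 <= n)%nat -> 1 <= INR n /\ 0 <= K / INR n).
{ intros n Hn; assert (INR n0 <= INR n) by now apply le_INR.
  split; [lra | apply Rdiv_le_0_compat; lra]. }
assert (Htel : forall n, (n0 <= n)%nat ->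
  K / (INR n * INR (S n)) = K / INR n - K / INR (S n)).
{ intros n Hn; rewrite S_INR; destruct (Hinv n Hn); field; lra. }
(* Bootstrap: a drift of at most U/2 so far gives |u n| <= 2 U, which bounds the next increment by 2
   U times a telescoping difference. *)
assert (Hbound : forall n, (n0 <= n)%nat ->
  Cmod (u n - u n0) <= 2 * U * (K / INR n0 - K / INR n)).
{ intros n Hn; induction Hn as [| n Hn IH].
  - replace (u n0 - u n0)%C with (RtoC 0) by ring; rewrite Cmod_0; lra.
  - destruct (Hinv n Hn) as [I1 I2], (Hinv (S n)) as [I3 I4]; [lia |].
    assert (Hsize : Cmod (u n) <= 2 * U).
    { replace (u n) with ((u n - u n0) + u n0)%C by ring.
      eapply Rle_trans; [apply Cmod_triangle |]; fold U; nra. }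
    replace (u (S n) - u n0)%C with ((u (S n) - u n) + (u n - u n0))%C by ring.
    eapply Rle_trans; [apply Cmod_triangle |].
    specialize (Hinc n ltac:(lia)); rewrite Htel in Hinc by assumption.
    assert (0 <= K / INR n - K / INR (S n)).
    { rewrite <- Htel by assumption; apply Rdiv_le_0_compat; [assumption |].
      apply Rmult_lt_0_compat; lra. }
    assert ((K / INR n - K / INR (S n)) * Cmod (u n) <=
            (K / INR n - K / INR (S n)) * (2 * U)) by (apply Rmult_le_compat_l; assumption).
    lra. }
assert (Hsize : forall n, (n0 <= n)%nat -> Cmod (u n) <= 2 * U).
{ intros n Hn; destruct (Hinv n Hn).
  replace (u n) with ((u n - u n0) + u n0)%C by ring.
  eapply Rle_trans; [apply Cmod_triangle |]; fold U.
  specialize (Hbound n Hn); nra. }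
assert (Hcauchy : forall n p, (n0 <= n)%nat -> (n <= p)%nat ->
  Cmod (u p - u n) <= 2 * U * (K / INR n - K / INR p)).
{ intros n p Hn Hp; induction Hp as [| p Hp IH].
  - replace (u n - u n)%C with (RtoC 0) by ring; rewrite Cmod_0; lra.
  - replace (u (S p) - u n)%C with ((u (S p) - u p) + (u p - u n))%C by ring.
    eapply Rle_trans; [apply Cmod_triangle |].
    assert (Hn0p : (n0 <= p)%nat) by lia.
    destruct (Hinv p Hn0p), (Hinv (S p)); [lia |].
    specialize (Hinc p ltac:(lia)); rewrite Htel in Hinc by assumption.
    assert (0 <= K / INR p - K / INR (S p)).
    { rewrite <- Htel by assumption; apply Rdiv_le_0_compat; [assumption |].
      apply Rmult_lt_0_compat; lra. }
    assert ((K / INR p - K / INR (S p)) * Cmod (u p) <=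
            (K / INR p - K / INR (S p)) * (2 * U))
      by (apply Rmult_le_compat_l; [assumption | apply Hsize; assumption]).
    lra. }
(* Convergence of the real and imaginary parts must be established first: [Clim_seq] also has a
   value, possibly 0, on divergent sequences. *)
assert (Hconv : forall h : C -> R, (forall z, Rabs (h z) <= Cmod z) ->
  (forall z w, h (z - w)%C = h z - h w) ->
  is_lim_seq (fun n => h (u n)) (real (Lim_seq (fun n => h (u n))))).
{ intros h Hh Hlin; apply Lim_seq_correct'.
  apply ex_lim_seq_cauchy_corr; intros eps.
  destruct (INR_unbounded (INR n0 + 2 * U * K / eps)) as [n1 Hn1].
  assert (He := cond_pos eps).
  assert (H0 : 0 <= 2 * U * K / eps) by (apply Rdiv_le_0_compat; nra).
  assert (Hn01 : (n0 <= n1)%nat) by (apply INR_le; lra).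
  assert (Hsmall : 2 * U * (K / INR n1) < eps).
  { apply (Rmult_lt_reg_r (INR n1)); [lra |].
    replace (2 * U * (K / INR n1) * INR n1) with (2 * U * K / eps * eps) by (field; lra).
    rewrite (Rmult_comm eps); apply Rmult_lt_compat_r; lra. }
  assert (Hone : forall n p, (n1 <= n)%nat -> (n <= p)%nat ->
    Rabs (h (u p) - h (u n)) < eps).
  { intros n p Hn Hp; rewrite <- Hlin; eapply Rle_lt_trans; [apply Hh |].
    eapply Rle_lt_trans; [apply Hcauchy; lia |].
    destruct (Hinv p ltac:(lia)) as [_ I].
    assert (K / INR n <= K / INR n1).
    { apply Rmult_le_compat_l; [assumption |].
      apply Rinv_le_contravar; [lra | now apply le_INR]. }
    nra. }
  exists n1; intros n p Hn Hp; destruct (le_ge_dec n p).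
  - rewrite Rabs_minus_sym; now apply Hone.
  - now apply Hone. }
assert (LR := Hconv Re re_le_Cmod ltac:(reflexivity)).
assert (LI := Hconv Im im_le_Cmod ltac:(reflexivity)).
intros H0; unfold Clim_seq in H0.
assert (HR := f_equal Re H0); assert (HI := f_equal Im H0).
cbn [Re Im RtoC fst snd] in HR, HI; rewrite HR in LR; rewrite HI in LI.
apply is_lim_seq_spec in LR, LI.
(* A zero limit would give |u n| < U/4 for some large n, whereas |u n| >= U - U/2. *)
destruct (LR (mkposreal (U / 8) ltac:(lra))) as [N1 A1].
destruct (LI (mkposreal (U / 8) ltac:(lra))) as [N2 A2].
cbn [pos] in A1, A2.
set (n := max n0 (max N1 N2)).
specialize (A1 n ltac:(lia)); specialize (A2 n ltac:(lia)).
rewrite Rminus_0_r in A1, A2.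
assert (A3 := Cmod_le_Re_Im (u n)).
specialize (Hbound n ltac:(lia)); destruct (Hinv n ltac:(lia)) as [_ I].
assert (A4 := Cmod_triangle (u n) (- (u n - u n0))); rewrite Cmod_opp in A4.
replace (u n + - (u n - u n0))%C with (u n0) in A4 by ring; fold U in A4.
assert (2 * U * (K / INR n0 - K / INR n) <= 2 * U * (1 / 4))
  by (apply Rmult_le_compat_l; lra).
lra.
Qed.

(** * Nonvanishing of Gamma by Gauss's product *)

Lemma ln_1_inv_bounds (n : nat) : (1 <= n)%nat ->
  / INR (S n) <= ln (INR (S n) / INR n) <= / INR n.
Proof.
intros Hn; assert (H1 : 1 <= INR n) by (change 1 with (INR 1); apply le_INR; lia).
assert (HS := S_INR n).
assert (Hln : forall x, 0 < x -> ln x <= x - 1).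
{ intros x Hx; assert (H := exp_ineq1_le (ln x)); rewrite exp_ln in H; lra. }
split.
- assert (H := Hln (INR n / INR (S n)) ltac:(apply Rdiv_lt_0_compat; lra)).
  rewrite ln_div in H |- * by lra.
  replace (INR n / INR (S n) - 1) with (- / INR (S n)) in H by (rewrite HS; field; lra).
  lra.
- assert (H := Hln (INR (S n) / INR n) ltac:(apply Rdiv_lt_0_compat; lra)).
  replace (INR (S n) / INR n - 1) with (/ INR n) in H by (rewrite HS; field; lra).
  exact H.
Qed.

Lemma Cinv_nonzero (z : C) : z <> RtoC 0 -> (/ z)%C <> RtoC 0.
Proof.
intros Hz K; apply (Cmod_gt_0 z) in Hz as Hm; assert (H := Cmod_inv z Hz).
rewrite K, Cmod_0 in H; assert (P := Rinv_0_lt_compat _ Hm); lra.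
Qed.

Lemma pochhammer_neq_0 (s : C) (n : nat) :
  (forall j : nat, (s + RtoC (INR j))%C <> RtoC 0) -> pochhammer s n <> RtoC 0.
Proof.
intros Hs; induction n as [| n IH]; cbn [pochhammer].
- intros H; apply RtoC_inj in H; lra.
- now apply Cmult_neq_0.
Qed.

(** With L = ln ((n + 1) / n), the ratio of consecutive terms is (n + 1) exp (s L) / (s + n + 1).
    Its first-order parts cancel because (n + 1) L is 1 up to 1/n, leaving 1 + O(1/n^2) as
    [Clim_seq_neq_0] requires. *)
Lemma CGamma_neq_0 (s : C) : (forall j : nat, (s + RtoC (INR j))%C <> RtoC 0) ->
  CGamma s <> RtoC 0.
Proof.
intros Hs; unfold CGamma; set (u := fun n => _).
set (S0 := Cmod s); assert (HS0 : 0 <= S0) by apply Cmod_ge_0.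
(* For n >= N, |s L| <= 1/2 as [Cexp_taylor_1] demands, and |s + n + 1| >= (n + 1) / 2; also n >= 1,
   so the logarithms are of positive numbers. *)
destruct (INR_unbounded (2 * S0 + 1)) as [N HN].
assert (Hfac : forall n, RtoC (INR (fact n)) <> RtoC 0).
{ intros n H; apply RtoC_inj in H; now apply (INR_fact_neq_0 n). }
(* The numerator is at most (|s| + 20 |s|^2) / n and the denominator contributes 2 / (n + 1). *)
apply (Clim_seq_neq_0 u (2 * (S0 + 20 * S0 ^ 2)) N).
- assert (H := pow2_ge_0 S0); lra.
- intros n _; unfold u, Rcpow; unfold Cdiv.
  apply Cmult_neq_0; [apply Cmult_neq_0; [apply Hfac | apply Cexp_neq_0] |].
  now apply Cinv_nonzero, pochhammer_neq_0.
- intros n Hn.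
  assert (HnN : INR N <= INR n) by now apply le_INR.
  assert (Hn1 : 1 <= INR n) by lra.
  assert (Hn1' : (1 <= n)%nat) by (apply INR_le; exact Hn1).
  assert (HSn := S_INR n).
  destruct (ln_1_inv_bounds n Hn1') as [L1 L2].
  set (L := ln (INR (S n) / INR n)) in *.
  assert (HL0 : 0 < / INR (S n)) by (apply Rinv_0_lt_compat; lra).
  set (den := (s + RtoC (INR (S n)))%C).
  assert (Hden : den <> RtoC 0) by apply Hs.
  assert (Hstep : u (S n) = (u n * (RtoC (INR (S n)) * Cexp (s * RtoC L) / den))%C).
  { unfold u, Rcpow.
    change (pochhammer s (S (S n))) with (pochhammer s (S n) * den)%C.
    assert (P := pochhammer_neq_0 s (S n) Hs).
    replace (ln (INR (S n))) with (ln (INR n) + L)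
      by (unfold L; rewrite ln_div by lra; ring).
    rewrite RtoC_plus, Cmult_plus_distr_l, Cexp_plus.
    change (fact (S n)) with (S n * fact n)%nat; rewrite mult_INR, RtoC_mult.
    field; split; assumption. }
  rewrite Hstep.
  replace (u n * (RtoC (INR (S n)) * Cexp (s * RtoC L) / den) - u n)%C
    with (((RtoC (INR (S n)) * (Cexp (s * RtoC L) - 1 - s * RtoC L) +
            s * RtoC (INR (S n) * L - 1)) / den) * u n)%C.
  2:{ unfold den in *; rewrite RtoC_minus, RtoC_mult; field; assumption. }
  rewrite Cmod_mult; apply Rmult_le_compat_r; [apply Cmod_ge_0 |].
  rewrite Cmod_div by assumption.
  assert (Hdenlow : INR (S n) / 2 <= Cmod den).
  { unfold den; assert (T := Cmod_triangle (s + RtoC (INR (S n))) (- s)).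
    replace (s + RtoC (INR (S n)) + - s)%C with (RtoC (INR (S n))) in T by ring.
    rewrite Cmod_opp, Cmod_R, Rabs_pos_eq in T by lra; fold S0 in T; lra. }
  assert (HsL : Cmod (s * RtoC L) = S0 * L).
  { rewrite Cmod_mult, Cmod_R, Rabs_pos_eq by lra; reflexivity. }
  assert (Hin : INR n * / INR n = 1) by (apply Rinv_r; lra).
  assert (HL1 : L <= / INR n) by exact L2.
  assert (Hi0 : 0 < / INR n) by (apply Rinv_0_lt_compat; lra).
  assert (HsL2 : S0 * L <= 1 / 2).
  { apply Rle_trans with (S0 * / INR n); [apply Rmult_le_compat_l; lra |]; nra. }
  assert (HT := Cexp_taylor_1 (s * RtoC L) ltac:(rewrite HsL; exact HsL2)).
  rewrite HsL in HT.
  assert (Hnum : Cmod (RtoC (INR (S n)) * (Cexp (s * RtoC L) - 1 - s * RtoC L) +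
            s * RtoC (INR (S n) * L - 1)) <= (S0 + 20 * S0 ^ 2) * / INR n).
  { eapply Rle_trans; [apply Cmod_triangle |].
    rewrite !Cmod_mult, !Cmod_R; fold S0.
    rewrite (Rabs_pos_eq (INR (S n))) by lra.
    assert (B : 0 <= INR (S n) * L - 1 <= / INR n).
    { split.
      - assert (INR (S n) * / INR (S n) = 1) by (apply Rinv_r; lra); nra.
      - rewrite HSn; nra. }
    rewrite (Rabs_pos_eq (INR (S n) * L - 1)) by lra.
    assert (B2 : INR (S n) * L ^ 2 <= 2 * / INR n).
    { assert (L ^ 2 <= / INR n * / INR n) by nra.
      assert (INR (S n) * / INR n <= 2) by (rewrite HSn; nra).
      assert (INR (S n) * L ^ 2 <= INR (S n) * (/ INR n * / INR n))
        by (apply Rmult_le_compat_l; lra).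
      nra. }
    assert (B3 : INR (S n) * Cmod (Cexp (s * RtoC L) - 1 - s * RtoC L) <=
                 20 * S0 ^ 2 * / INR n).
    { apply Rle_trans with (INR (S n) * (10 * (S0 * L) ^ 2));
        [apply Rmult_le_compat_l; lra |].
      replace (INR (S n) * (10 * (S0 * L) ^ 2)) with (10 * S0 ^ 2 * (INR (S n) * L ^ 2))
        by ring.
      assert (Q := pow2_ge_0 S0).
      apply Rle_trans with (10 * S0 ^ 2 * (2 * / INR n));
        [apply Rmult_le_compat_l; lra | lra]. }
    assert (S0 * (INR (S n) * L - 1) <= S0 * / INR n) by (apply Rmult_le_compat_l; lra).
    lra. }
  assert (Hd0 : 0 < Cmod den) by lra.
  apply Rle_trans with ((S0 + 20 * S0 ^ 2) * / INR n * / (INR (S n) / 2)).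
  + apply Rmult_le_compat; [apply Cmod_ge_0 | left; now apply Rinv_0_lt_compat
      | exact Hnum | apply Rinv_le_contravar; lra].
  + right; field; lra.
Qed.

(** Factor by factor, |a + j| <= (|a| + 1) (1 + j) and |b + j| >= 1 + j. *)
Lemma pochhammer_ratio (a b : C) (n : nat) : 1 <= Re b ->
  Cmod (pochhammer a n / pochhammer b n) <= (Cmod a + 1) ^ n.
Proof.
intros Hb; assert (Ha := Cmod_ge_0 a).
assert (Hbj : forall j, 1 + INR j <= Cmod (b + RtoC (INR j))).
{ intros j; eapply Rle_trans; [| apply re_le_Cmod].
  rewrite re_plus; cbn [Re RtoC fst]; eapply Rle_trans; [| apply Rle_abs].
  unfold Re in *; cbn [fst RtoC]; lra. }
assert (Hbj0 : forall j, (b + RtoC (INR j))%C <> RtoC 0).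
{ intros j K; specialize (Hbj j); rewrite K, Cmod_0 in Hbj; assert (P := pos_INR j); lra. }
induction n as [| n IH].
- cbn [pochhammer pow]; replace (RtoC 1 / RtoC 1)%C with (RtoC 1) by field.
  rewrite Cmod_1; lra.
- cbn [pochhammer pow].
  assert (P := pochhammer_neq_0 b n Hbj0).
  replace (pochhammer a n * (a + RtoC (INR n)) / (pochhammer b n * (b + RtoC (INR n))))%C
    with ((a + RtoC (INR n)) / (b + RtoC (INR n)) * (pochhammer a n / pochhammer b n))%C
    by (field; split; first [assumption | apply Hbj0]).
  rewrite Cmod_mult; apply Rmult_le_compat; try apply Cmod_ge_0; [| assumption].
  rewrite Cmod_div by apply Hbj0.
  assert (Hn := pos_INR n); specialize (Hbj n).
  apply (Rmult_le_reg_r (Cmod (b + RtoC (INR n)))); [lra |].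
  unfold Rdiv; rewrite Rmult_assoc, Rinv_l, Rmult_1_r by lra.
  eapply Rle_trans; [apply Cmod_triangle |].
  rewrite Cmod_R, Rabs_pos_eq by assumption; nra.
Qed.

(** The series is dominated term by term by that of exp ((|a| + 1) t), and both start with 1. Hence
    both Kummer functions tend to 1 as t -> 0. *)
Lemma kummerM_near_1 (a b : C) (t : R) : 1 <= Re b -> 0 < t ->
  Cmod (kummerM a b t - 1) <= exp ((Cmod a + 1) * t) - 1.
Proof.
intros Hb Ht; unfold kummerM.
set (p := fun n => (pochhammer a n / pochhammer b n * RtoC (t ^ n / INR (fact n)))%C).
set (x := (Cmod a + 1) * t).
assert (Hx : 0 <= x) by (assert (P := Cmod_ge_0 a); unfold x; nra).
assert (Hp : forall n, Cmod (p n) <= / INR (fact n) * x ^ n).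
{ intros n; unfold p; rewrite Cmod_mult, Cmod_R.
  assert (F := INR_fact_lt_0 n); assert (T := pow_lt t n Ht).
  rewrite Rabs_pos_eq by (apply Rdiv_le_0_compat; lra).
  unfold x; rewrite Rpow_mult_distr.
  replace (/ INR (fact n) * ((Cmod a + 1) ^ n * t ^ n))
    with ((Cmod a + 1) ^ n * (t ^ n / INR (fact n))) by (unfold Rdiv; ring).
  apply Rmult_le_compat_r; [apply Rdiv_le_0_compat; lra |].
  now apply pochhammer_ratio. }
assert (HE : is_series (fun n => / INR (fact n) * x ^ n) (exp x)).
{ apply is_pseries_R, is_exp_Reals. }
assert (Hpos : forall n, 0 <= / INR (fact n) * x ^ n).
{ intros n; apply Rmult_le_pos; [left; apply Rinv_0_lt_compat, INR_fact_lt_0 |].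
  now apply pow_le. }
assert (Hser : ex_series (fun n => Cmod (p n))).
{ apply (ex_series_le (V := R_CompleteNormedModule)) with (2 := ex_intro _ _ HE).
  intros n; change norm with Rabs; rewrite Rabs_pos_eq by apply Cmod_ge_0; apply Hp. }
apply le_epsilon; intros eps He.
destruct (CSeries_lim p Hser eps He) as [N HN]; specialize (HN N (le_n _)).
replace (CSeries p - 1)%C
  with ((Csum (seq 0 (S N)) p - 1) + - (Csum (seq 0 (S N)) p - CSeries p))%C by ring.
eapply Rle_trans; [apply Cmod_triangle |]; rewrite Cmod_opp.
apply Rplus_le_compat; [| lra].
assert (Hp0 : p 0%nat = RtoC 1).
{ unfold p; cbn [pochhammer pow fact INR]; rewrite Rdiv_1_r; field. }
replace (Csum (seq 0 (S N)) p - 1)%C with (Csum (seq 1 N) p).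
2:{ change (seq 0 (S N)) with (0%nat :: seq 1 N).
    change (Csum (0%nat :: seq 1 N) p) with (p 0%nat + Csum (seq 1 N) p)%C.
    rewrite Hp0; ring. }
eapply Rle_trans; [apply Cmod_Csum |].
apply Rle_trans with (Rsum (seq 1 N) (fun n => / INR (fact n) * x ^ n));
  [apply Rsum_le; intros; apply Hp |].
assert (Hle : Rsum (seq 0 (S N)) (fun n => / INR (fact n) * x ^ n) <= exp x).
{ rewrite Rsum_seq.
  apply (is_lim_seq_incr_compare (sum_n (fun n => / INR (fact n) * x ^ n))); [exact HE |].
  intros n; rewrite sum_Sn; change plus with Rplus; specialize (Hpos (S n)); lra. }
change (seq 0 (S N)) with (0%nat :: seq 1 N) in Hle.
unfold Rsum in *; cbn [fold_right fact INR pow] in Hle; rewrite Rinv_1 in Hle; lra.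
Qed.

Lemma exp_near_1 (A eps : R) : 0 < A -> 0 < eps ->
  exists T, 0 < T /\ forall t, 0 < t < T -> exp (A * t) - 1 <= eps.
Proof.
intros HA He; exists (ln (1 + eps) / A).
assert (HL : 0 < ln (1 + eps)) by (rewrite <- ln_1; apply ln_increasing; lra).
split; [now apply Rdiv_lt_0_compat |]; intros t [Ht1 Ht2].
cut (exp (A * t) <= 1 + eps); [lra |].
rewrite <- (exp_ln (1 + eps)) by lra; left; apply exp_increasing.
apply (Rmult_lt_compat_l A) in Ht2; [| assumption].
replace (A * (ln (1 + eps) / A)) with (ln (1 + eps)) in Ht2 by (field; lra); exact Ht2.
Qed.

(* [t = exp (pi (j + c) / r)] makes [t^(2 i r)] equal to [e (j + c)]. *)
Lemma small_phase (r c T : R) : r <> 0 -> 0 < T ->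
  exists t, 0 < t < T /\ Cexp (RtoC 2 * (Ci * RtoC r) * RtoC (ln t)) = e (RtoC c).
Proof.
intros Hr HT.
assert (HP := PI_RGT_0).
assert (Hj : exists j : Z, PI * (IZR j + c) / r < ln T).
{ destruct (archimed (Rabs (r * ln T / PI) + Rabs c)) as [A1 _].
  set (n := up (Rabs (r * ln T / PI) + Rabs c)) in *.
  assert (B1 := Rle_abs (r * ln T / PI)); assert (B2 := Rle_abs (- (r * ln T / PI))).
  assert (B3 := Rle_abs c); assert (B4 := Rle_abs (- c)).
  rewrite Rabs_Ropp in B2, B4.
  set (X := r * ln T / PI) in *.
  assert (HX : ln T = PI * X / r) by (unfold X; field; lra).
  rewrite HX.
  (* The exponent pi (j + c) / r goes to minus infinity as j does when r > 0, and as j goes to plus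
     infinity when r < 0. *)
  destruct (Rlt_dec 0 r) as [Hr0 | Hr0].
  - exists (- n)%Z; rewrite opp_IZR.
    apply Rmult_lt_compat_r; [now apply Rinv_0_lt_compat |].
    apply Rmult_lt_compat_l; lra.
  - exists n; apply Ropp_lt_cancel.
    replace (- (PI * X / r)) with (PI * X / - r) by (field; lra).
    replace (- (PI * (IZR n + c) / r)) with (PI * (IZR n + c) / - r) by (field; lra).
    apply Rmult_lt_compat_r; [apply Rinv_0_lt_compat; lra |].
    apply Rmult_lt_compat_l; lra. }
destruct Hj as [j Hj]; exists (exp (PI * (IZR j + c) / r)); split; [split |].
- apply exp_pos.
- rewrite <- (exp_ln T HT) at 1; now apply exp_increasing.
- rewrite ln_exp, <- (e_add_IZR c j); unfold e; f_equal.
  apply C_eq; cbn; field; assumption.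
Qed.

Lemma whittakerW_neq_0 (l r : R) : r <> 0 ->
  exists t, 0 < t /\ whittakerW (RtoC l) (Ci * RtoC r) t <> RtoC 0.
Proof.
intros Hr; apply NNPP; intros Hno.
assert (HW : forall t, 0 < t -> whittakerW (RtoC l) (Ci * RtoC r) t = RtoC 0).
{ intros t Ht; destruct (Ceq_dec (whittakerW (RtoC l) (Ci * RtoC r) t) (RtoC 0));
    [assumption | exfalso; apply Hno; now exists t]. }
clear Hno; unfold whittakerW, whittakerM in HW.
set (mu := (Ci * RtoC r)%C) in *.
set (g1 := (CGamma (- (RtoC 2 * mu)) / CGamma (RtoC (1 / 2) - mu - RtoC l))%C) in *.
set (g2 := (CGamma (RtoC 2 * mu) / CGamma (RtoC (1 / 2) + mu - RtoC l))%C) in *.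
(* The Gamma arguments have imaginary parts -2 r and -r, so they avoid the poles. *)
assert (Hg1 : g1 <> RtoC 0).
{ assert (Him : forall s : C, Im s <> 0 -> CGamma s <> RtoC 0).
  { intros s Hs; apply CGamma_neq_0; intros j K; apply Hs.
    apply (f_equal Im) in K; rewrite im_plus in K; cbn [Im RtoC snd] in K.
    unfold Im, RtoC in *; cbn [snd] in *; lra. }
  unfold g1, Cdiv; apply Cmult_neq_0; [| apply Cinv_nonzero]; apply Him;
    unfold mu; cbn; lra. }
set (a1 := (mu - RtoC l + RtoC (1 / 2))%C) in *.
set (a2 := (- mu - RtoC l + RtoC (1 / 2))%C) in *.
set (b1 := (RtoC 1 + RtoC 2 * mu)%C) in *.
set (b2 := (RtoC 1 + RtoC 2 * - mu)%C) in *.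
assert (Hb1 : 1 <= Re b1) by (unfold b1, mu; cbn; lra).
assert (Hb2 : 1 <= Re b2) by (unfold b2, mu; cbn; lra).
set (A := Cmod a1 + Cmod a2 + 1).
assert (HA1 := Cmod_ge_0 a1); assert (HA2 := Cmod_ge_0 a2).
assert (G1 := Cmod_ge_0 g1); assert (G2 := Cmod_ge_0 g2).
(* W vanishing identically is divided by exp (-t/2) t^(1/2 - mu), which leaves the relative phase
   t^(2 mu) of unit modulus. *)
assert (Hrel : forall t, 0 < t ->
  (g1 * Cexp (RtoC 2 * mu * RtoC (ln t)) * kummerM a1 b1 t + g2 * kummerM a2 b2 t)%C
  = RtoC 0).
{ intros t Ht; specialize (HW t Ht).
  set (E := RtoC (exp (- t / 2))) in *.
  assert (HE : E <> RtoC 0).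
  { intros K; apply RtoC_inj in K; assert (P := exp_pos (- t / 2)); lra. }
  assert (HR : Rcpow t (- mu + RtoC (1 / 2)) <> RtoC 0) by apply Cexp_neq_0.
  replace (Rcpow t (mu + RtoC (1 / 2)))
    with (Rcpow t (- mu + RtoC (1 / 2)) * Cexp (RtoC 2 * mu * RtoC (ln t)))%C in HW.
  2:{ unfold Rcpow; rewrite <- Cexp_plus; f_equal; ring. }
  set (X := Rcpow t (- mu + RtoC (1 / 2))) in *.
  set (Y := Cexp _) in *; set (M1 := kummerM a1 b1 t) in *.
  set (M2 := kummerM a2 b2 t) in *.
  transitivity ((g1 * (E * (X * Y) * M1) + g2 * (E * X * M2)) / (E * X))%C;
    [field; split; assumption |].
  rewrite HW; field; split; assumption. }
(* Letting t -> 0 along points where t^(2 mu) = e(c) removes the Kummer functions and keeps an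
   arbitrary phase c. *)
assert (Happrox : forall c eps, 0 < eps -> Cmod (g1 * e (RtoC c) + g2) <= eps).
{ intros c eps He.
  set (eps' := eps / (Cmod g1 + Cmod g2 + 1)).
  assert (He' : 0 < eps') by (apply Rdiv_lt_0_compat; lra).
  destruct (exp_near_1 A eps' ltac:(unfold A; lra) He') as (T & HT & HTs).
  destruct (small_phase r c T Hr HT) as (t & Ht & Hphase); fold mu in Hphase.
  assert (R0 := Hrel t (proj1 Ht)); rewrite Hphase in R0.
  assert (K1 := kummerM_near_1 a1 b1 t Hb1 (proj1 Ht)).
  assert (K2 := kummerM_near_1 a2 b2 t Hb2 (proj1 Ht)).
  specialize (HTs t Ht).
  assert (Hmono : forall a, 0 <= a -> a + 1 <= A -> exp ((a + 1) * t) - 1 <= eps').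
  { intros a Ha HaA; apply Rle_trans with (exp (A * t) - 1); [| assumption].
    apply Rplus_le_compat_r.
    assert (Hat : (a + 1) * t <= A * t) by (apply Rmult_le_compat_r; lra).
    destruct Hat as [Hat | ->]; [left; now apply exp_increasing | apply Rle_refl]. }
  assert (J1 := Hmono (Cmod a1) HA1 ltac:(unfold A; lra)).
  assert (J2 := Hmono (Cmod a2) HA2 ltac:(unfold A; lra)).
  set (M1 := kummerM a1 b1 t) in *; set (M2 := kummerM a2 b2 t) in *.
  replace (g1 * e (RtoC c) + g2)%C
    with (- (g1 * e (RtoC c) * (M1 - 1)) + - (g2 * (M2 - 1)))%C.
  2:{ transitivity (g1 * e (RtoC c) + g2 - (g1 * e (RtoC c) * M1 + g2 * M2))%C;
        [ring | rewrite R0; ring]. }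
  eapply Rle_trans; [apply Cmod_triangle |].
  rewrite !Cmod_opp, !Cmod_mult, Cmod_e, Rmult_1_r.
  assert (Cmod g1 * Cmod (M1 - 1) <= Cmod g1 * eps') by (apply Rmult_le_compat_l; lra).
  assert (Cmod g2 * Cmod (M2 - 1) <= Cmod g2 * eps') by (apply Rmult_le_compat_l; lra).
  assert (eps' * (Cmod g1 + Cmod g2 + 1) = eps) by (unfold eps'; field; lra).
  lra. }
assert (Hzero : forall c, (g1 * e (RtoC c) + g2)%C = RtoC 0).
{ intros c; apply Cmod_eq_0; apply Rle_antisym; [| apply Cmod_ge_0].
  apply le_epsilon; intros eps He; rewrite Rplus_0_l; now apply Happrox. }
apply Hg1.
(* The phases 1 and -1 give g1 + g2 = 0 and -g1 + g2 = 0. *)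
assert (Z0 := Hzero 0); assert (Z1 := Hzero (1 / 2)).
rewrite e_0 in Z0; rewrite e_RtoC in Z1.
replace (2 * PI * (1 / 2)) with PI in Z1 by field; rewrite cos_PI, sin_PI in Z1.
replace ((-1, 0) : C) with (RtoC (-1)) in Z1 by reflexivity.
transitivity (((g1 * RtoC 1 + g2) - (g1 * RtoC (-1) + g2)) / RtoC 2)%C.
- field.
- rewrite Z0, Z1; field.
Qed.

(** * Eigenvalues *)

Lemma usum_tail (A : Z -> C) (s : C) (eps : R) : usum A s -> 0 < eps ->
  exists l0, forall l, NoDup l -> (forall n, In n l -> ~ In n l0) ->
  Cmod (Csum l A) < eps.
Proof.
intros [_ Hs] He; destruct (Hs (eps / 2)) as [l0 H0]; [lra |].
set (l1 := nodup Z.eq_dec l0); exists l1; intros l Hl Hd.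
assert (Hin : incl l0 l1) by (intros n Hn; now apply nodup_In).
assert (H1 := H0 l1 (NoDup_nodup _ _) Hin).
assert (H2 := H0 (l ++ l1)).
rewrite Csum_app in H2.
assert (H3 := Cmod_triangle (Csum l A + Csum l1 A - s) (- (Csum l1 A - s))).
rewrite Cmod_opp in H3.
replace (Csum l A + Csum l1 A - s + - (Csum l1 A - s))%C with (Csum l A) in H3 by ring.
assert (Cmod (Csum l A + Csum l1 A - s) < eps / 2); [| lra].
apply H2.
- apply NoDup_app; [assumption | apply NoDup_nodup | exact Hd].
- intros n Hn; apply in_or_app; right; now apply Hin.
Qed.

(* Averaging over x = j / N keeps only the n divisible by N; as N grows only
   n = 0 survives. *)
Lemma fourier_coeff_0 (A : Z -> C) (alpha : R) :
  (forall x, usum (fun n => A n * e (RtoC ((IZR n + alpha) * x)))%C (RtoC 0)) ->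
  A 0%Z = RtoC 0.
Proof.
intros HA.
assert (H0 : usum A (RtoC 0)).
{ apply (usum_ext (fun n => A n * e (RtoC ((IZR n + alpha) * 0)))%C); [| apply HA].
  intros n; rewrite Rmult_0_r, e_0; ring. }
apply Cmod_eq_0, Rle_antisym; [| apply Cmod_ge_0].
apply le_epsilon; intros eps He; rewrite Rplus_0_l.
destruct (usum_tail A (RtoC 0) (eps / 2) H0) as [l0 Hl0]; [lra |].
(* N exceeds |n| for every n in l0, so l0 contains no nonzero multiple of N. *)
set (N := (1 + fold_right (fun n s => Z.abs n + s) 0 l0)%Z).
assert (HN : (0 < N)%Z /\ forall n, In n l0 -> (Z.abs n < N)%Z).
{ unfold N; clear; induction l0 as [| n l0 [IH1 IH2]]; cbn [fold_right].
  - split; [lia | intros n []].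
  - split; [lia |]; intros p [<- | Hp]; [lia | specialize (IH2 p Hp); lia]. }
destruct HN as [HN HNl].
assert (HN' : 0 < IZR N) by now apply IZR_lt.
assert (Hav : usum (fun n => A n * if (n mod N =? 0)%Z then RtoC 1 else RtoC 0)%C
                   (RtoC 0)).
(* The factor e(-alpha j / N) removes the shift alpha, so that averaging over j tests n modulo N. *)
{ apply (usum_ext (fun n => RtoC (/ IZR N) * Csum (zrange N) (fun j =>
    e (RtoC (- alpha * (IZR j / IZR N))) *
    (A n * e (RtoC ((IZR n + alpha) * (IZR j / IZR N)))))))%C.
  - intros n.
    rewrite (Csum_ext _ _ (fun j => A n * e (RtoC (IZR (j * n) / IZR N)))%C).
    + rewrite Csum_scal, Csum_roots_of_unity by assumption.
      destruct (n mod N =? 0)%Z; [| ring].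
      unfold CZ; transitivity (A n * (RtoC (/ IZR N) * RtoC (IZR N)))%C; [ring |].
      rewrite <- RtoC_mult, Rinv_l by lra; reflexivity.
    + intros j _.
      transitivity (A n * (e (RtoC (- alpha * (IZR j / IZR N))) *
        e (RtoC ((IZR n + alpha) * (IZR j / IZR N)))))%C; [ring |].
      f_equal; rewrite <- e_Rplus; do 2 f_equal; rewrite mult_IZR; field; lra.
  - replace (RtoC 0) with (RtoC (/ IZR N) * Csum (zrange N) (fun j =>
      e (RtoC (- alpha * (IZR j / IZR N))) * RtoC 0))%C.
    + apply usum_scal, usum_Csum; intros j _; apply usum_scal, HA.
    + rewrite Csum_0; [ring | intros; ring]. }
destruct Hav as [_ Hav]; destruct (Hav (eps / 2)) as [l1 Hl1]; [lra |].
set (l := nodup Z.eq_dec (0 :: l1)%Z).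
assert (Hl : NoDup l) by apply NoDup_nodup.
assert (Hl1l : incl l1 l) by (intros n Hn; apply nodup_In; now right).
specialize (Hl1 l Hl Hl1l).
set (B := fun n => (A n * if (n mod N =? 0)%Z then RtoC 1 else RtoC 0)%C) in *.
set (rest := filter (fun n => negb (n =? 0)%Z) l).
assert (Hrest : Csum l B = (A 0%Z + Csum (filter (fun n => (n mod N =? 0)%Z) rest) A)%C).
{ rewrite (Csum_perm l (0%Z :: rest)).
  - change (Csum (0%Z :: rest) B) with (B 0%Z + Csum rest B)%C; f_equal.
    + unfold B; rewrite Z.mod_0_l, Z.eqb_refl by lia; ring.
    + rewrite <- (Csum_filter (fun n => (n mod N =? 0)%Z) rest).
      * apply Csum_ext; intros n Hn; apply filter_In in Hn as [_ Hn].
        unfold B; rewrite Hn; ring.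
      * intros n _ Hn; unfold B; rewrite Hn; ring.
  - apply NoDup_Permutation; [assumption | |].
    + constructor; [| now apply NoDup_filter].
      intros H; apply filter_In in H as [_ H]; discriminate.
    + intros n; cbn [In]; unfold rest; rewrite filter_In.
      destruct (Z.eqb_spec n 0) as [-> | Hn0]; cbn [negb]; split.
      * now left.
      * intros _; apply nodup_In; now left.
      * intros Hn; now right.
      * intros [E | [Hn _]]; [now symmetry in E | assumption]. }
rewrite Hrest in Hl1.
assert (Hsmall : Cmod (Csum (filter (fun n => (n mod N =? 0)%Z) rest) A) < eps / 2).
{ apply Hl0; [now apply NoDup_filter, NoDup_filter |].
  intros n Hn Hn0; specialize (HNl n Hn0).
  apply filter_In in Hn as [Hn Hmod]; apply filter_In in Hn as [_ Hnz].
  apply Bool.negb_true_iff, Z.eqb_neq in Hnz; apply Z.eqb_eq in Hmod.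
  apply Z.mod_divide, Z.divide_abs_r, Z.divide_pos_le in Hmod; lia. }
set (S := Csum _ A) in *.
assert (T := Cmod_triangle (A 0%Z + S - RtoC 0) (- S)); rewrite Cmod_opp in T.
replace (A 0%Z + S - RtoC 0 + - S)%C with (A 0%Z) in T by ring.
lra.
Qed.

Lemma calW_horizontal (n k : Z) (r x y : R) :
  calW n k r (x, y) = (calW n k r (0, y) * e (RtoC ((IZR n + IZR k / 12) * x)))%C.
Proof.
unfold calW, shift; cbn [Re Im fst snd]; rewrite Rmult_0_r, e_0; ring.
Qed.

Lemma fourier_unique_0 (k : Z) (r : R) (b : Z -> C) : (1 <= k <= 11)%Z -> r <> 0 ->
  (forall z, upper z -> usum (fun n => b n * calW n k r z)%C (RtoC 0)) ->
  b 0%Z = RtoC 0.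
Proof.
intros Hk Hr Hb.
assert (Hs : 0 < shift k 0).
{ unfold shift; assert (1 <= IZR k) by (apply IZR_le; lia); lra. }
destruct (whittakerW_neq_0 (IZR k / 2 * 1) r Hr) as (t & Ht & HW).
assert (HP := PI_RGT_0).
(* The height at which the Whittaker factor of index 0 is evaluated at t, where it does not
   vanish. *)
set (y := t / (4 * PI * shift k 0)).
assert (Hy : 0 < y) by (apply Rdiv_lt_0_compat; [assumption | nra]).
assert (H0 : (b 0%Z * calW 0 k r (0, y))%C = RtoC 0).
{ apply (fourier_coeff_0 (fun n => b n * calW n k r (0, y))%C (IZR k / 12)).
  intros x; apply (usum_ext (fun n => b n * calW n k r (x, y))%C).
  - intros n; rewrite calW_horizontal; ring.
  - now apply Hb. }
destruct (Ceq_dec (b 0%Z) (RtoC 0)) as [| Hb0]; [assumption | exfalso].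
revert H0; apply Cmult_neq_0; [assumption |].
unfold calW; cbn [Re Im fst snd]; rewrite Rmult_0_r, e_0, Cmult_1_r.
rewrite (sign_eq_1 _ Hs), (Rabs_pos_eq (shift k 0)) by lra.
replace (4 * PI * shift k 0 * y) with t by (unfold y; field; lra).
apply Cmult_neq_0; [| assumption].
intros K; apply RtoC_inj in K.
assert (P := Rinv_0_lt_compat _ (sqrt_lt_R0 _ Hs)); lra.
Qed.

(** Let N = 12 / gcd(12, k). Then m - 1 = N w and k (m - 1) / 12 = D w for some w, and w is prime to
    m because m - N w = 1; so the factor w drops out of the gcd with m. *)
Lemma gcd_bigD (k m : Z) : (1 <= k <= 11)%Z -> ((k * m) mod 12 = k mod 12)%Z ->
  Z.gcd m (0 - k * (m - 1) / 12) = Z.gcd (bigD k) m.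
Proof.
intros Hk Hkm; destruct (multiple_exact k m Hkm) as [q Hq].
rewrite Hq, Z.div_mul, Z.sub_0_l, Z.gcd_opp_r by lia.
assert (Hw : exists w, (m - 1 = (12 / Z.gcd 12 k) * w)%Z /\ (q = bigD k * w)%Z).
{ assert (Hk' : (k = 1 \/ k = 2 \/ k = 3 \/ k = 4 \/ k = 5 \/ k = 6 \/ k = 7 \/
                 k = 8 \/ k = 9 \/ k = 10 \/ k = 11)%Z) by lia.
  clear Hk Hkm; exists ((m - 1) / (12 / Z.gcd 12 k))%Z.
  decompose [or] Hk'; subst k; clear Hk';
    match goal with |- context [bigD ?x] =>
      let y := eval vm_compute in (bigD x) in change (bigD x) with y end;
    match goal with |- context [(12 / Z.gcd 12 ?x)%Z] =>
      let y := eval vm_compute in (12 / Z.gcd 12 x)%Z in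
      change (12 / Z.gcd 12 x)%Z with y end;
    Z.div_mod_to_equations; lia. }
destruct Hw as (w & Hw & ->).
assert (Hco : Z.gcd m w = 1%Z).
{ apply Z.bezout_1_gcd; exists 1%Z, (- (12 / Z.gcd 12 k))%Z; lia. }
apply Z.divide_antisym_nonneg; try apply Z.gcd_nonneg; apply Z.gcd_greatest.
- apply (Z.gauss _ w).
  + rewrite Z.mul_comm; apply Z.gcd_divide_r.
  + assert (H := Z.gcd_divide_l m (bigD k * w)).
    assert (H' : (Z.gcd (Z.gcd m (bigD k * w)) w | 1)%Z).
    { rewrite <- Hco; apply Z.gcd_greatest; [| apply Z.gcd_divide_r].
      eapply Z.divide_trans; [apply Z.gcd_divide_l | exact H]. }
    apply Z.divide_1_r_nonneg; [apply Z.gcd_nonneg | exact H'].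
- apply Z.gcd_divide_l.
- apply Z.gcd_divide_r.
- apply Z.divide_mul_l, Z.gcd_divide_l.
Qed.

(** For 1 <= k <= 11 the number D is 1 or one of the primes 2, 3, 5, 7, 11, so its gcd with m is 1
    or D. This is the origin of the two cases of the eigenvalue formula. *)
Lemma bigD_divisors (k m : Z) : (1 <= k <= 11)%Z -> (0 < m)%Z ->
  divisors (Z.gcd (bigD k) m) =
  if (Z.gcd (bigD k) m =? 1)%Z then (1 :: nil)%Z else (1 :: bigD k :: nil)%Z.
Proof.
intros Hk Hm.
assert (Hg := Z.gcd_divide_l (bigD k) m); assert (H0 := Z.gcd_nonneg (bigD k) m).
destruct Hg as [s Hs].
assert (Hk' : (k = 1 \/ k = 2 \/ k = 3 \/ k = 4 \/ k = 5 \/ k = 6 \/ k = 7 \/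
               k = 8 \/ k = 9 \/ k = 10 \/ k = 11)%Z) by lia.
clear Hk; revert Hs H0.
assert (Hcase : forall D g : Z, D = bigD k -> (0 <= g)%Z -> D = (s * g)%Z ->
  (g = 1 \/ g = D)%Z).
{ intros D g HD Hg E.
  assert (Hle : (g <= D)%Z).
  { apply Z.divide_pos_le; [| now exists s].
    subst D; decompose [or] Hk'; subst k; reflexivity. }
  decompose [or] Hk'; subst k; vm_compute in HD; subst D;
  match goal with H : (g <= ?n)%Z |- _ =>
    assert (Hg' : (g = 0 \/ g = 1 \/ g = 2 \/ g = 3 \/ g = 4 \/ g = 5 \/ g = 6 \/ g = 7 \/
      g = 8 \/ g = 9 \/ g = 10 \/ g = 11)%Z) by lia end;
  decompose [or] Hg'; subst g; lia. }
generalize (Z.gcd (bigD k) m); intros g Hs Hg.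
destruct (Hcase (bigD k) g eq_refl Hg Hs) as [-> | ->]; [reflexivity |].
decompose [or] Hk'; subst k; reflexivity.
Qed.

Lemma hecke_coeff_0 (k m : Z) (c : Z -> C) : (1 <= k <= 11)%Z -> (0 < m)%Z ->
  ((k * m) mod 12 = k mod 12)%Z ->
  hecke_coeff k m c 0 =
  if (Z.gcd (bigD k) m =? 1)%Z then c (k * (m - 1) / 12)%Z
  else (c (k * (m - 1) / 12)%Z +
        chi k (bigD k) * c (k * (m - bigD k ^ 2) / (12 * bigD k ^ 2))%Z)%C.
Proof.
intros Hk Hm Hkm; unfold hecke_coeff; rewrite gcd_bigD, bigD_divisors by assumption.
assert (H1 : (chi k 1 * c (hecke_index k m 0 1))%C = c (k * (m - 1) / 12)%Z).
{ unfold hecke_index; rewrite chi_e.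
  replace (3 * k * (1 - 1))%Z with 0%Z by ring.
  replace (0 / 12) with 0 by field; rewrite e_0, Cmult_1_l; do 2 f_equal; ring. }
assert (HD : hecke_index k m 0 (bigD k) =
             (k * (m - bigD k ^ 2) / (12 * bigD k ^ 2))%Z)
  by (unfold hecke_index; f_equal; ring).
destruct (Z.gcd (bigD k) m =? 1)%Z; unfold Csum; cbn [fold_right]; rewrite H1.
- ring.
- rewrite HD; ring.
Qed.

Theorem proposition4p1
  (k : Z) (hk : (1 <= k <= 11)%Z)
  (v : SL2Z -> C) (hv : is_eta_multiplier k v)
  (r : R) (hr : 1 / 4 < 1 / 4 + r ^ 2)
  (m : Z) (hm : (0 < m)%Z) (hkm : ((k * m) mod 12 = k mod 12)%Z) :
  (* the summands depend only on b mod d, and T maps the space to itself *)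
  (forall f : C -> C, maass v k r f ->
     (forall (a d b : Z) (z : C), (a * d = m)%Z -> (0 < d)%Z -> upper z ->
        hecke_term k f a d (b + d) z = hecke_term k f a d b z) /\
     maass v k r (hecke k m f)) /\
  (forall (f : C -> C) (c : Z -> C), maass v k r f ->
     has_fourier_coeffs k r f c ->
     has_fourier_coeffs k r (hecke k m f) (hecke_coeff k m c)) /\
  (forall (f : C -> C) (c : Z -> C) (lam : C), maass v k r f ->
     has_fourier_coeffs k r f c ->
     (forall z, upper z -> hecke k m f z = (lam * f z)%C) ->
     c 0%Z <> RtoC 0 ->
     lam = (/ c 0%Z *
       (if (Z.gcd (bigD k) m =? 1)%Z
        then c (k * (m - 1) / 12)%Z
        else c (k * (m - 1) / 12)%Z +
             chi k (bigD k) *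
             c (k * (m - bigD k ^ 2) / (12 * bigD k ^ 2))%Z))%C).
Proof.
split; [| split].
- intros f Hf; split; [| now apply maass_hecke].
  intros a d b z Had Hd Hz.
  apply (hecke_term_periodic k v m); try assumption.
  apply (maass_aut v k r f Hf).
- intros f c _ Hc z Hz; now apply hecke_fourier.
- intros f c lam _ Hc Heig Hc0.
  assert (Hr : r <> 0) by (intros ->; lra).
  assert (H0 : (hecke_coeff k m c 0 + - lam * c 0%Z)%C = RtoC 0).
  { apply (fourier_unique_0 k r (fun n => hecke_coeff k m c n + - lam * c n)%C hk Hr).
    intros z Hz.
    apply (usum_ext (fun n => hecke_coeff k m c n * calW n k r z +
                              - lam * (c n * calW n k r z))%C); [intros; ring |].
    replace (RtoC 0) with (hecke k m f z + - lam * f z)%C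
      by (rewrite Heig by assumption; ring).
    apply usum_plus; [| apply usum_scal]; apply zsum_eq_usum;
      [now apply hecke_fourier | now apply Hc]. }
  rewrite <- hecke_coeff_0 by assumption.
  transitivity (/ c 0%Z * (lam * c 0%Z))%C; [field; assumption |].
  f_equal; transitivity (hecke_coeff k m c 0 - (hecke_coeff k m c 0 + - lam * c 0%Z))%C;
    [ring | rewrite H0; ring].
Qed.
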